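(* Let $V=H_3(\mathbb{O})$ be the exceptional Hermitian Jordan triple system of dimension 27, let $f_1(x,x)=1-(x\mid x)+(x^{\#}\mid x^{\#})-|\det x|^2$, $f_2(x,x)=3-2(x\mid x)+(x^{\#}\mid x^{\#})$, $f_3(x,x)=3-(x\mid x)$, let $\Omega=\{x\in V: f_1(x,x)>0,\ f_2(x,x)>0,\ f_3(x,x)>0\}$, and for $k=1,2,3$ let $\partial_k\Omega=\{x\in V : f_j(x,x)=0\ (1\le j\le k),\ f_m(x,x)>0\ (k<m\le 3)\}$. Then: 1. $\partial_1\Omega$, which is defined by $f_1(x,x)=0$, $f_2(x,x)>0$, $f_3(x,x)>0$, is a locally closed submanifold of real codimension $1$. It contains the manifold $\mathcal{E}_1=\{e\in V: (e\mid e)=1,\ e^{\#}=0\}$ of minimal tripotents of $V$. For $e\in\mathcal{E}_1$, the normal direction to $\partial_1\Omega$ at $e$ is $e$ and the direction of the tangent space $T_e(\partial_1\Omega)$ is $\mathrm{i}\mathbb{R}e\oplus V_1(e)\oplus V_0(e)$. The Peirce subspaces $V_1(e)$ and $V_0(e)$ have complex dimensions $16$ and $10$ respectively. The Jordan triple subsystem $V_0(e)$ is isomorphic to the classical Hermitian Jordan triple system of type $IV_{10}$, and the domain $\Omega(e)\subset V_0(e)$ is isomorphic to a Lie ball of dimension $10$. 2. $\partial_2\Omega$ is a locally closed Cauchy–Riemann submanifold of real dimension $44$ and CR type $(17,10)$; it contains the manifold $\mathcal{E}_2=\{e\in V: (e\mid e)=2,\ (e^{\#}\mid e^{\#})=1,\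 \det e=0\}$ of rank $2$ tripotents of $V$. For $e\in\mathcal{E}_2$, the normal direction $V_2^+(e)$ to $\partial_2\Omega$ at $e$ has real dimension $10$, and the direction of the tangent space is $\overrightarrow{T_e(\partial_2\Omega)}=\mathrm{i}V_2^+(e)\oplus V_1(e)\oplus V_0(e)$, where $V_1(e)$ and $V_0(e)$ have complex dimensions $16$ and $1$ respectively. Moreover $$\partial_2\Omega\cap\bigl(e+\overrightarrow{T_e(\partial_2\Omega)}\bigr)=\partial_2\Omega\cap\bigl(e+V_0(e)\bigr)=e+\Omega(e),$$ where $\Omega(e)$ is the unit disc of the one-dimensional Jordan triple subsystem $V_0(e)$. 3. $\partial_3\Omega$ equals the set $\mathcal{E}_3=\{e\in V: (e\mid e)=3,\ (e^{\#}\mid e^{\#})=3,\ |\det e|^2=1\}$ of maximal tripotents, and it is compact and totally real, of real dimension $27$.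
   Context: Octonions. $\mathbb{O}_c$ is the real 8-dimensional division algebra of octonions with positive definite multiplicative norm $n$, Cayley conjugation $a\mapsto\widetilde a$ ($a\widetilde a=n(a)1$), and bilinear form $(a:b)=n(a+b)-n(a)-n(b)$ (so $(a:a)=2n(a)$). $\mathbb{O}=\mathbb{C}\otimes_{\mathbb{R}}\mathbb{O}_c$ is the complex octonion algebra; product, $n$, $\widetilde{\ }$ and $(\,:\,)$ are extended complex (multi)linearly/quadratically, and $a\mapsto\overline a$ is complex conjugation with respect to $\mathbb{O}_c$. $H_3(\mathbb{O})$ is the 27-dimensional complex vector space of matrices $a=\begin{pmatrix}\alpha_1&a_3&\widetilde{a_2}\\ \widetilde{a_3}&\alpha_2&a_1\\ a_2&\widetilde{a_1}&\alpha_3\end{pmatrix}$, $\alpha_i\in\mathbb{C}$, $a_i\in\mathbb{O}$, written $a=\sum\alpha_ie_i+\sum F_i(a_i)$. Put $(a:b)=\sum\alpha_i\beta_i+\sum(a_i:b_i)$; $a^{\#}=\sum_i(\alpha_j\alpha_k-n(a_i))e_i+\sum_iF_i\bigl((a_ja_k)^{\sim}-\alpha_ia_i\bigr)$, where $(i,j,k)$ is the even (cyclic) permutation of $(1,2,3)$ starting with $i$; $a\times b=(a+b)^{\#}-a^{\#}-b^{\#}$; $\det a=\frac13(a^{\#}:a)$; $\overline a=\sum\overline{\alpha_i}e_i+\sum F_i(\overline{a_i})$; $(a\mid b)=(a:\overline b)$. The triple product is $\{xyz\}=D(x,y)z=(x\mid y)z+(z\mid y)x-(x\times z)\times\overline y$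 and $Q(x)y=\frac12\{xyx\}=(x\mid y)x-x^{\#}\times\overline y$. This is a positive Hermitian Jordan triple system. Tripotents. $e$ is a tripotent if $\{eee\}=2e$. Two tripotents $e,f$ are orthogonal if $D(e,f)=0$. A nonzero tripotent is minimal if it is not the sum of two nonzero orthogonal tripotents; it has rank $k$ if it is a sum of $k$ pairwise orthogonal minimal tripotents; it is maximal if no nonzero tripotent is orthogonal to it. The Peirce subspaces are $V_j(e)=\{y: D(e,e)y=jy\}$, $j=0,1,2$; $V=V_0(e)\oplus V_1(e)\oplus V_2(e)$; $V_2^+(e)=\{x\in V: Q(e)x=x\}$, a real form of $V_2(e)$. $V_0(e)$ is a Jordan triple subsystem. For a positive Hermitian Jordan triple system $U$ of rank $r$ with generic minimal polynomial $m(T,x,y)$, the associated bounded symmetric domain is $\{x\in U:\frac1{k!}\frac{d^k}{dT^k}m(T,x,x)|_{T=1}>0,\ k=0,\dots,r-1\}$; here, with $x^{(1,y)}=x$, $x^{(k+1,y)}=\frac12D(x,y)x^{(k,y)}$, the rank $r$ is the maximal dimension of the span of the $x^{(k,y)}$ ($k\ge1$), and $m(T,x,y)=T^r-m_1(x,y)T^{r-1}+\cdots+(-1)^rm_r(x,y)$ is the unique polynomial with coefficients polynomial in $(x,\overline y)$ such that $x^{(r+1,y)}-m_1(x,y)x^{(r,y)}+\cdots+(-1)^rm_r(x,y)x^{(1,y)}=0$ for all $x,y$. $\Omega(e)$ denotes the bounded symmetric domain associated with $V_0(e)$; $\Omega$ above is the one associated with $V$. Type $IV_n$: $\mathbb{C}^n$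 with $\{xyz\}=(x\mid y)z+(z\mid y)x-(x:z)\overline y$, where $(x:z)=\sum x_iz_i$ and $(x\mid y)=\sum x_i\overline{y_i}$ (up to isomorphism of triple systems). Its symmetric domain is (linearly equivalent to) the Lie ball $\{z\in\mathbb{C}^n:1-2\|z\|^2+|\sum z_i^2|^2>0,\ \|z\|<1\}$. Normal directions are taken with respect to the real inner product $\operatorname{Re}(x\mid y)$ (''the normal direction is $e$'' means the normal space is $\mathbb{R}e$). A real submanifold $M$ of a complex vector space is a Cauchy–Riemann manifold of CR type $(s,t)$ if at each point the maximal complex subspace of the tangent direction has complex dimension $s$ and $\dim_{\mathbb{R}}M=2s+t$; it is totally real if that complex subspace is $0$. *)

(* Defs.v *)
From HB Require Import structures.
From mathcomp Require Import all_boot all_order all_algebra.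
From mathcomp Require Import all_classical all_reals all_analysis.
From mathcomp Require Import complex ring.
Import Order.TTheory GRing.Theory Num.Theory numFieldNormedType.Exports.
Import VectorInternalTheory.

Set Implicit Arguments.
Unset Strict Implicit.
Unset Printing Implicit Defensive.

Local Open Scope classical_set_scope.
Local Open Scope complex_scope.
Local Open Scope ring_scope.

Section SetSums.
Context {U : nmodType}.

Definition translate (e : U) (A : set U) : set U := [set e + a | a in A].

Definition sum3 (A B D : set U) : set U :=
  [set x | exists a b d, [/\ A a, B b, D d & x = a + b + d]].

Definition direct3 (A B D : set U) : Prop :=
  forall a b d, A a -> B b -> D d -> a + b + d = 0 -> [/\ a = 0, b = 0 & d = 0].

End SetSums.

Section RealSubmanifolds.
Context {R : realType} {E : normedModType R}.

Fixpoint Ck_on (k : nat) (O : set E) (f : E -> R) : Prop :=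
  match k with
  | 0 => {in O, continuous f}
  | k'.+1 => (forall x, O x -> differentiable f x) /\
             (forall v, Ck_on k' O ('D_v f))
  end.

Definition smooth_on (O : set E) (f : E -> R) : Prop :=
  forall k, Ck_on k O f.

Definition defining_functions (M : set E) (p : E) (q : nat)
    (O : set E) (F : 'I_q -> E -> R) : Prop :=
  [/\ open O /\ O p,
      forall i, smooth_on O (F i),
      forall c : 'I_q -> R,
        (forall v, \sum_(i < q) c i * 'd (F i) p v = 0) -> forall i, c i = 0
    & M `&` O = [set x | O x /\ forall i, F i x = 0] ].

Definition locally_closed (M : set E) : Prop :=
  exists O K : set E, [/\ open O, closed K & M = O `&` K].

End RealSubmanifolds.

Section ComplexSpaces.
Context {R : realType} {U : vectType R[i]}.

(* The real vector space underlying U, in coordinates: all topological and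
   real-differential notions on U are read through this R-linear bijection
   onto R^(2 dim U). *)
Definition realify (x : U) : 'rV[R]_(dim U + dim U) :=
  row_mx (map_mx (@complex.Re R) (v2r x)) (map_mx (@complex.Im R) (v2r x)).

Definition is_real_dim (A : set U) (d : nat) : Prop :=
  exists W : {vspace 'rV[R]_(dim U + dim U)},
    realify @` A = [set` W] /\ \dim W = d.

Definition submanifold_codim (q : nat) (M : set U) : Prop :=
  forall p, M p -> exists (O : set _) (F : 'I_q -> _),
    defining_functions (realify @` M) (realify p) O F.

Definition submanifold (d : nat) (M : set U) : Prop :=
  exists q : nat, (q + d = dim U + dim U)%N /\ submanifold_codim q M.

(* T is the direction of the tangent space of M at p, i.e. the common kernel of
   the differentials of local defining functions; it does not depend on them. *)
Definition tangent_direction (M : set U) (p : U) (T : set U) : Prop :=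
  exists (q : nat) (O : set _) (F : 'I_q -> _),
    defining_functions (realify @` M) (realify p) O F /\
    T = [set v | forall i, 'd (F i) (realify p) (realify v) = 0].

Definition max_complex_subspace (T : set U) (W : {vspace U}) : Prop :=
  [set` W] `<=` T /\
  forall W' : {vspace U}, [set` W'] `<=` T -> (W' <= W)%VS.

Definition CR_submanifold (s t : nat) (M : set U) : Prop :=
  submanifold (2 * s + t) M /\
  forall p, M p -> exists T W,
    [/\ tangent_direction M p T, max_complex_subspace T W & \dim W = s].

Definition totally_real (M : set U) : Prop :=
  (exists d, submanifold d M) /\
  forall p, M p -> exists T,
    tangent_direction M p T /\ max_complex_subspace T 0%VS.

End ComplexSpaces.

Section TripleSystems.
Context {R : realType} {U : vectType R[i]}.
Variable tr : U -> U -> U -> U.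

Definition triple_closed (W : {vspace U}) : Prop :=
  forall x y z, x \in W -> y \in W -> z \in W -> tr x y z \in W.

Definition tripotent (e : U) : Prop := tr e e e = 2 *: e.

Definition orthogonal_tripotents (e f : U) : Prop := forall z, tr e f z = 0.

Definition minimal_tripotent (e : U) : Prop :=
  [/\ tripotent e, e != 0
    & ~ exists e1 e2, [/\ tripotent e1 /\ e1 != 0, tripotent e2 /\ e2 != 0,
          orthogonal_tripotents e1 e2 & e = e1 + e2] ].

Definition rank_tripotent (k : nat) (e : U) : Prop :=
  tripotent e /\ exists c : 'I_k -> U,
    [/\ forall i, minimal_tripotent (c i),
        forall i j, i != j -> orthogonal_tripotents (c i) (c j)
      & e = \sum_(i < k) c i].

Definition maximal_tripotent (e : U) : Prop :=
  tripotent e /\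
  forall f, tripotent f -> orthogonal_tripotents e f -> f = 0.

(* tr e e is assumed to be linear here, see peirceE below *)
Definition peirce (j : nat) (e : U) : {vspace U} :=
  lker (linfun (tr e e) - j%:R *: \1%VF).

Definition peirce2_plus (e : U) : set U := [set x | 2^-1 *: tr e x e = x].

(* x^(k, y), for k >= 1 *)
Definition jpow (x y : U) (k : nat) : U :=
  iter k.-1 (fun z => 2^-1 *: tr x y z) x.

(* In the next three definitions W is a triple subsystem of (U, tr), considered
   as a triple system in its own right; W = fullv is the case of U itself. *)
Definition is_rank (W : {vspace U}) (r : nat) : Prop :=
  (exists x y N, [/\ x \in W, y \in W
     & \dim <<[seq jpow x y k | k <- iota 1 N]>> = r]) /\
  (forall x y N, x \in W -> y \in W ->
     (\dim <<[seq jpow x y k | k <- iota 1 N]>> <= r)%N).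

(* functions of (x, y) which are polynomial in (x, conjugate of y) *)
Inductive sesqui_polynomial : (U -> U -> R[i]) -> Prop :=
| SPconst c : sesqui_polynomial (fun _ _ => c)
| SPlin (phi : 'Hom(U, R[i]^o)) : sesqui_polynomial (fun x _ => phi x)
| SPconj (phi : 'Hom(U, R[i]^o)) : sesqui_polynomial (fun _ y => (phi y)^*)
| SPadd p q : sesqui_polynomial p -> sesqui_polynomial q ->
    sesqui_polynomial (fun x y => p x y + q x y)
| SPmul p q : sesqui_polynomial p -> sesqui_polynomial q ->
    sesqui_polynomial (fun x y => p x y * q x y).

Definition generic_minimal_polynomial (W : {vspace U}) (r : nat)
    (m : U -> U -> {poly R[i]}) : Prop :=
  [/\ forall k, sesqui_polynomial (fun x y => (m x y)`_k),
      forall x y, m x y \is monic /\ size (m x y) = r.+1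
    & forall x y, x \in W -> y \in W ->
        \sum_(k < r.+1) (m x y)`_k *: jpow x y k.+1 = 0].

(* p^`N(k) is the k-th derivative of p divided by k! *)
Definition symmetric_domain (W : {vspace U}) : set U :=
  [set x | x \in W /\ exists r m,
     [/\ is_rank W r, generic_minimal_polynomial W r m
       & forall k, (k < r)%N -> 0 < ((m x x)^`N(k)).[1]] ].

End TripleSystems.

Definition triple_isomorphic {R : realType} {U U' : vectType R[i]}
    (tr : U -> U -> U -> U) (W : {vspace U})
    (tr' : U' -> U' -> U' -> U') (W' : {vspace U'}) : Prop :=
  exists f : 'Hom(U, U'),
    [/\ (f @: W)%VS = W', (W :&: lker f)%VS = 0%VS
      & forall x y z, x \in W -> y \in W -> z \in W ->
          f (tr x y z) = tr' (f x) (f y) (f z)].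

Definition linearly_equivalent {R : realType} {U U' : vectType R[i]}
    (W : {vspace U}) (A : set U) (W' : {vspace U'}) (A' : set U') : Prop :=
  exists f : 'Hom(U, U'),
    [/\ (f @: W)%VS = W', (W :&: lker f)%VS = 0%VS & f @` A = A'].

Section TypeIV.
Context {R : realType} {n : nat}.
Implicit Types x y z : 'rV[R[i]]_n.

Definition dotIV x y : R[i] := \sum_(i < n) x ord0 i * y ord0 i.
Definition hermIV x y : R[i] := \sum_(i < n) x ord0 i * (y ord0 i)^*.

Definition tripleIV x y z : 'rV[R[i]]_n :=
  hermIV x y *: z + hermIV z y *: x - dotIV x z *: map_mx (@conjc R) y.

Definition lie_ball : set 'rV[R[i]]_n :=
  [set z | 0 < 1 - 2 * hermIV z z + `|dotIV z z| ^+ 2 /\ hermIV z z < 1].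

End TypeIV.

Section CayleyDickson.
Variable K : comNzRingType.

(* Cayley-Dickson doubling: (a, b)(c, d) = (ac - d~ b, da + b c~) *)
Definition cd_conj n (cj : 'rV[K]_n -> 'rV[K]_n) (x : 'rV[K]_(n + n)) :
    'rV[K]_(n + n) :=
  row_mx (cj (lsubmx x)) (- rsubmx x).

Definition cd_mul n (mul : 'rV[K]_n -> 'rV[K]_n -> 'rV[K]_n)
    (cj : 'rV[K]_n -> 'rV[K]_n) (x y : 'rV[K]_(n + n)) : 'rV[K]_(n + n) :=
  let a := lsubmx x in let b := rsubmx x in
  let c := lsubmx y in let d := rsubmx y in
  row_mx (mul a c - mul (cj d) b) (mul d a + mul b (cj c)).

Definition scal_mul (x y : 'rV[K]_1) : 'rV[K]_1 := \row_i (x 0 i * y 0 i).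

End CayleyDickson.

(* Over K = R this is O_c, over K = R[i] it is its complexification O. *)
Definition octonion (K : comNzRingType) := 'rV[K]_8.

HB.lock Definition oconj (K : comNzRingType) : octonion K -> octonion K :=
  @cd_conj K 4 (@cd_conj K 2 (@cd_conj K 1 id)).

HB.lock Definition omul (K : comNzRingType) :
    octonion K -> octonion K -> octonion K :=
  @cd_mul K 4
    (@cd_mul K 2 (@cd_mul K 1 (@scal_mul K) id) (@cd_conj K 1 id))
    (@cd_conj K 2 (@cd_conj K 1 id)).

Definition onorm (K : comNzRingType) (a : octonion K) : K :=
  \sum_(i < 8) a 0 i ^+ 2.

Definition oform (K : comNzRingType) (a b : octonion K) : K :=
  onorm (a + b) - onorm a - onorm b.

(* a = (alpha, A) is the hermitian matrix with diagonal coefficients alpha 0 i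
   and off-diagonal octonions a_i = row i A. Indices are in 'I_3 = Z/3, so that
   (i, i + 1, i + 2) is the cyclic permutation starting with i. *)
Definition H3O (R : realType) : Type := ('rV[R[i]]_3 * 'M[R[i]]_(3, 8))%type.
HB.instance Definition _ (R : realType) := Vector.on (H3O R).

Definition diag_coef (R : realType) (a : H3O R) (i : 'I_3) : R[i] := a.1 0 i.
Definition oct_coef (R : realType) (a : H3O R) (i : 'I_3) : octonion R[i] :=
  row i a.2.

HB.lock Definition sharp (R : realType) (a : H3O R) : H3O R :=
  (\row_i (diag_coef a (i + 1) * diag_coef a (i + 2) - onorm (oct_coef a i)),
   \matrix_i (oconj (omul (oct_coef a (i + 1)) (oct_coef a (i + 2)))
              - diag_coef a i *: oct_coef a i)).

Section H3O.
Context {R : realType}.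
Implicit Types a b x y z e : H3O R.

Definition h3_form a b : R[i] :=
  \sum_i diag_coef a i * diag_coef b i +
  \sum_i oform (oct_coef a i) (oct_coef b i).

Definition freudenthal a b : H3O R := sharp (a + b) - sharp a - sharp b.

Definition h3_det a : R[i] := 3^-1 * h3_form (sharp a) a.

Definition h3_conj a : H3O R :=
  (map_mx (@conjc R) a.1, map_mx (@conjc R) a.2).

Definition h3_herm a b : R[i] := h3_form a (h3_conj b).

Definition triple x y z : H3O R :=
  h3_herm x y *: z + h3_herm z y *: x
  - freudenthal (freudenthal x z) (h3_conj y).

Definition normal_directions (T : set (H3O R)) : set (H3O R) :=
  [set v | forall w, T w -> complex.Re (h3_herm v w) = 0].

Definition f1 x : R[i] :=
  1 - h3_herm x x + h3_herm (sharp x) (sharp x) - `|h3_det x| ^+ 2.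
Definition f2 x : R[i] := 3 - 2 * h3_herm x x + h3_herm (sharp x) (sharp x).
Definition f3 x : R[i] := 3 - h3_herm x x.

Definition f_ (j : nat) x : R[i] := [:: f1 x; f2 x; f3 x]`_j.-1.

Definition Omega : set (H3O R) :=
  [set x | forall j, (1 <= j <= 3)%N -> 0 < f_ j x].

Definition boundary (k : nat) : set (H3O R) :=
  [set x | (forall j, (1 <= j <= k)%N -> f_ j x = 0) /\
           (forall m, (k < m <= 3)%N -> 0 < f_ m x)].

Definition E1 : set (H3O R) := [set e | h3_herm e e = 1 /\ sharp e = 0].
Definition E2 : set (H3O R) :=
  [set e | [/\ h3_herm e e = 2, h3_herm (sharp e) (sharp e) = 1
             & h3_det e = 0] ].
Definition E3 : set (H3O R) :=
  [set e | [/\ h3_herm e e = 3, h3_herm (sharp e) (sharp e) = 3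
             & `|h3_det e| ^+ 2 = 1] ].

Definition real_line e : set (H3O R) := [set t%:C *: e | t in [set: R]].

Definition imaginary (A : set (H3O R)) : set (H3O R) := [set 'i *: x | x in A].

End H3O.

Section OctonionLinearity.
Variable K : comNzRingType.

Lemma oformE (a b : octonion K) : oform a b = 2 * \sum_i a 0 i * b 0 i.
Proof.
rewrite /oform /onorm -!sumrB mulr_sumr; apply: eq_bigr => i _.
by rewrite mxE; ring.
Qed.

Definition bilinear_mul n (mul : 'rV[K]_n -> 'rV[K]_n -> 'rV[K]_n) :=
  (forall a x y z, mul (a *: x + y) z = a *: mul x z + mul y z) /\
  (forall a x y z, mul z (a *: x + y) = a *: mul z x + mul z y).

Lemma cd_conj_linear n (cj : 'rV[K]_n -> 'rV[K]_n) :
  linear cj -> linear (cd_conj cj).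
Proof.
move=> h a x y; rewrite /cd_conj !linearP /= h scale_row_mx add_row_mx.
by [].
Qed.

Lemma cd_mul_bilinear n mul (cj : 'rV[K]_n -> 'rV[K]_n) :
  bilinear_mul mul -> linear cj -> bilinear_mul (cd_mul mul cj).
Proof.
move=> [hl hr] hc; split=> a x y z; rewrite /cd_mul !linearP /=;
  rewrite !(hc, hl, hr) scale_row_mx add_row_mx; congr row_mx;
  by rewrite ?scalerBr ?scalerDr ?opprD addrACA.
Qed.

Lemma oconj_linear : linear (@oconj K).
Proof.
rewrite oconj.unlock.
apply: (@cd_conj_linear 4); apply: (@cd_conj_linear 2).
by apply: (@cd_conj_linear 1).
Qed.

Lemma omul_bilinear : bilinear_mul (@omul K).
Proof.
rewrite omul.unlock.
apply: (@cd_mul_bilinear 4); last by apply: (@cd_conj_linear 2); apply: (@cd_conj_linear 1).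
apply: (@cd_mul_bilinear 2); last by apply: (@cd_conj_linear 1).
apply: (@cd_mul_bilinear 1) => //.
by split=> a x y z; apply/rowP => i; rewrite !mxE; ring.
Qed.
End OctonionLinearity.

Section H3OLinearity.
Context {R : realType}.
Local Notation C := R[i].
Lemma h3_form_linear (y : H3O R) a u v :
  h3_form (a *: u + v) y = a * h3_form u y + h3_form v y.
Proof.
rewrite /h3_form mulrDr addrACA.
congr (_ + _); rewrite mulr_sumr -big_split; apply: eq_bigr => i _ /=.
  by rewrite /diag_coef !mxE; ring.
rewrite !oformE mulrCA -mulrDr [a * _]mulr_sumr -big_split; congr (_ * _).
by apply: eq_bigr => j _; rewrite !mxE /=; ring.
Qed.


Lemma H3O_eqP (a b : H3O R) :
  diag_coef a =1 diag_coef b -> oct_coef a =1 oct_coef b -> a = b.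
Proof.
case: a b => [a A] [b B] h1 h2; congr pair; first by apply/rowP => i; exact: h1.
by apply/row_matrixP => i; exact: h2.
Qed.
Lemma oct_coefP c (a b : H3O R) i :
  oct_coef (c *: a + b) i = c *: oct_coef a i + oct_coef b i.
Proof. by apply/rowP => j; rewrite !mxE. Qed.
Lemma diag_coefP c (a b : H3O R) i :
  diag_coef (c *: a + b) i = c * diag_coef a i + diag_coef b i.
Proof. by rewrite /diag_coef !mxE. Qed.
Lemma oct_coefB (a b : H3O R) i : oct_coef (a - b) i = oct_coef a i - oct_coef b i.
Proof. by apply/rowP => j; rewrite !mxE. Qed.
Lemma diag_coefB (a b : H3O R) i : diag_coef (a - b) i = diag_coef a i - diag_coef b i.
Proof. by rewrite /diag_coef !mxE. Qed.
Lemma diag_sharp (a : H3O R) i : diag_coef (sharp a) i =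
  diag_coef a (i + 1) * diag_coef a (i + 2) - onorm (oct_coef a i).
Proof. by rewrite sharp.unlock {1}/diag_coef mxE. Qed.
Lemma oct_sharp (a : H3O R) i : oct_coef (sharp a) i =
  oconj (omul (oct_coef a (i + 1)) (oct_coef a (i + 2))) - diag_coef a i *: oct_coef a i.
Proof. by rewrite sharp.unlock {1}/oct_coef rowK. Qed.
Lemma diag_freud (a b : H3O R) i : diag_coef (freudenthal a b) i =
  diag_coef a (i + 1) * diag_coef b (i + 2) + diag_coef b (i + 1) * diag_coef a (i + 2)
  - oform (oct_coef a i) (oct_coef b i).
Proof.
rewrite /freudenthal !diag_coefB !diag_sharp .
have -> : a + b = 1 *: a + b by rewrite scale1r.
rewrite oct_coefP !diag_coefP scale1r !mul1r /oform.
move: (onorm _) (onorm _) (onorm _) => p q r; ring.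
Qed.
Lemma oct_freud (a b : H3O R) i : oct_coef (freudenthal a b) i =
  oconj (omul (oct_coef a (i + 1)) (oct_coef b (i + 2)))
  + oconj (omul (oct_coef b (i + 1)) (oct_coef a (i + 2)))
  - diag_coef a i *: oct_coef b i - diag_coef b i *: oct_coef a i.
Proof.
have [hl hr] := @omul_bilinear C.
have hc := @oconj_linear C.
rewrite /freudenthal !oct_coefB !oct_sharp.
have -> : a + b = 1 *: a + b by rewrite scale1r.
rewrite !oct_coefP !diag_coefP !hl !hr !hc !scale1r !mul1r scalerDl !scalerDr.
move: (oconj _) (oconj _) (oconj _) (oconj _) (_ *: _) (_ *: _) (_ *: _) (_ *: _).
move=> p q r s t u v w.
apply/rowP => j; rewrite !mxE; ring.
Qed.

Lemma freudenthal_linear (a : H3O R) c u v :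
  freudenthal a (c *: u + v) = c *: freudenthal a u + freudenthal a v.
Proof.
have [hl hr] := @omul_bilinear C.
have hc := @oconj_linear C.
have ho x y z : oform x (c *: y + z) = c * oform x y + oform x z :> C.
  rewrite !oformE mulrCA -mulrDr [c * _]mulr_sumr -big_split; congr (_ * _).
  by apply: eq_bigr => j _; rewrite !mxE /=; ring.
apply: H3O_eqP => i.
  rewrite diag_coefP !diag_freud oct_coefP !diag_coefP ho; ring.
rewrite oct_coefP !oct_freud !oct_coefP !diag_coefP !hl !hr !hc.
move: (oconj _) (oconj _) (oconj _) (oconj _) => p q r t.
move: (oct_coef a i) (oct_coef u i) (oct_coef v i) (diag_coef a i) (diag_coef u i) (diag_coef v i).
by move=> ? ? ? ? ? ?; apply/rowP => j; rewrite !mxE; ring.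
Qed.

Lemma freudenthalC (a b : H3O R) : freudenthal a b = freudenthal b a.
Proof. 
by rewrite /freudenthal [a + b]addrC addrAC. Qed.

Lemma triple_linear (x y : H3O R) : linear (triple x y).
Proof.
have aux (W : lmodType C) (c p q r : C) (u v t w1 w2 : W) :
  p *: (c *: u + v) + (c * q + r) *: t - (c *: w1 + w2)
  = c *: (p *: u + q *: t - w1) + (p *: v + r *: t - w2).
  rewrite !scalerDr scalerDl !scalerN !scalerA opprD [p * c]mulrC.
  by rewrite addrACA -!addrA; congr (_ + _); rewrite addrCA [RHS]addrCA;
     congr (_ + _); rewrite addrCA.
move=> c u v; rewrite /triple freudenthal_linear.
rewrite ![freudenthal _ (h3_conj y)]freudenthalC freudenthal_linear /h3_herm.
rewrite h3_form_linear; exact: aux.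
Qed.
Lemma peirceE (e y : H3O R) (j : nat) :
  (y \in peirce triple j e) = (triple e e y == j%:R *: y).
Proof.
pose D := GRing.isLinear.Build C _ _ _ (triple e e) (triple_linear e e).
pose T : {linear H3O R -> H3O R} := HB.pack (triple e e) D.
rewrite /peirce memv_ker add_lfunE opp_lfunE scale_lfunE id_lfunE.
by rewrite (lfunE T) subr_eq0.
Qed.

End H3OLinearity.

(* Main.v *)
(* The equations f_1 = ... = f_k = 0 of a boundary component have dependent
   differentials, so defining functions are extracted from vector-valued
   polynomial maps K instead: x - Q(x)x, whose zeros are the tripotents, and
   x - x# * conj x + det(x) conj(x#), whose squared norm is f2^2 - 2 f1 f3 - f1 f2
   and which therefore vanishes on the second component. Both satisfy the
   syzygy L_x (K x) = 0 with L_x v = {xxv} - {xvx}, so near a point p the equation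
   K x = 0 reduces to the components of K along the kernel of L_p, and their
   differentials at p are independent.

   Solving e# * conj e = ((e|e) - 1) e splits the nonzero tripotents into E1, E2
   and E3, and a point of the second component is e + t w with e in E2,
   w = conj(e#) in E1 and |t| < 1. The Peirce spaces of e in E2 are those of w in
   reverse order. For w in E1 and x, z in V_0(w), the product x * z is a multiple
   of conj w, which turns V_0(w) into a spin factor; a real orthonormal basis of
   it gives the isomorphism with type IV_10, and its generic minimal polynomial
   is T^2 - (x|y) T + q(x) conj q(y).

   If x = e' + t w' also lies in the tangent space e + iu + v_1 + v_0 at e, then
   ({xxe}|e) = ({eex}|x) = 4 + 2 |u|^2 + |v_1|^2, whereas {xxe} = 2e -
   (1 - |t|^2) {w'w'e} gives at most 4; hence u = v_1 = 0. *)

(* Everything about [**] and the adjoint is extracted from x## = det(x) x and from the symmetry of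
   tf (x ** y) z: polarizing gives the linearized identities, and transposing along tf turns each of
   them into a second one. The dimensions are traces. For w in E1 the map v -> conj w ** (w ** v) is
   idempotent with image V_0(w); one coordinate computation gives it trace 10 (w|w), and 27 = 1 + 16
   + 10 yields V_1(w). Normal coordinates are orthonormal bases fixed by an antilinear isometric
   involution: v -> conj(w ** v) on V_0(w), or Q(e) on V_2(e). Between fixed vectors the Hermitian
   product is real, so real and complex orthogonality can be exchanged. The obstacle in the
   submanifold claims is that K has 54 real components while exactly as many functions as the
   codimension are allowed, with independent differentials. The syzygies act as an algebraic
   substitute for a constant rank argument: the remaining components of K vanish as soon as the
   chosen ones do. *)
Require Import Defs.
From HB Require Import structures.
From mathcomp Require Import all_boot all_order all_algebra.
From mathcomp Require Import all_classical all_reals all_analysis.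
From mathcomp Require Import perm complex ring lra.
Import Order.TTheory GRing.Theory Num.Theory numFieldNormedType.Exports.

Set Implicit Arguments.
Unset Strict Implicit.
Unset Printing Implicit Defensive.

Local Open Scope classical_set_scope.
Local Open Scope complex_scope.
Local Open Scope ring_scope.

(** * Octonions *)

Section Octonions.
Variable K : comNzRingType.
Implicit Types a b c : octonion K.

(** The indices are paths through the three doublings, so that each Cayley-Dickson level is peeled
    off by one rewriting with [row_mxEl] or [row_mxEr]. *)
Let o0 : 'I_8 := lshift 4 (lshift 2 (lshift 1 (ord0 : 'I_1))).
Let o1 : 'I_8 := lshift 4 (lshift 2 (rshift 1 (ord0 : 'I_1))).
Let o2 : 'I_8 := lshift 4 (rshift 2 (lshift 1 (ord0 : 'I_1))).
Let o3 : 'I_8 := lshift 4 (rshift 2 (rshift 1 (ord0 : 'I_1))).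
Let o4 : 'I_8 := rshift 4 (lshift 2 (lshift 1 (ord0 : 'I_1))).
Let o5 : 'I_8 := rshift 4 (lshift 2 (rshift 1 (ord0 : 'I_1))).
Let o6 : 'I_8 := rshift 4 (rshift 2 (lshift 1 (ord0 : 'I_1))).
Let o7 : 'I_8 := rshift 4 (rshift 2 (rshift 1 (ord0 : 'I_1))).

Lemma sum_ord8 (F : 'I_8 -> K) : \sum_(i < 8) F i =
  F o0 + F o1 + F o2 + F o3 + F o4 + F o5 + F o6 + F o7.
Proof.
rewrite (@big_split_ord _ _ _ 4 4) !(@big_split_ord _ _ _ 2 2).
by rewrite !(@big_split_ord _ _ _ 1 1) !big_ord1 /= !addrA.
Qed.

Lemma ord8_ind (P : 'I_8 -> Prop) :
  P o0 -> P o1 -> P o2 -> P o3 -> P o4 -> P o5 -> P o6 -> P o7 -> forall i, P i.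
Proof.
have sp n m (Q : 'I_(n + m) -> Prop) :
    (forall j, Q (lshift m j)) -> (forall j, Q (rshift n j)) -> forall i, Q i.
  move=> h1 h2 i; case: (split_ordP i) => j ->; [exact: h1 | exact: h2].
by move=> *; apply: (sp 4 4); apply: (sp 2 2); apply: (sp 1 1) => j; rewrite [j]ord1.
Qed.

Section Doubling.
Variables (n : nat) (mul : 'rV[K]_n -> 'rV[K]_n -> 'rV[K]_n) (cj : 'rV[K]_n -> 'rV[K]_n).
Implicit Types (x y : 'rV[K]_(n + n)) (i : 'I_n).

Lemma cd_conjl x i : cd_conj cj x 0 (lshift n i) = cj (lsubmx x) 0 i.
Proof. by rewrite row_mxEl. Qed.

Lemma cd_conjr x i : cd_conj cj x 0 (rshift n i) = - rsubmx x 0 i.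
Proof. by rewrite row_mxEr mxE. Qed.

Lemma cd_mull x y i : cd_mul mul cj x y 0 (lshift n i) =
  mul (lsubmx x) (lsubmx y) 0 i - mul (cj (rsubmx y)) (rsubmx x) 0 i.
Proof. by rewrite row_mxEl !mxE. Qed.

Lemma cd_mulr x y i : cd_mul mul cj x y 0 (rshift n i) =
  mul (rsubmx y) (lsubmx x) 0 i + mul (rsubmx x) (cj (lsubmx y)) 0 i.
Proof. by rewrite row_mxEr !mxE. Qed.

Lemma lsub_rowE x i : lsubmx x 0 i = x 0 (lshift n i).
Proof. by rewrite mxE. Qed.

Lemma rsub_rowE x i : rsubmx x 0 i = x 0 (rshift n i).
Proof. by rewrite mxE. Qed.

End Doubling.

Let mul1 := @scal_mul K.
Let conj2 := @cd_conj K 1 id.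
Let conj4 := @cd_conj K 2 conj2.
Let mul2 := @cd_mul K 1 mul1 id.
Let mul4 := @cd_mul K 2 mul2 conj2.

Let conj2E x : (conj2 x 0 (lshift 1 (ord0 : 'I_1)) = x 0 (lshift 1 (ord0 : 'I_1))) *
  (conj2 x 0 (rshift 1 (ord0 : 'I_1)) = - x 0 (rshift 1 (ord0 : 'I_1))).
Proof. by rewrite /conj2 (@cd_conjl 1) (@cd_conjr 1) (@lsub_rowE 1) (@rsub_rowE 1). Qed.

Let mul2E x y :
  let l : 'I_2 := lshift 1 (ord0 : 'I_1) in let r : 'I_2 := rshift 1 (ord0 : 'I_1) in
  (mul2 x y 0 l = x 0 l * y 0 l - y 0 r * x 0 r) *
  (mul2 x y 0 r = y 0 r * x 0 l + x 0 r * y 0 l).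
Proof.
rewrite /= /mul2 (@cd_mull 1) (@cd_mulr 1) /mul1 /scal_mul !mxE.
by split.
Qed.

Let conj4E x (i : 'I_2) : (conj4 x 0 (lshift 2 i) = conj2 (lsubmx x) 0 i) *
  (conj4 x 0 (rshift 2 i) = - x 0 (rshift 2 i)).
Proof. by rewrite /conj4 (@cd_conjl 2) (@cd_conjr 2) (@rsub_rowE 2). Qed.

Let mul4E x y (i : 'I_2) :
  (mul4 x y 0 (lshift 2 i) =
    mul2 (lsubmx x) (lsubmx y) 0 i - mul2 (conj2 (rsubmx y)) (rsubmx x) 0 i) *
  (mul4 x y 0 (rshift 2 i) =
    mul2 (rsubmx y) (lsubmx x) 0 i + mul2 (rsubmx x) (conj2 (lsubmx y)) 0 i).
Proof. by rewrite /mul4 (@cd_mull 2) (@cd_mulr 2). Qed.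

Let conj8 x (i : 'I_4) : (oconj x 0 (lshift 4 i) = conj4 (lsubmx (x : 'rV_(4 + 4))) 0 i) *
  (oconj x 0 (rshift 4 i) = - x 0 (rshift 4 i)).
Proof. by rewrite oconj.unlock (@cd_conjl 4) (@cd_conjr 4) (@rsub_rowE 4). Qed.

Let mul8 (x y : 'rV[K]_(4 + 4)) (i : 'I_4) :
  (omul x y 0 (lshift 4 i) =
    mul4 (lsubmx x) (lsubmx y) 0 i - mul4 (conj4 (rsubmx y)) (rsubmx x) 0 i) *
  (omul x y 0 (rshift 4 i) =
    mul4 (rsubmx y) (lsubmx x) 0 i + mul4 (rsubmx x) (conj4 (lsubmx y)) 0 i).
Proof. by rewrite omul.unlock (@cd_mull 4) (@cd_mulr 4). Qed.

Lemma oconjE a : (oconj a 0 o0 = a 0 o0) * (oconj a 0 o1 = - a 0 o1) *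
  (oconj a 0 o2 = - a 0 o2) * (oconj a 0 o3 = - a 0 o3) *
  (oconj a 0 o4 = - a 0 o4) * (oconj a 0 o5 = - a 0 o5) *
  (oconj a 0 o6 = - a 0 o6) * (oconj a 0 o7 = - a 0 o7).
Proof.
by do !split; rewrite conj8 ?conj4E ?conj2E ?(@lsub_rowE 4, @lsub_rowE 2, @lsub_rowE 1).
Qed.

(** The multiplication table is unfolded only here; each octonion identity below becomes a
    polynomial identity in at most 24 scalars, left to [ring]. *)
Lemma omulE a b :
  let x i := a 0 i in let y i := b 0 i in
  (omul a b 0 o0 = x o0 * y o0 - x o1 * y o1 - x o2 * y o2 - x o3 * y o3
                 - x o4 * y o4 - x o5 * y o5 - x o6 * y o6 - x o7 * y o7) *
  (omul a b 0 o1 = x o0 * y o1 + x o1 * y o0 + x o2 * y o3 - x o3 * y o2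
                 + x o4 * y o5 - x o5 * y o4 - x o6 * y o7 + x o7 * y o6) *
  (omul a b 0 o2 = x o0 * y o2 - x o1 * y o3 + x o2 * y o0 + x o3 * y o1
                 + x o4 * y o6 + x o5 * y o7 - x o6 * y o4 - x o7 * y o5) *
  (omul a b 0 o3 = x o0 * y o3 + x o1 * y o2 - x o2 * y o1 + x o3 * y o0
                 + x o4 * y o7 - x o5 * y o6 + x o6 * y o5 - x o7 * y o4) *
  (omul a b 0 o4 = x o0 * y o4 - x o1 * y o5 - x o2 * y o6 - x o3 * y o7
                 + x o4 * y o0 + x o5 * y o1 + x o6 * y o2 + x o7 * y o3) *
  (omul a b 0 o5 = x o0 * y o5 + x o1 * y o4 - x o2 * y o7 + x o3 * y o6
                 - x o4 * y o1 + x o5 * y o0 - x o6 * y o3 + x o7 * y o2) *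
  (omul a b 0 o6 = x o0 * y o6 + x o1 * y o7 + x o2 * y o4 - x o3 * y o5
                 - x o4 * y o2 + x o5 * y o3 + x o6 * y o0 - x o7 * y o1) *
  (omul a b 0 o7 = x o0 * y o7 - x o1 * y o6 + x o2 * y o5 + x o3 * y o4
                 - x o4 * y o3 - x o5 * y o2 + x o6 * y o1 + x o7 * y o0).
Proof.
move=> x y.
do !split; rewrite /o0 /o1 /o2 /o3 /o4 /o5 /o6 /o7 (mul8, mul8) !mul4E !mul2E
  ?(conj4E, conj2E, @lsub_rowE 4, @rsub_rowE 4, @lsub_rowE 2, @rsub_rowE 2) -/o0 -/o1 -/o2 -/o3 -/o4 -/o5 -/o6 -/o7
  -!/(x _) -!/(y _); ring.
Qed.

Lemma onormE a : onorm a = a 0 o0 ^+ 2 + a 0 o1 ^+ 2 + a 0 o2 ^+ 2 + a 0 o3 ^+ 2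
  + a 0 o4 ^+ 2 + a 0 o5 ^+ 2 + a 0 o6 ^+ 2 + a 0 o7 ^+ 2.
Proof. exact: sum_ord8. Qed.

Lemma oform8E a b : oform a b = 2 * (a 0 o0 * b 0 o0 + a 0 o1 * b 0 o1
  + a 0 o2 * b 0 o2 + a 0 o3 * b 0 o3 + a 0 o4 * b 0 o4 + a 0 o5 * b 0 o5
  + a 0 o6 * b 0 o6 + a 0 o7 * b 0 o7).
Proof. by rewrite oformE sum_ord8. Qed.

Let octE := (omulE, oconjE, onormE, oform8E).

Ltac gen8 a := move: (a 0 o0) (a 0 o1) (a 0 o2) (a 0 o3)
                     (a 0 o4) (a 0 o5) (a 0 o6) (a 0 o7) => ? ? ? ? ? ? ? ?.

Lemma onorm_conj a : onorm (oconj a) = onorm a.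
Proof. by rewrite !octE; gen8 a; ring. Qed.

Lemma onorm_mul a b : onorm (omul a b) = onorm a * onorm b.
Proof. by rewrite !octE /=; gen8 a; gen8 b; ring. Qed.

(** Both sides are twice the scalar part of a product of three octonions, which is insensitive to
    cyclic rotation. This is the source of the symmetry of the cubic form. *)
Lemma oform_mul_rot a b c :
  oform (oconj (omul a b)) c = oform (oconj (omul b c)) a.
Proof. by rewrite !octE /=; gen8 a; gen8 b; gen8 c; ring. Qed.

Lemma oconjK a : oconj (oconj a) = a.
Proof. by apply/rowP; elim/ord8_ind; rewrite !octE ?opprK. Qed.

Lemma oconj_mul a b : oconj (omul a b) = omul (oconj b) (oconj a).
Proof.
by apply/rowP; elim/ord8_ind; rewrite !octE /=; gen8 a; gen8 b; ring.
Qed.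

Lemma omul_conjKl a b : omul (oconj a) (omul a b) = onorm a *: b.
Proof.
by apply/rowP; elim/ord8_ind; rewrite ?mxE !octE /=; gen8 a; gen8 b; ring.
Qed.

Lemma omul_conjKr a b : omul (omul a b) (oconj b) = onorm b *: a.
Proof.
by apply/rowP; elim/ord8_ind; rewrite ?mxE !octE /=; gen8 a; gen8 b; ring.
Qed.

(** The middle Moufang identity (ab)(ca) = a(bc)a, with axa expanded by the quadratic relation axa =
    (a : x~) a - n(a) x~. *)
Lemma omul_moufang a b c : omul (omul a b) (omul c a) =
  oform (oconj (omul b c)) a *: a - onorm a *: oconj (omul b c).
Proof.
by apply/rowP; elim/ord8_ind; rewrite ?mxE !octE /=; gen8 a; gen8 b; gen8 c; ring.
Qed.

Lemma oconj_map (f : {rmorphism K -> K}) a : oconj (map_mx f a) = map_mx f (oconj a).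
Proof. by apply/rowP; elim/ord8_ind; rewrite !(mxE, oconjE) ?rmorphN. Qed.

Lemma omul_map (f : {rmorphism K -> K}) a b :
  omul (map_mx f a) (map_mx f b) = map_mx f (omul a b).
Proof.
by apply/rowP; elim/ord8_ind; rewrite !(mxE, omulE) /= !(rmorphD, rmorphN, rmorphM).
Qed.

End Octonions.

(** * Identities for the cubic form *)

(* Locked: otherwise comparing two vectors unfolds them to matrix entries. *)
HB.lock Definition cross (R : realType) (a b : H3O R) := freudenthal a b.
HB.lock Definition tf (R : realType) (a b : H3O R) := h3_form a b.
HB.lock Definition hdet (R : realType) (a : H3O R) := h3_det a.
HB.lock Definition cj (R : realType) (a : H3O R) := h3_conj a.

Definition coord_idx : Type := ('I_3 + 'I_3 * 'I_8)%type.
HB.instance Definition _ := Finite.on coord_idx.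

HB.lock Definition co (R : realType) (k : coord_idx) (x : H3O R) : R[i] :=
  match k with inl i => x.1 0 i | inr ij => x.2 ij.1 ij.2 end.

HB.lock Definition unit_vec (R : realType) (k : coord_idx) : H3O R :=
  match k with inl i => (delta_mx 0 i, 0) | inr ij => (0, delta_mx ij.1 ij.2) end.

(* (x : y) counts every octonion coordinate twice, since (a : a) = 2 n(a). *)
Definition weight (k : coord_idx) : nat := if k is inl _ then 1 else 2.

Notation "x ** y" := (cross x y) (at level 40, left associativity) : ring_scope.

Section Coordinates.
Context {R : realType}.
Local Notation C := R[i].
Implicit Types (x y z u v : H3O R) (a b c : C) (k : coord_idx).

Lemma coD k x y : co k (x + y) = co k x + co k y.
Proof. by rewrite co.unlock; case: k => [i|[i j]] /=; rewrite mxE. Qed.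
Lemma coN k x : co k (- x) = - co k x.
Proof. by rewrite co.unlock; case: k => [i|[i j]] /=; rewrite mxE. Qed.
Lemma co0 k : co k (0 : H3O R) = 0.
Proof. by rewrite co.unlock; case: k => [i|[i j]] /=; rewrite mxE. Qed.
Lemma coZ k a x : co k (a *: x) = a * co k x.
Proof. by rewrite co.unlock; case: k => [i|[i j]] /=; rewrite mxE. Qed.
Lemma co_sum k I (r : seq I) (P : pred I) (F : I -> H3O R) :
  co k (\sum_(i <- r | P i) F i) = \sum_(i <- r | P i) co k (F i).
Proof.
elim/big_rec2: _ => [|i y1 y2 _ <-]; [exact: co0 | exact: coD].
Qed.
Lemma co_cj k x : co k (cj x) = (co k x)^*.
Proof. by rewrite co.unlock cj.unlock; case: k => [i|[i j]] /=; rewrite mxE. Qed.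
Lemma co_inj x y : (forall k, co k x = co k y) -> x = y.
Proof.
rewrite co.unlock; case: x y => [x1 x2] [y1 y2] h; congr pair.
  by apply/rowP => i; have := h (inl i).
by apply/matrixP => i j; have := h (inr (i, j)).
Qed.
Lemma co_unit k l : co k (unit_vec R l) = (k == l)%:R.
Proof.
rewrite co.unlock unit_vec.unlock; case: k l => [i|[i j]] [i'|[i' j']] /=; rewrite !mxE //.
Qed.

Definition coE := (coD, coN, co0, coZ).

Lemma co_sumE x : x = \sum_k co k x *: unit_vec R k.
Proof.
apply: co_inj => l; rewrite co_sum (bigD1 l) //= coZ co_unit eqxx mulr1.
rewrite big1 ?addr0 // => k kl; rewrite coZ co_unit eq_sym (negbTE kl).
by rewrite mulr0.
Qed.

Lemma tf_sumE x y : tf x y = \sum_k (weight k)%:R * (co k x * co k y).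
Proof.
rewrite tf.unlock co.unlock /h3_form big_sumType /=; congr (_ + _).
  by apply: eq_bigr => i _; rewrite mul1r.
have -> : \sum_(i : 'I_3 * 'I_8) 2%:R * (x.2 i.1 i.2 * y.2 i.1 i.2) =
  \sum_i \sum_j 2 * (x.2 i j * y.2 i j) by rewrite pair_bigA.
apply: eq_bigr => i _; rewrite oformE mulr_sumr; apply: eq_bigr => j _.
by rewrite !mxE.
Qed.

Lemma tfC x y : tf x y = tf y x.
Proof. by rewrite !tf_sumE; apply: eq_bigr => k _; congr (_ * _); rewrite mulrC. Qed.
Lemma tfDl x y z : tf (x + y) z = tf x z + tf y z.
Proof.
by rewrite !tf_sumE -big_split; apply: eq_bigr => k _ /=; rewrite coD mulrDl mulrDr.
Qed.
Lemma tfZl a x z : tf (a *: x) z = a * tf x z.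
Proof.
by rewrite !tf_sumE mulr_sumr; apply: eq_bigr => k _; rewrite coZ; ring.
Qed.
Lemma tfNl x z : tf (- x) z = - tf x z.
Proof. by rewrite -scaleN1r tfZl mulN1r. Qed.
Lemma tf0l z : tf 0 z = 0.
Proof. by rewrite -(scale0r z) tfZl mul0r. Qed.
Lemma tfDr x y z : tf z (x + y) = tf z x + tf z y.
Proof. by rewrite ![tf z _]tfC tfDl. Qed.
Lemma tfZr a x z : tf z (a *: x) = a * tf z x.
Proof. by rewrite ![tf z _]tfC tfZl. Qed.
Lemma tfNr x z : tf z (- x) = - tf z x.
Proof. by rewrite ![tf z _]tfC tfNl. Qed.
Lemma tf0r z : tf z 0 = 0.
Proof. by rewrite tfC tf0l. Qed.
Lemma tf_unit k x : tf x (unit_vec R k) = (weight k)%:R * co k x.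
Proof.
rewrite tf_sumE (bigD1 k) //= co_unit eqxx mulr1 big1 ?addr0 // => l kl.
by rewrite co_unit (negbTE kl) !mulr0.
Qed.
Lemma weight_neq0 k : (weight k)%:R != 0 :> C.
Proof. by rewrite pnatr_eq0; case: k. Qed.
Lemma tf_inj x y : (forall z, tf x z = tf y z) -> x = y.
Proof.
move=> h; apply: co_inj => k; have := h (unit_vec R k); rewrite !tf_unit.
exact/mulfI/weight_neq0.
Qed.

Lemma cjD x y : cj (x + y) = cj x + cj y.
Proof. by apply: co_inj => k; rewrite !(coE, co_cj) rmorphD. Qed.
Lemma cjZ a x : cj (a *: x) = a^* *: cj x.
Proof. by apply: co_inj => k; rewrite !(coE, co_cj) rmorphM. Qed.
Lemma cjN x : cj (- x) = - cj x.
Proof. by apply: co_inj => k; rewrite !(coE, co_cj) rmorphN. Qed.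
Lemma cj0 : cj 0 = 0 :> H3O R.
Proof. by apply: co_inj => k; rewrite !(coE, co_cj) rmorph0. Qed.
Lemma cjK x : cj (cj x) = x.
Proof. by apply: co_inj => k; rewrite !co_cj conjCK. Qed.
Lemma tf_cj x y : tf (cj x) (cj y) = (tf x y)^*.
Proof.
rewrite !tf_sumE rmorph_sum /=; apply: eq_bigr => k _.
by rewrite !co_cj !rmorphM rmorph_nat.
Qed.
Lemma tf_cjr x y : (tf x (cj y))^* = tf y (cj x).
Proof. by rewrite -tf_cj cjK tfC. Qed.

Lemma herm_ge0 x : 0 <= tf x (cj x).
Proof.
rewrite tf_sumE; apply: sumr_ge0 => k _; rewrite co_cj mulr_ge0 ?ler0n //.
exact: mul_conjC_ge0.
Qed.
Lemma herm_eq0 x : tf x (cj x) = 0 -> x = 0.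
Proof.
rewrite tf_sumE => /eqP; rewrite psumr_eq0 => [/allP h|k _]; last first.
  by rewrite co_cj mulr_ge0 ?ler0n // mul_conjC_ge0.
apply: co_inj => k; rewrite co0; apply/eqP; have := h k (mem_index_enum k).
by rewrite /= !mulf_eq0 (negbTE (weight_neq0 k)) co_cj conjC_eq0 orbb.
Qed.

Lemma crossC x y : x ** y = y ** x.
Proof. by rewrite cross.unlock freudenthalC. Qed.
Lemma crossDr x y z : z ** (x + y) = z ** x + z ** y.
Proof. by rewrite cross.unlock -[x in x + y]scale1r freudenthal_linear scale1r. Qed.
Lemma cross0r z : z ** 0 = 0.
Proof.
by have := crossDr 0 0 z; rewrite addr0 => /eqP; rewrite -subr_eq0 opprD addNKr oppr_eq0 => /eqP.
Qed.
Lemma crossZr a x z : z ** (a *: x) = a *: (z ** x).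
Proof.
by have := cross0r z; rewrite cross.unlock -[a *: x]addr0 freudenthal_linear => ->; rewrite addr0.
Qed.
Lemma crossNr x z : z ** (- x) = - (z ** x).
Proof. by rewrite -scaleN1r crossZr scaleN1r. Qed.
Lemma crossDl x y z : (x + y) ** z = x ** z + y ** z.
Proof. by rewrite ![_ ** z]crossC crossDr. Qed.
Lemma crossZl a x z : (a *: x) ** z = a *: (x ** z).
Proof. by rewrite ![_ ** z]crossC crossZr. Qed.
Lemma crossNl x z : (- x) ** z = - (x ** z).
Proof. by rewrite ![_ ** z]crossC crossNr. Qed.
Lemma cross0l z : 0 ** z = 0.
Proof. by rewrite crossC cross0r. Qed.

Lemma sharpD x y : sharp (x + y) = sharp x + x ** y + sharp y.
Proof.
rewrite cross.unlock /freudenthal; apply: co_inj => k; rewrite !coE; ring.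
Qed.
Lemma sharpZ a x : sharp (a *: x) = a ^+ 2 *: sharp x.
Proof.
have [hl hr] := @omul_bilinear C; have hc := @oconj_linear C.
have Dz i : diag_coef (a *: x) i = a * diag_coef x i by rewrite /diag_coef mxE.
have Oz i : oct_coef (a *: x) i = a *: oct_coef x i.
  by rewrite /oct_coef; apply/rowP => j; rewrite !mxE.
have lZ (u v : octonion C) : omul (a *: u) v = a *: omul u v.
  by rewrite -[a *: u]addr0 hl; have := hl (-1) 0 0 v; rewrite scaler0 add0r scaleN1r addNr => ->; rewrite addr0.
have rZ (u v : octonion C) : omul v (a *: u) = a *: omul v u.
  by rewrite -[a *: u]addr0 hr; have := hr (-1) 0 0 v; rewrite scaler0 add0r scaleN1r addNr => ->; rewrite addr0.
have cZ (u : octonion C) : oconj (a *: u) = a *: oconj u.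
  by rewrite -[a *: u]addr0 hc; have := hc (-1) 0 0; rewrite scaler0 add0r scaleN1r addNr => ->; rewrite addr0.
apply: H3O_eqP => i.
  rewrite diag_sharp /diag_coef [RHS]mxE -!/(diag_coef _ _) diag_sharp !Dz Oz.
  have -> : onorm (a *: oct_coef x i) = a ^+ 2 * onorm (oct_coef x i).
    by rewrite /onorm mulr_sumr; apply: eq_bigr => j _; rewrite mxE exprMn.
  by ring.
have -> : oct_coef (a ^+ 2 *: sharp x) i = a ^+ 2 *: oct_coef (sharp x) i.
  by rewrite /oct_coef; apply/rowP => j; rewrite !mxE.
rewrite !oct_sharp !Dz !Oz lZ rZ !cZ scalerBr !scalerA; congr (_ *: _ - _ *: _); ring.
Qed.
Lemma crossxx x : x ** x = 2 *: sharp x.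
Proof.
have := sharpD x x; rewrite (_ : x + x = 2 *: x) ?sharpZ; last first.
  by apply: co_inj => k; rewrite !coE; ring.
move=> h; apply: co_inj => k; have := congr1 (co k) h; rewrite !coE => {}h.
have -> : co k (x ** x) = co k (sharp x) + co k (x ** x) + co k (sharp x)
  - 2 * co k (sharp x) by ring.
by rewrite -h; ring.
Qed.
Lemma sharpN x : sharp (- x) = sharp x.
Proof. by rewrite -scaleN1r sharpZ sqrrN expr1n scale1r. Qed.

End Coordinates.

(* Linear identities in H3O R are reified and compared coordinatewise: rewriting
   with coE is slow, since unifying a scaling with a sum unfolds both down to
   the entries of the underlying matrices. *)
Inductive vexpr (R : realType) :=
| VAtom of H3O R | VAdd of vexpr R & vexpr R | VOpp of vexpr R
| VScale of R[i] & vexpr R | VZero.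
Arguments VZero {R}.

Fixpoint veval (R : realType) (e : vexpr R) : H3O R :=
  match e with
  | VAtom x => x
  | VAdd e1 e2 => veval e1 + veval e2
  | VOpp e1 => - veval e1
  | VScale a e1 => a *: veval e1
  | VZero => 0
  end.

Fixpoint vcoord (R : realType) (k : coord_idx) (e : vexpr R) : R[i] :=
  match e with
  | VAtom x => co k x
  | VAdd e1 e2 => vcoord k e1 + vcoord k e2
  | VOpp e1 => - vcoord k e1
  | VScale a e1 => a * vcoord k e1
  | VZero => 0
  end.

Lemma co_veval (R : realType) k (e : vexpr R) : co k (veval e) = vcoord k e.
Proof. by elim: e => //= *; rewrite ?coE; congruence. Qed.

Lemma vexpr_ext (R : realType) (e1 e2 : vexpr R) :
  (forall k, vcoord k e1 = vcoord k e2) -> veval e1 = veval e2.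
Proof. by move=> h; apply: co_inj => k; rewrite !co_veval. Qed.

Lemma vexpr_coord (R : realType) (e1 e2 : vexpr R) k :
  veval e1 = veval e2 -> vcoord k e1 = vcoord k e2.
Proof. by rewrite -!co_veval => ->. Qed.

Ltac vreify t :=
  lazymatch t with
  | @Algebra.add _ ?x ?y => let a := vreify x in let b := vreify y in open_constr:(VAdd a b)
  | @Algebra.opp _ ?x => let a := vreify x in open_constr:(VOpp a)
  | @GRing.scale _ _ ?c ?x => let a := vreify x in open_constr:(VScale c a)
  | @Algebra.zero _ => open_constr:(VZero)
  | _ => open_constr:(VAtom t)
  end.

Ltac vpush :=
  lazymatch goal with
  | |- @eq _ ?u ?v => let a := vreify u in let b := vreify v in
      refine (@vexpr_ext _ a b _); let k := fresh "k" in intro k; cbn [vcoord]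
  end.

Ltac vpush_hyp h k :=
  lazymatch type of h with
  | @eq _ ?u ?v => let a := vreify u in let b := vreify v in
      let h' := fresh in
      pose proof (@vexpr_coord _ a b k h) as h'; cbn [vcoord] in h'; clear h; rename h' into h
  end.

Ltac vring := (vpush; ring).

Section AdjointIdentities.
Context {R : realType}.
Local Notation C := R[i].
Implicit Types (x y z u v w : H3O R) (a b c : C) (k : coord_idx).

Let ord3E : ((0 + 1 = 1 :> 'I_3) * (1 + 1 = 2 :> 'I_3) * (2 + 1 = 0 :> 'I_3) *
  (0 + 2 = 2 :> 'I_3) * (1 + 2 = 0 :> 'I_3) * (2 + 2 = 1 :> 'I_3)).
Proof. by do !split; apply/val_inj. Qed.

Let ord3P (i : 'I_3) : [\/ i = 0, i = 1 | i = 2].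
Proof.
case: i => [[|[|[|//]]] ilt]; [apply: Or31 | apply: Or32 | apply: Or33]; exact/val_inj.
Qed.

Let sum3 (F : 'I_3 -> C) : \sum_i F i = F 0 + F 1 + F 2.
Proof.
rewrite !big_ord_recl big_ord0 addr0 addrA; congr (F _ + F _ + F _); exact/val_inj.
Qed.

Let ofDl (p q r : octonion C) : oform (p + q) r = oform p r + oform q r.
Proof.
by rewrite !oformE -mulrDr -big_split; congr (_ * _); apply: eq_bigr => j _; rewrite mxE mulrDl.
Qed.
Let ofZl (t : C) (p r : octonion C) : oform (t *: p) r = t * oform p r.
Proof.
rewrite !oformE mulrCA [t * _]mulr_sumr; apply: congr1.
by apply: eq_bigr => j _; rewrite mxE mulrA.
Qed.
Let ofNl (p r : octonion C) : oform (- p) r = - oform p r.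
Proof. by rewrite -scaleN1r ofZl mulN1r. Qed.
Let ofC (p r : octonion C) : oform p r = oform r p.
Proof.
rewrite !oformE; apply: congr1; apply: eq_bigr => j _; exact: mulrC.
Qed.

Let of2 (p u c : octonion C) s : oform (p - s *: u) c = oform p c - s * oform u c.
Proof. by rewrite ofDl ofNl ofZl. Qed.
Let of4 (p q u v c : octonion C) s t : oform (p + q - s *: u - t *: v) c =
  oform p c + oform q c - s * oform u c - t * oform v c.
Proof. by rewrite !of2 ofDl. Qed.

(** [L] is [tf (x ** y) z] written out. Once every trilinear term is rotated so that its index-0
    argument comes first, six trilinear atoms remain and the symmetry in the last two vectors is
    polynomial. *)
Let freud_pairing (p0 p1 p2 q0 q1 q2 r0 r1 r2 : octonion C) (a0 a1 a2 b0 b1 b2 c0 c1 c2 : C) :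
  let F p q r := oform (oconj (omul p q)) r in
  let L p0 p1 p2 q0 q1 q2 r0 r1 r2 a0 a1 a2 b0 b1 b2 c0 c1 c2 :=
    (a1 * b2 + b1 * a2 - oform p0 q0) * c0 + (a2 * b0 + b2 * a0 - oform p1 q1) * c1
    + (a0 * b1 + b0 * a1 - oform p2 q2) * c2
    + (F p1 q2 r0 + F q1 p2 r0 - a0 * oform q0 r0 - b0 * oform p0 r0
    + (F p2 q0 r1 + F q2 p0 r1 - a1 * oform q1 r1 - b1 * oform p1 r1)
    + (F p0 q1 r2 + F q0 p1 r2 - a2 * oform q2 r2 - b2 * oform p2 r2)) in
  L p0 p1 p2 q0 q1 q2 r0 r1 r2 a0 a1 a2 b0 b1 b2 c0 c1 c2 =
  L p0 p1 p2 r0 r1 r2 q0 q1 q2 a0 a1 a2 c0 c1 c2 b0 b1 b2.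
Proof.
move=> F L; rewrite /L.
have rot p q r : F p q r = F r p q by rewrite /F [RHS]oform_mul_rot.
have rot2 p q r : F p q r = F q r p by rewrite [RHS]rot.
rewrite !(rot p1) !(rot q1) !(rot r1) !(rot2 p2) !(rot2 q2) !(rot2 r2).
rewrite (ofC r0) (ofC r1) (ofC r2).
move: (F p0 q1 r2) (F p0 r1 q2) (F q0 p1 r2) (F q0 r1 p2) (F r0 p1 q2) (F r0 q1 p2).
move: (oform p0 q0) (oform p1 q1) (oform p2 q2) (oform q0 r0) (oform q1 r1) (oform q2 r2).
move: (oform p0 r0) (oform p1 r1) (oform p2 r2) => *; ring.
Qed.

Lemma tf_crossC x y z : tf (x ** y) z = tf (x ** z) y.
Proof.
rewrite tf.unlock cross.unlock /h3_form !sum3.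
rewrite (diag_freud _ _ 0) (diag_freud _ _ 1) (diag_freud _ _ 2).
rewrite (oct_freud _ _ 0) (oct_freud _ _ 1) (oct_freud _ _ 2).
rewrite (diag_freud _ _ 0) (diag_freud _ _ 1) (diag_freud _ _ 2).
rewrite (oct_freud _ _ 0) (oct_freud _ _ 1) (oct_freud _ _ 2) !ord3E.
move: (oct_coef x 0) (oct_coef x 1) (oct_coef x 2) => p0 p1 p2.
move: (oct_coef y 0) (oct_coef y 1) (oct_coef y 2) => q0 q1 q2.
move: (oct_coef z 0) (oct_coef z 1) (oct_coef z 2) => r0 r1 r2.
move: (diag_coef x 0) (diag_coef x 1) (diag_coef x 2) => a0 a1 a2.
move: (diag_coef y 0) (diag_coef y 1) (diag_coef y 2) => b0 b1 b2.
move: (diag_coef z 0) (diag_coef z 1) (diag_coef z 2) => c0 c1 c2.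
rewrite !of4; exact: freud_pairing.
Qed.

Lemma tf_cross x y z : tf (x ** y) z = tf x (y ** z).
Proof. by rewrite crossC tf_crossC tfC. Qed.

Lemma cj_sharp x : cj (sharp x) = sharp (cj x).
Proof.
have dc (w : H3O R) i : diag_coef (cj w) i = (diag_coef w i)^*.
  by rewrite cj.unlock /diag_coef mxE.
have oc (w : H3O R) i : oct_coef (cj w) i = map_mx (Num.conj : {rmorphism C -> C}) (oct_coef w i).
  by rewrite cj.unlock; apply/rowP => j; rewrite !mxE.
apply: H3O_eqP => i.
  rewrite dc !diag_sharp !dc oc rmorphB rmorphM /onorm rmorph_sum; congr (_ - _).
  by apply: eq_bigr => j _; rewrite rmorphXn !mxE.
rewrite oc !oct_sharp !dc !oc omul_map oconj_map.
by rewrite map_mxB map_mxZ.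
Qed.

Lemma cj_cross x y : cj (x ** y) = cj x ** cj y.
Proof.
by rewrite cross.unlock /freudenthal !(cjD, cjN) !cj_sharp cjD.
Qed.

Lemma hdetE x : hdet x = 3^-1 * tf (sharp x) x.
Proof. by rewrite hdet.unlock tf.unlock. Qed.

Lemma tf_sharp x : tf (sharp x) x = 3 * hdet x.
Proof. by rewrite hdetE mulrA mulfV ?mul1r // pnatr_eq0. Qed.

Let hdet_coord x i : hdet x =
  diag_coef x i * diag_coef x (i + 1) * diag_coef x (i + 2)
  - diag_coef x i * onorm (oct_coef x i)
  - diag_coef x (i + 1) * onorm (oct_coef x (i + 1))
  - diag_coef x (i + 2) * onorm (oct_coef x (i + 2))
  + oform (oconj (omul (oct_coef x (i + 1)) (oct_coef x (i + 2)))) (oct_coef x i).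
Proof.
apply: (@mulfI _ 3); first by rewrite pnatr_eq0.
rewrite -tf_sharp tf.unlock /h3_form !sum3 !diag_sharp !oct_sharp.
have nn (p : octonion C) : oform p p = 2 * onorm p.
  by rewrite oformE /onorm; congr (_ * _); apply: eq_bigr => j _.
have [->|->|->] := ord3P i; rewrite !ord3E;
  move: (oct_coef x 0) (oct_coef x 1) (oct_coef x 2) => p q r;
  rewrite !of2 !nn [oform (oconj (omul r p)) _]oform_mul_rot
    -[oform (oconj (omul q r)) _]oform_mul_rot; ring.
Qed.

(** The off-diagonal part of the adjoint identity. Conjugation reverses products, which leaves
    (pq)(rp), (pq)q~ and r~(rp): one Moufang product and two alternative-law products. *)
Let adjoint_octonion (p q r : octonion C) s t m :
  oconj (omul (oconj (omul r p) - t *: q) (oconj (omul p q) - m *: r))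
    - (t * m - onorm p) *: (oconj (omul q r) - s *: p) =
  (s * t * m - s * onorm p - t * onorm q - m * onorm r
    + oform (oconj (omul q r)) p) *: p.
Proof.
have [hl hr] := @omul_bilinear C; have hc := @oconj_linear C.
have Bl c (d v w : octonion C) : omul (d - c *: v) w = omul d w - c *: omul v w.
  by rewrite [d - _]addrC -scaleNr hl scaleNr addrC.
have Br c (d v w : octonion C) : omul w (d - c *: v) = omul w d - c *: omul w v.
  by rewrite [d - _]addrC -scaleNr hr scaleNr addrC.
have Bc c (d v : octonion C) : oconj (d - c *: v) = oconj d - c *: oconj v.
  by rewrite [d - _]addrC -scaleNr hc scaleNr addrC.
have -> : oconj (omul (oconj (omul r p) - t *: q) (oconj (omul p q) - m *: r)) =
   omul (omul p q) (omul r p) - t *: omul (omul p q) (oconj q)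
   - m *: (omul (oconj r) (omul r p) - t *: oconj (omul q r)).
  by rewrite Br !Bl !Bc (oconj_mul _ (oconj (omul p q))) (oconj_mul q (oconj (omul p q)))
     (oconj_mul (oconj (omul r p)) r) !oconjK.
rewrite omul_moufang omul_conjKr omul_conjKl.
by apply/rowP => j; rewrite !mxE; ring.
Qed.

(** Together with [tf_crossC] this identity generates the linearized identities below. *)
Lemma sharpK x : sharp (sharp x) = hdet x *: x.
Proof.
have i11 (i : 'I_3) : ((i + 1 + 1 = i + 2) * (i + 1 + 2 = i) * (i + 2 + 1 = i) *
    (i + 2 + 2 = i + 1)).
  by have [->|->|->] := ord3P i; rewrite !ord3E.
apply: H3O_eqP => i; last first.
  rewrite oct_sharp.
  have -> : oct_coef (hdet x *: x) i = hdet x *: oct_coef x i.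
    by rewrite /oct_coef; apply/rowP => j; rewrite !mxE.
  rewrite !oct_sharp !diag_sharp !i11 (hdet_coord x i).
  move: (oct_coef x i) (oct_coef x (i + 1)) (oct_coef x (i + 2)) => p q r.
  move: (diag_coef x i) (diag_coef x (i + 1)) (diag_coef x (i + 2)) => s t m.
  exact: adjoint_octonion.
rewrite diag_sharp.
have -> : diag_coef (hdet x *: x) i = hdet x * diag_coef x i by rewrite /diag_coef mxE.
rewrite !diag_sharp !oct_sharp !i11 (hdet_coord x i).
have nB (s : C) (p q : octonion C) :
    onorm (p - s *: q) = onorm p - s * oform p q + s ^+ 2 * onorm q.
  rewrite oformE /onorm !mulr_sumr -sumrB -big_split.
  by apply: eq_bigr => j _; rewrite !mxE /=; ring.
by rewrite nB onorm_conj onorm_mul; ring.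
Qed.

End AdjointIdentities.

(** * Linearizations of the adjoint identity *)

Section CubicIdentities.
Context {R : realType}.
Local Notation C := R[i].
Implicit Types (x y z u v w : H3O R) (a b c t : C) (k : coord_idx).

(** The polarization tool: an identity valid along x + t y splits into powers of t, because a
    polynomial vanishing at more integers than its degree allows is zero. *)
Lemma poly_vec0 n (d : nat -> H3O R) :
  (forall t : C, \sum_(k < n) t ^+ k *: d k = 0) -> forall k : nat, (k < n)%N -> d k = 0.
Proof.
move=> h k kn; apply: co_inj => l; rewrite co0.
pose p := \poly_(k < n) co l (d k).
have p0 : p = 0.
  apply/eqP; apply: contraT => pn0.
  have := @max_poly_roots _ p [seq i%:R | i <- iota 0 (size p)] pn0.
  rewrite size_map size_iota ltnn; apply.
    apply/allP => _ /mapP [i _ ->]; rewrite /root horner_poly; apply/eqP.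
    have := congr1 (co l) (h i%:R); rewrite co_sum co0 => h'; rewrite -[RHS]h'.
    by apply: eq_bigr => j _; rewrite coZ mulrC.
  rewrite map_inj_uniq ?iota_uniq // => i j /eqP.
  by rewrite eqr_nat => /eqP.
by have := coef_poly n (fun j => co l (d j)) k; rewrite -/p p0 coef0 kn.
Qed.

Lemma hdetD x y : hdet (x + y) = hdet x + tf (sharp x) y + tf x (sharp y) + hdet y.
Proof.
rewrite !hdetE sharpD !(tfDl, tfDr) (tf_crossC x y x) (tf_cross x y y) !crossxx.
rewrite tfZl tfZr (tfC (sharp y) x); by field.
Qed.

Lemma hdetZ a x : hdet (a *: x) = a ^+ 3 * hdet x.
Proof. by rewrite !hdetE sharpZ tfZl tfZr; ring. Qed.

Lemma hdet_cj x : hdet (cj x) = (hdet x)^*.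
Proof. by rewrite !hdetE -cj_sharp tf_cj rmorphM /= fmorphV /= rmorph_nat. Qed.

(** The coefficient of t in the adjoint identity at x + t y. The list [c] holds all coefficients;
    its ends vanish by the identity at x and at y. *)
Lemma sharp_cross x y : sharp x ** (x ** y) = hdet x *: y + tf (sharp x) y *: x.
Proof.
pose c (k : nat) : H3O R := nth 0 [:: 0; sharp x ** (x ** y) - (hdet x *: y + tf (sharp x) y *: x);
  sharp x ** sharp y + sharp (x ** y) - (tf (sharp x) y *: y + tf x (sharp y) *: x);
  (x ** y) ** sharp y - (tf x (sharp y) *: y + hdet y *: x); 0] k.
have := @poly_vec0 5 c _ 1%N isT; rewrite /c /= => h; apply/eqP; rewrite -subr_eq0; apply/eqP.
apply: h => t; rewrite !big_ord_recl big_ord0 /=.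
have := sharpK (x + t *: y); rewrite hdetD hdetZ !sharpD !(tfZr, crossZr, sharpZ) !sharpK.
rewrite !(crossDl, crossDr, crossZl, crossZr) => /eqP; rewrite -subr_eq0 => /eqP h.
by rewrite -[RHS]h /bump /=; vring.
Qed.

(** The transpose of [sharp_cross]: each map [x ** _] is self-adjoint for tf, so transposing a
    composite reverses its order. *)
Lemma cross_sharp x y : x ** (sharp x ** y) = hdet x *: y + tf x y *: sharp x.
Proof.
apply: tf_inj => z; rewrite !(tfDl, tfZl).
rewrite (tf_crossC x) tfC (crossC (sharp x)) (tf_cross y) sharp_cross.
by rewrite tfDr !tfZr (tfC y x); ring.
Qed.

(** The coefficient of t in [sharp_cross] at x + t z. *)
Lemma sharp_cross_lin x y z : (x ** z) ** (x ** y) + sharp x ** (z ** y) =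
  tf (sharp x) z *: y + tf (x ** z) y *: x + tf (sharp x) y *: z.
Proof.
pose c (k : nat) : H3O R := nth 0 [:: 0; (x ** z) ** (x ** y) + sharp x ** (z ** y) -
    (tf (sharp x) z *: y + tf (x ** z) y *: x + tf (sharp x) y *: z);
  (x ** z) ** (z ** y) + sharp z ** (x ** y) -
    (tf x (sharp z) *: y + tf (x ** z) y *: z + tf (sharp z) y *: x)] k.
have := @poly_vec0 3 c _ 1%N isT; rewrite /c /= => h; apply/eqP; rewrite -subr_eq0; apply/eqP.
apply: h => t; rewrite !big_ord_recl big_ord0 /=.
have := sharp_cross (x + t *: z) y; rewrite hdetD hdetZ !sharpD !sharpZ !(tfZr, crossZr).
rewrite !(crossDl, crossDr, crossZl, crossZr, tfDl, tfZl) !sharp_cross => /eqP.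
rewrite -subr_eq0 => /eqP h.
by rewrite -[RHS]h /bump /=; vring.
Qed.

(** The transpose of [sharp_cross_lin], obtained as above. *)
Lemma cross_sharp_lin x y z : z ** (sharp x ** y) + x ** ((x ** z) ** y) =
  tf (sharp x) z *: y + tf z y *: sharp x + tf x y *: (x ** z).
Proof.
apply: tf_inj => u; rewrite !(tfDl, tfZl).
rewrite (tf_crossC z) (tf_crossC x (_ ** _)) !(tfC _ (_ ** y)) !(crossC _ y) !(tf_cross y) -tfDr.
rewrite [sharp x ** _ + _]addrC.
by rewrite sharp_cross_lin !(tfDr, tfZr) (tfC y u) (tfC y x) (tfC y z); ring.
Qed.

End CubicIdentities.

(** * The trace of a product of two cross multiplications *)

Section TraceIdentity.
Context {R : realType}.
Local Notation C := R[i].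
Implicit Types (x y z u v w : H3O R) (a b c t : C) (k : coord_idx).

(** The sum is the trace of v -> y ** (x ** v), since the basis dual to [unit_vec] under tf is
    [unit_vec] divided by the weights. A diagonal product receives 1 + 1 from the other two diagonal
    units and 8 from the octonion units of its own slot; an octonion form receives 1 from its
    diagonal unit and 1 + 4 + 4 from the three octonion slots. Both totals are 10. *)
Lemma trace_cross x y :
  \sum_k (weight k)%:R^-1 * tf (x ** unit_vec R k) (y ** unit_vec R k) = 10 * tf x y.
Proof.
have rotE (i : 'I_3) : (i + 1 + 1 = i + 2) * (i + 1 + 2 = i) * (i + 2 + 1 = i) *
    (i + 2 + 2 = i + 1).
  by case: i => [[|[|[|//]]] ?]; do !split; apply/val_inj.
have sum3 (i : 'I_3) (F : 'I_3 -> C) : \sum_j F j = F i + F (i + 1) + F (i + 2).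
  rewrite !big_ord_recl big_ord0 addr0.
  set a0 := ord0; set a1 := lift _ _; set a2 := lift _ _.
  have [[-> -> ->]|[-> -> ->]|[-> -> ->]] : [\/ [/\ i = a0, i + 1 = a1 & i + 2 = a2],
      [/\ i = a1, i + 1 = a2 & i + 2 = a0] | [/\ i = a2, i + 1 = a0 & i + 2 = a1]].
    by case: i => [[|[|[|//]]] ?]; [apply: Or31 | apply: Or32 | apply: Or33];
       split; apply/val_inj.
  - by rewrite addrA.
  - by rewrite addrC.
  - by rewrite addrA addrC addrA.
have tf3 (i : 'I_3) z w : tf z w = diag_coef z i * diag_coef w i +
    diag_coef z (i + 1) * diag_coef w (i + 1) + diag_coef z (i + 2) * diag_coef w (i + 2)
    + (oform (oct_coef z i) (oct_coef w i) + oform (oct_coef z (i + 1)) (oct_coef w (i + 1))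
    + oform (oct_coef z (i + 2)) (oct_coef w (i + 2))).
  by rewrite tf.unlock /h3_form !(sum3 i).
have of0l (p : octonion C) : oform p 0 = 0.
  by rewrite oformE big1 ?mulr0 // => j _; rewrite mxE mulr0.
have ofZZ (p q : octonion C) a b : oform (a *: p) (b *: q) = a * b * oform p q.
  by rewrite !oformE !mulr_sumr; apply: eq_bigr => j _; rewrite !mxE; ring.
have [hl hr] := @omul_bilinear C; have hc := @oconj_linear C.
have om0l (p : octonion C) : omul p 0 = 0.
  by have := hr (-1) 0 0 p; rewrite scaler0 add0r scaleN1r addNr.
have om0r (p : octonion C) : omul 0 p = 0.
  by have := hl (-1) 0 0 p; rewrite scaler0 add0r scaleN1r addNr.
have oc0 : oconj 0 = 0 :> octonion C.
  by have := hc (-1) 0 0; rewrite scaler0 add0r scaleN1r addNr.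
have ofmul (p q u : octonion C) : (oform (oconj (omul p u)) (oconj (omul q u)) = onorm u * oform p q)
   * (oform (oconj (omul u p)) (oconj (omul u q)) = onorm u * oform p q).
  have := hc 1 (omul p u) (omul q u); have := hl 1 p q u; rewrite !scale1r => h1 h2.
  have := hc 1 (omul u p) (omul u q); have := hr 1 p q u; rewrite !scale1r => h3 h4.
  by split; rewrite {1}/oform -?h2 -?h4 -?h1 -?h3 !onorm_conj !onorm_mul /oform; ring.
have Ed i z : tf (x ** unit_vec R (inl i)) (z ** unit_vec R (inl i)) =
    diag_coef x (i + 1) * diag_coef z (i + 1) + diag_coef x (i + 2) * diag_coef z (i + 2)
    + oform (oct_coef x i) (oct_coef z i).
  set E := unit_vec R (inl i).
  have D j : diag_coef E j = (j == i)%:R by rewrite /E unit_vec.unlock /diag_coef mxE.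
  have O j : oct_coef E j = 0 by rewrite /E unit_vec.unlock; apply/rowP => k; rewrite !mxE.
  have [n1 n2] : (i + 1 == i) = false /\ (i + 2 == i) = false.
    by case: i {E D O} => [[|[|[|//]]] ?].
  have fd w j : diag_coef (w ** E) j = diag_coef w (j + 1) * (j + 2 == i)%:R
      + (j + 1 == i)%:R * diag_coef w (j + 2).
    by rewrite cross.unlock diag_freud !D O of0l subr0.
  have fo w j : oct_coef (w ** E) j = (- (j == i)%:R) *: oct_coef w j.
    rewrite cross.unlock oct_freud !O D om0l om0r oc0 scaler0 addr0 subr0 sub0r.
    by rewrite scaleNr.
  rewrite (tf3 i) !fd !fo !ofZZ !rotE !eqxx !n1 !n2 /=; ring.
have Eo i j z : tf (x ** unit_vec R (inr (i, j))) (z ** unit_vec R (inr (i, j))) =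
    4 * oct_coef x i 0 j * oct_coef z i 0 j + 2 * (diag_coef x i * diag_coef z i)
    + oform (oct_coef x (i + 1)) (oct_coef z (i + 1))
    + oform (oct_coef x (i + 2)) (oct_coef z (i + 2)).
  set E := unit_vec R (inr (i, j)); pose u : octonion C := delta_mx 0 j.
  have D l : diag_coef E l = 0 by rewrite /E unit_vec.unlock /diag_coef mxE.
  have O l : oct_coef E l = if l == i then u else 0.
    rewrite /E unit_vec.unlock; apply/rowP => k; rewrite /u !mxE /=.
    by case: (l == i); rewrite !mxE.
  have [n1 n2] : (i + 1 == i) = false /\ (i + 2 == i) = false.
    by case: i {E D O} => [[|[|[|//]]] ?].
  have nu : onorm u = 1.
    rewrite /onorm (bigD1 j) //= big1 ?addr0 => [|k kj]; rewrite mxE ?eqxx ?expr1n //=.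
    by rewrite (negbTE kj) expr0n.
  have ou (p : octonion C) : oform p u = 2 * p 0 j.
    rewrite oformE (bigD1 j) //= big1 ?addr0 => [|k kj]; rewrite mxE ?eqxx ?mulr1 //=.
    by rewrite (negbTE kj) mulr0.
  have d0 w : diag_coef (w ** E) i = - oform (oct_coef w i) u.
    by rewrite cross.unlock diag_freud !D O eqxx !(mulr0, mul0r) addr0 sub0r.
  have d1 w l : (l == i) = false -> diag_coef (w ** E) l = 0.
    by move=> li; rewrite cross.unlock diag_freud !D O li !(mulr0, mul0r) of0l addr0 subr0.
  have f0 w : oct_coef (w ** E) i = (- diag_coef w i) *: u.
    rewrite cross.unlock oct_freud !O D n1 n2 eqxx om0l om0r oc0 scale0r addr0 subr0 sub0r.
    by rewrite scaleNr.
  have f1 w : oct_coef (w ** E) (i + 1) = oconj (omul (oct_coef w (i + 2)) u).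
    by rewrite cross.unlock oct_freud !O D !rotE n1 n2 eqxx om0r oc0 scale0r scaler0 addr0 !subr0.
  have f2 w : oct_coef (w ** E) (i + 2) = oconj (omul u (oct_coef w (i + 1))).
    by rewrite cross.unlock oct_freud !O D !rotE n1 n2 eqxx om0l oc0 scale0r scaler0 add0r !subr0.
  rewrite (tf3 i) !d0 !(d1 _ (i + 1)) // !(d1 _ (i + 2)) // !f0 !f1 !f2 !ofmul !ofZZ !ou nu.
  have -> : u 0 j = 1 by rewrite /u mxE !eqxx.
  ring.
rewrite big_sumType /= (eq_bigr _ (fun i _ => congr1 _ (Ed i y))).
have -> : \sum_(i : 'I_3 * 'I_8) 2%:R^-1 * tf (x ** unit_vec R (inr i)) (y ** unit_vec R (inr i))
   = \sum_i \sum_j 2^-1 * tf (x ** unit_vec R (inr (i, j))) (y ** unit_vec R (inr (i, j))).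
  by rewrite pair_bigA; apply: eq_bigr => -[].
have Es i : \sum_j 2^-1 * tf (x ** unit_vec R (inr (i, j))) (y ** unit_vec R (inr (i, j))) =
    oform (oct_coef x i) (oct_coef y i) + 8 * (diag_coef x i * diag_coef y i)
    + 4 * oform (oct_coef x (i + 1)) (oct_coef y (i + 1))
    + 4 * oform (oct_coef x (i + 2)) (oct_coef y (i + 2)).
  under eq_bigr do rewrite Eo.
  rewrite -mulr_sumr [oform (oct_coef x i) _]oformE.
  move: (oform (oct_coef x (i + 1)) _) (oform (oct_coef x (i + 2)) _) => p1 p2.
  rewrite !big_split /= !sumr_const !card_ord.
  have -> : \sum_(j < 8) 4 * oct_coef x i 0 j * oct_coef y i 0 j =
     4 * \sum_(j < 8) oct_coef x i 0 j * oct_coef y i 0 j.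
    by rewrite mulr_sumr; apply: eq_bigr => j _; rewrite mulrA.
  by field.
rewrite (eq_bigr _ (fun i _ => Es i)) !(sum3 0) (tf3 0) !rotE !add0r invr1.
ring.
Qed.

End TraceIdentity.

(* Vanishes on the second boundary component, see gap_gap. *)
HB.lock Definition gap (R : realType) (x : H3O R) :=
  x - sharp x ** cj x + hdet x *: sharp (cj x).

Section BoundaryVector.
Context {R : realType}.
Local Notation C := R[i].
Implicit Types (x y z u v w : H3O R) (a b c t : C).

Definition cjE := (@cjD R, @cjN R, @cjZ R, @cj_cross R, @cj_sharp R, @cjK R).
Definition tfE := (@tfDl R, @tfNl R, @tfZl R, @tfDr R, @tfNr R, @tfZr R).
Definition crossE := (@crossDl R, @crossNl R, @crossZl R, @crossDr R, @crossNr R, @crossZr R).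

(* The coefficients m_k(x, x) of the generic minimal polynomial. *)
Definition s1 x := tf x (cj x).
Definition s2 x := tf (sharp x) (sharp (cj x)).
Definition s3 x := hdet x * (hdet x)^*.

Lemma s1_ge0 x : 0 <= s1 x. Proof. exact: herm_ge0. Qed.
Lemma s2_ge0 x : 0 <= s2 x. Proof. by rewrite /s2 -cj_sharp herm_ge0. Qed.
Lemma s3_ge0 x : 0 <= s3 x. Proof. exact: mul_conjC_ge0. Qed.
Lemma conj_s1 x : (s1 x)^* = s1 x. Proof. by rewrite conj_Creal ?ger0_real ?s1_ge0. Qed.
Lemma conj_s2 x : (s2 x)^* = s2 x. Proof. by rewrite conj_Creal ?ger0_real ?s2_ge0. Qed.
Lemma conj_s3 x : (s3 x)^* = s3 x. Proof. by rewrite conj_Creal ?ger0_real ?s3_ge0. Qed.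

Lemma hermE x y : h3_herm x y = tf x (cj y).
Proof. by rewrite tf.unlock cj.unlock. Qed.

Lemma f1E x : f1 x = 1 - s1 x + s2 x - s3 x.
Proof.
rewrite /f1 !hermE /s1 /s2 /s3 cj_sharp normCK; congr (_ - _ * _); by rewrite hdet.unlock.
Qed.
Lemma f2E x : f2 x = 3 - 2 * s1 x + s2 x.
Proof. by rewrite /f2 !hermE /s2 cj_sharp. Qed.
Lemma f3E x : f3 x = 3 - s1 x.
Proof. by rewrite /f3 !hermE. Qed.

Lemma tripleE x y z :
  triple x y z = tf x (cj y) *: z + tf z (cj y) *: x - (x ** z) ** cj y.
Proof. by rewrite /triple !hermE cross.unlock cj.unlock. Qed.

Lemma tf_sharpC x : tf x (sharp x) = 3 * hdet x.
Proof. by rewrite tfC tf_sharp. Qed.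
Lemma tf_cross_cj x : tf (sharp x ** cj x) (cj x) = 2 * s2 x.
Proof. by rewrite tf_cross crossxx tfZr. Qed.
Lemma tf_cross_sharp x : tf (sharp x ** cj x) (sharp x) = 2 * hdet x * s1 x.
Proof. by rewrite tf_crossC crossxx sharpK !tfZl mulrA. Qed.

Lemma gap_herm x : tf (gap x) (cj x) = s1 x - 2 * s2 x + 3 * s3 x.
Proof.
rewrite gap.unlock !tfE tf_cross_cj tf_sharp hdet_cj /s3 /s1; ring.
Qed.

Lemma gap_sharp x : tf (gap x) (sharp x) = hdet x * (3 - 2 * s1 x + s2 x).
Proof. rewrite gap.unlock !tfE tf_cross_sharp tf_sharpC (tfC (sharp (cj x))) -/(s2 x); ring. Qed.

Lemma gap_gap x : tf (gap x) (cj (gap x)) =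
  (3 - 2 * s1 x + s2 x) ^+ 2 - (1 - s1 x + s2 x - s3 x) *
     (2 * (3 - s1 x) + (3 - 2 * s1 x + s2 x)).
Proof.
have e1 : tf (gap x) (sharp (cj x) ** x) =
    2 * s2 x - 3 * s3 x - s1 x * s2 x + 2 * s3 x * s1 x.
  have ea : tf x (sharp (cj x) ** x) = 2 * s2 x.
    by rewrite tfC tf_cross crossxx tfZr tfC.
  have eb : tf (sharp x ** cj x) (sharp (cj x) ** x) = 3 * s3 x + s1 x * s2 x.
    rewrite (crossC (sharp (cj x)) x) -tf_cross (crossC _ x) (cross_sharp x) !tfE.
    by rewrite tf_sharpC hdet_cj /s3 /s2 /s1; ring.
  have ec : tf (sharp (cj x)) (sharp (cj x) ** x) = 2 * (hdet x)^* * s1 x.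
    by rewrite -tf_cross crossxx sharpK !tfE hdet_cj mulrA (tfC _ x).
  rewrite {1}gap.unlock !tfE ea eb ec /s3; ring.
rewrite {2}gap.unlock !cjE !tfE e1 -/(s1 x) gap_herm gap_sharp -hdet_cj.
rewrite hdet_cj /s3; ring.
Qed.

End BoundaryVector.

(* sk x annihilates both the tripotent defect and gap; on gap there is one more
   real-linear syzygy, needed because the kernel of sk at e + t w is too large. *)
HB.lock Definition sk (R : realType) (x v : H3O R) := triple x x v - triple x v x.
HB.lock Definition tripotent_defect (R : realType) (x : H3O R) := x - 2^-1 *: triple x x x.
HB.lock Definition gap_syzygy (R : realType) (x v : H3O R) : R[i] :=
  let g2 := 3 - 2 * s1 x + s2 x in let g3 := 3 - s1 x in
  let a := tf v (cj ((2 * g3 + g2) *: x - 3 *: gap x)) in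
  2 * (g3 - g2) * tf v (sharp x) - hdet x * (2^-1 * (a + a^*)).

Section Syzygies.
Context {R : realType}.
Local Notation C := R[i].
Implicit Types (x y z u v w e : H3O R) (a b c t : C).

Lemma skE x v : sk x v = s1 x *: v + tf v (cj x) *: x - (x ** v) ** cj x
  - (2 * tf x (cj v)) *: x + 2 *: (sharp x ** cj v).
Proof. by rewrite sk.unlock !tripleE crossxx crossZl /s1; vring. Qed.

Lemma skD x u v : sk x (u + v) = sk x u + sk x v.
Proof. by rewrite !skE !cjE !tfE !crossE; vring. Qed.
Lemma skZ x a v : a^* = a -> sk x (a *: v) = a *: sk x v.
Proof. by move=> ar; rewrite !skE !cjE !tfE !crossE ar; vring. Qed.
Lemma skN x v : sk x (- v) = - sk x v.
Proof. by rewrite -scaleN1r skZ ?scaleN1r // rmorphN rmorph1. Qed.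

Lemma sk_self x : sk x x = 0.
Proof. by rewrite skE crossxx crossZl -/(s1 x); vring. Qed.

(** The three terms of [gap x] are real combinations of odd powers of x in the triple system. For
    such p one has D(x, p) = D(p, x), hence {xxp} = {xpx}. *)
Lemma sk_cross x : sk x (sharp x ** cj x) = 0.
Proof.
rewrite skE tf_cross_cj cross_sharp !cjE !crossE.
have -> : tf x (sharp (cj x) ** x) = 2 * s2 x by rewrite tfC tf_cross crossxx tfZr tfC.
rewrite (crossC (sharp (cj x)) x) sharp_cross crossxx -/(s1 x) -/(s2 x); vring.
Qed.

Lemma sk_sharp x : sk x (hdet x *: sharp (cj x)) = 0.
Proof.
rewrite skE !cjE !tfE !crossE tf_sharp !tf_sharpC hdet_cj (crossC (x ** _)).
by rewrite (crossC x) cross_sharp crossxx sharpK (tfC _ x) -/(s1 x) hdet_cj; vring.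
Qed.

Lemma sk_gap x : sk x (gap x) = 0.
Proof.
by rewrite gap.unlock !skD skN sk_self sk_cross sk_sharp oppr0 !addr0.
Qed.

Lemma tdefE x : tripotent_defect x = x - s1 x *: x + sharp x ** cj x.
Proof.
rewrite tripotent_defect.unlock tripleE crossxx -/(s1 x) !crossE; vpush.
by field.
Qed.

Lemma sk_tripotent_defect x : sk x (tripotent_defect x) = 0.
Proof.
by rewrite tdefE !(skD, skN) skZ ?conj_s1 // sk_self sk_cross scaler0 oppr0 !addr0.
Qed.

Lemma syzD x u v : gap_syzygy x (u + v) = gap_syzygy x u + gap_syzygy x v.
Proof. by rewrite gap_syzygy.unlock /= !tfDl !rmorphD; ring. Qed.
Lemma syzZ x a v : a^* = a -> gap_syzygy x (a *: v) = a * gap_syzygy x v.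
Proof. by move=> ar; rewrite gap_syzygy.unlock /= !tfZl rmorphM /= ar; ring. Qed.

(** Origin of the coefficients: (gap|x) = f2 - 3 f1 and (gap|gap) = f2^2 - f1 (2 f3 + f2), so
    pairing [gap x] with (2 f3 + f2) x - 3 gap(x) eliminates f1 and leaves 2 (f3 - f2) f2, a real
    number. Pairing with the adjoint gives det(x) f2, and the two results are proportional. *)
Lemma syz_gap x : gap_syzygy x (gap x) = 0.
Proof.
have r1 : s1 x \is Num.real by rewrite ger0_real ?s1_ge0.
have r2 : s2 x \is Num.real by rewrite ger0_real ?s2_ge0.
have r3 : s3 x \is Num.real by rewrite ger0_real ?s3_ge0.
have e : tf (gap x) (cj ((2 * (3 - s1 x) + (3 - 2 * s1 x + s2 x)) *: x - 3 *: gap x)) =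
    2 * (3 - s1 x - (3 - 2 * s1 x + s2 x)) * (3 - 2 * s1 x + s2 x).
  have -> : cj ((2 * (3 - s1 x) + (3 - 2 * s1 x + s2 x)) *: x - 3 *: gap x) =
     (2 * (3 - s1 x) + (3 - 2 * s1 x + s2 x)) *: cj x - 3 *: cj (gap x).
    rewrite !cjE conj_Creal ?conj_Creal // ?(rpredD, rpredN, rpredB, rpredM) ?realn ?real1 //.
  by rewrite !tfE gap_gap gap_herm; ring.
rewrite gap_syzygy.unlock /= e gap_sharp conj_Creal; last first.
  by rewrite ?(rpredD, rpredN, rpredB, rpredM) ?realn ?real1.
by field.
Qed.

End Syzygies.

(** * Unit vectors with zero adjoint *)

Section RankOne.
Context {R : realType}.
Local Notation C := R[i].
Implicit Types (x y z u v e : H3O R) (a b c t : C).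
Variable w : H3O R.
Hypotheses (w1 : tf w (cj w) = 1) (w0 : sharp w = 0).

Let w0' : sharp (cj w) = 0. Proof. by rewrite -cj_sharp w0 cj0. Qed.

(** It follows that v -> [cj w ** (w ** v)] is idempotent; this map is the projection onto
    V_0(w). *)
Lemma rank1_cross v : w ** (cj w ** (w ** v)) = w ** v.
Proof.
have := cross_sharp_lin w (cj w) v; rewrite w0 w1 cross0l cross0r tf0l !scale0r scaler0.
by rewrite !add0r scale1r (crossC (w ** v)).
Qed.

Lemma rank1_neq0 : w != 0.
Proof. by apply/eqP => w2; move: w1; rewrite w2 tf0l => /eqP; rewrite eq_sym oner_eq0. Qed.

Lemma rank1_orth x : cj w ** (w ** x) = x -> tf x (cj w) = 0.
Proof. by move<-; rewrite tf_crossC crossxx w0' scaler0 tf0l. Qed.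

(** Both factors have the form [cj w ** u]. In [sharp_cross_lin] at [cj w], whose adjoint is 0, only
    the term along [cj w] survives. *)
Lemma rank1_V0_cross x z : cj w ** (w ** x) = x -> cj w ** (w ** z) = z ->
  x ** z = tf (x ** z) w *: cj w.
Proof.
move=> hx hz.
have h : x ** z = tf x (w ** z) *: cj w.
  rewrite -{1}hx -{1}hz; have := sharp_cross_lin (cj w) (w ** z) (w ** x).
  by rewrite w0' cross0l addr0 tf0l !scale0r add0r tf0l scale0r addr0 hx.
by rewrite (tf_cross x z w) (crossC z) -h.
Qed.

Lemma rank1_orth_triple y z : cj w ** (w ** y) = y -> triple w y z = 0.
Proof.
move=> hy; have := sharp_cross_lin w (cj w ** cj y) z.
have hy' : cj y = w ** (cj w ** cj y) by rewrite -{1}hy !cjE.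
rewrite w0 cross0l addr0 tf0l !scale0r add0r tf0l scale0r addr0 -hy'.
rewrite tf_crossC -hy' tfC => e; rewrite tripleE e.
have -> : tf w (cj y) = 0 by rewrite -(tf_cjr) (rank1_orth hy) rmorph0.
by rewrite scale0r add0r subrr.
Qed.

End RankOne.

(** * Dimensions as traces of projections *)

Section Dimensions.
Context {R : realType}.
Local Notation C := R[i].
Implicit Types (x y z u v w e : H3O R) (a b c t : C) (W : {vspace H3O R}).

Lemma co_tf k x : co k x = (weight k)%:R^-1 * tf x (unit_vec R k).
Proof. by rewrite tf_unit mulKf // weight_neq0. Qed.

(** The rank of a projection is its trace. As the field has characteristic 0, an equality of complex
    numbers is enough to determine the dimension. *)
Lemma dim_trace W (F : H3O R -> H3O R) : linear F ->
  (forall v, F v \in W) -> (forall v, v \in W -> F v = v) ->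
  (\dim W)%:R = \sum_k co k (F (unit_vec R k)) :> C.
Proof.
move=> linF FW FK.
pose L := HB.pack_for {linear H3O R -> H3O R} F (GRing.isLinear.Build _ _ _ _ F linF).
have FE : F =1 L by [].
pose B := vbasis W.
have -> : \sum_k co k (F (unit_vec R k)) =
  \sum_k \sum_(i < \dim W) coord B i (F (unit_vec R k)) * co k B`_i.
  apply: eq_bigr => k _; rewrite {1}(coord_vbasis (FW (unit_vec R k))) co_sum.
  by apply: eq_bigr => i _; rewrite coZ.
rewrite exchange_big /=.
rewrite (eq_bigr (fun=> 1)) => [|i _]; first by rewrite sumr_const card_ord.
have Bi : B`_i \in W by apply: vbasis_mem; rewrite mem_nth ?size_tuple.
transitivity (coord B i (F B`_i)).
  rewrite [in RHS](co_sumE B`_i) FE linear_sum linear_sum; apply: eq_bigr => k _.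
  by rewrite !linearZ /= mulrC.
by rewrite FK // coord_free ?eqxx // (basis_free (vbasisP W)).
Qed.

Lemma rank1_cross_linear w : linear (fun v => cj w ** (w ** v)).
Proof. by move=> a u v; rewrite !crossE. Qed.

Lemma trace_rank1_V0 w : \sum_k co k (cj w ** (w ** unit_vec R k)) = 10 * tf w (cj w).
Proof.
rewrite -trace_cross; apply: eq_bigr => k _.
by rewrite co_tf tf_crossC (tfC (cj w ** _)).
Qed.

Lemma trace_rank1_V2 w :
  \sum_k co k (tf (unit_vec R k) (cj w) *: w) = tf w (cj w).
Proof.
rewrite tf_sumE; apply: eq_bigr => k _.
by rewrite coZ tfC tf_unit; ring.
Qed.

Lemma trace_id : \sum_k co k (unit_vec R k) = 27.
Proof.
rewrite (eq_bigr (fun _ => 1)) => [|k _]; last by rewrite co_unit eqxx.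
by rewrite sumr_const card_sum card_prod !card_ord.
Qed.

End Dimensions.

(** * Orthonormal bases of real forms *)

Section RealForms.
Context {R : realType}.
Local Notation C := R[i].
Implicit Types (x y z u v w e : H3O R) (a b c t : C).
Variables (W : {vspace H3O R}) (th : H3O R -> H3O R).
Hypotheses (thW : forall v, v \in W -> th v \in W)
  (thD : forall u v, th (u + v) = th u + th v) (thZ : forall a v, th (a *: v) = a^* *: th v)
  (thK : forall v, v \in W -> th (th v) = v)
  (th_isom : forall u v, u \in W -> v \in W -> tf (th u) (cj (th v)) = (tf u (cj v))^*).

(** A Gram-Schmidt step that stays among the fixed vectors of [th]: the residue v' of a new vector
    is replaced by v' + th v', still orthogonal to s because [th] is isometric and fixes s. *)
Lemma orthonormal_extend (s : seq (H3O R)) : (size s < \dim W)%N ->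
  {in s, forall x, x \in W /\ th x = x} ->
  (forall i j : nat, (i < size s)%N -> (j < size s)%N ->
     tf s`_i (cj s`_j) = (i == j)%:R) ->
  exists u, [/\ u \in W, th u = u, tf u (cj u) = 1 & {in s, forall x, tf u (cj x) = 0}].
Proof.
move=> ss sW so.
have /subvPn [v vW vs] : ~~ (W <= span s)%VS.
  apply/negP => /dimvS; rewrite leqNgt => /negP; apply.
  exact: leq_ltn_trans (dim_span s) ss.
pose v' := v - \sum_(i < size s) tf v (cj s`_i) *: s`_i.
have v'W : v' \in W.
  rewrite rpredB // rpred_sum // => i _; rewrite rpredZ //.
  by have [] := sW s`_i (mem_nth 0 (ltn_ord i)).
have v'0 : v' != 0.
  apply: contraNneq vs => /eqP; rewrite subr_eq0 => /eqP ->.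
  by rewrite rpred_sum // => i _; rewrite rpredZ // memv_span // mem_nth.
have sumr (I : finType) (F : I -> H3O R) z : tf (\sum_i F i) z = \sum_i tf (F i) z.
  by elim/big_rec2: _ => [|i y1 y2 _ <-]; rewrite ?tf0l ?tfDl.
have v's (x : H3O R) : x \in s -> tf v' (cj x) = 0.
  move=> /(nthP 0) [j js <-]; rewrite /v' tfDl tfNl sumr (bigD1 (Ordinal js)) //=.
  rewrite tfZl so // eqxx mulr1 big1 ?addr0 ?subrr // => i ij.
  rewrite tfZl so // (_ : (i == j :> nat) = false) ?mulr0 //.
  by apply: contraNF ij => /eqP ij; apply/eqP/val_inj.
have tv's (x : H3O R) : x \in s -> tf (th v') (cj x) = 0.
  by move=> xs; have [xW xth] := sW x xs; rewrite -xth th_isom // v's // rmorph0.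
have [u [uW uth u0 us]] : exists u, [/\ u \in W, th u = u, u != 0 & {in s, forall x, tf u (cj x) = 0}].
  (* If the symmetrization vanishes then th v' = - v', and antilinearity makes i v' a fixed
     vector. *)
  have [e|n] := eqVneq (v' + th v') 0.
    exists ('i *: v'); split; first by rewrite rpredZ.
    - rewrite thZ conjCi; apply/eqP; rewrite scaleNr eq_sym -subr_eq0 opprK -scalerDr e.
      by rewrite scaler0.
    - by rewrite scaler_eq0 negb_or v'0 andbT neq0Ci.
    - by move=> x xs; rewrite tfZl v's ?mulr0.
  exists (v' + th v'); split => //; first by rewrite rpredD // thW.
    by rewrite thD thK // addrC.
  by move=> x xs; rewrite tfDl v's // tv's // addr0.
pose n := sqrtC (tf u (cj u)).
have n0 : n != 0.
  by rewrite sqrtC_eq0; apply: contra u0 => /eqP /herm_eq0 ->.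
have nr : (n^-1)^* = n^-1.
  by rewrite conj_Creal // realV ger0_real // sqrtC_ge0 herm_ge0.
exists (n^-1 *: u); split; first by rewrite rpredZ.
- by rewrite thZ nr uth.
- by rewrite cjZ tfZl tfZr nr -[tf u _]sqrtCK -/n; field.
- by move=> x xs; rewrite tfZl us ?mulr0.
Qed.

(** Applied to v -> conj(w ** v) on V_0(w), to Q(e) on V_2(e) for e of rank 2, and to Q(e) on the
    whole space for e maximal. *)
Lemma real_form_basis : exists b : 'I_(\dim W) -> H3O R,
  [/\ forall i, b i \in W, forall i, th (b i) = b i
    & forall i j, tf (b i) (cj (b j)) = (i == j)%:R].
Proof.
have h k : (k <= \dim W)%N -> exists s : seq (H3O R), [/\ size s = k,
    {in s, forall x, x \in W /\ th x = x} &
  (forall i j : nat, (i < size s)%N -> (j < size s)%N -> tf s`_i (cj s`_j) = (i == j)%:R)].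
  elim: k => [|k IH] kW; first by exists [::].
  have [s [sk sW so]] := IH (ltnW kW).
  have [|u [uW uth u1 us]] := orthonormal_extend (s := s) _ sW so; first by rewrite sk.
  exists (rcons s u); rewrite size_rcons sk; split => // [x|i j].
    by rewrite mem_rcons in_cons => /predU1P [->|/sW].
  rewrite !ltnS (leq_eqVlt i) (leq_eqVlt j) !nth_rcons sk.
  move=> /predU1P [->|ik] /predU1P [->|jk]; rewrite ?ltnn ?eqxx ?ik ?jk.
  - by rewrite u1.
  - by rewrite us ?mem_nth ?sk // gtn_eqF.
  - by rewrite -tf_cjr us ?mem_nth ?sk // rmorph0 ltn_eqF.
  - by rewrite so ?sk.
have [s [ss sW so]] := h _ (leqnn _).
have si (i : 'I_(\dim W)) : s`_i \in s by rewrite mem_nth ?ss.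
exists (fun i => s`_i); split=> [i|i|i j]; try by have [] := sW _ (si i).
by rewrite so ?ss.
Qed.

End RealForms.

Section OrthonormalFamilies.
Context {R : realType}.
Local Notation C := R[i].
Implicit Types (x y z u v w e : H3O R) (a b c t : C).

Lemma tf_suml (I : finType) (F : I -> H3O R) z : tf (\sum_i F i) z = \sum_i tf (F i) z.
Proof. by elim/big_rec2: _ => [|i y1 y2 _ <-]; rewrite ?tf0l ?tfDl. Qed.

Lemma orthonormal_expand (W : {vspace H3O R}) (b : 'I_(\dim W) -> H3O R) :
  (forall i, b i \in W) -> (forall i j, tf (b i) (cj (b j)) = (i == j)%:R) ->
  forall v, v \in W -> v = \sum_i tf v (cj (b i)) *: b i.
Proof.
move=> bW bo v vW; pose X := [tuple b i | i < \dim W].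
have Xi (i : 'I_(\dim W)) : X`_i = b i by rewrite -tnth_nth tnth_mktuple.
have fX : free X.
  apply/freeP => k k0 i; have := congr1 (fun z => tf z (cj (b i))) k0.
  rewrite /= tf_suml tf0l (bigD1 i) //= big1 => [|j ji].
    by rewrite Xi tfZl bo eqxx mulr1 addr0.
  by rewrite Xi tfZl bo (negbTE ji) mulr0.
have /span_basis XW : basis_of W X.
  rewrite basisEfree fX size_tuple leqnn andbT; apply/span_subvP => _ /mapP [i _ ->].
  exact: bW.
have := coord_span (X := X) (v := v); rewrite XW => /(_ vW) e.
rewrite {1}e; apply: eq_bigr => i _; rewrite Xi; congr (_ *: _).
rewrite [in RHS]e tf_suml (bigD1 i) //= big1 => [|j ji].
  by rewrite Xi tfZl bo eqxx mulr1 addr0.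
by rewrite Xi tfZl bo (negbTE ji) mulr0.
Qed.

End OrthonormalFamilies.

(** * Tripotents and Peirce spaces *)

Section TripleProduct.
Context {R : realType}.
Local Notation C := R[i].
Implicit Types (x y z u v w e : H3O R) (a b c t : C).

Lemma triple_adj x y z u : tf (triple x y z) (cj u) = tf z (cj (triple y x u)).
Proof.
rewrite !tripleE !cjD cjN !cjZ !cj_cross !cjK !tf_cjr.
rewrite !tfDl !tfDr tfNl tfNr !tfZl !tfZr.
have -> : tf ((x ** z) ** cj y) (cj u) = tf z ((cj y ** cj u) ** x).
  by rewrite tf_cross (crossC x) tf_cross (crossC x).
by ring.
Qed.

Lemma tripleC x y z : triple x y z = triple z y x.
Proof. by rewrite !tripleE (crossC x); vring. Qed.

Lemma triple_eq0C x y : (forall z, triple x y z = 0) -> forall z, triple y x z = 0.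
Proof.
move=> h z; apply: tf_inj => u; rewrite -(cjK u) triple_adj h cj0 tf0r.
by rewrite tf0l.
Qed.

Lemma tripleDr x y z u : triple x y (z + u) = triple x y z + triple x y u.
Proof. by rewrite !tripleE !tfE !crossE; vring. Qed.
Lemma tripleDl x y z u : triple (x + u) y z = triple x y z + triple u y z.
Proof. by rewrite ![triple _ y z]tripleC tripleDr. Qed.
Lemma tripleDm x y z u : triple x (y + u) z = triple x y z + triple x u z.
Proof. by rewrite !tripleE !cjE !tfE !crossE; vring. Qed.
Lemma tripleZr a x y z : triple x y (a *: z) = a *: triple x y z.
Proof. by rewrite !tripleE !tfE !crossE; vring. Qed.
Lemma triple0l y z : triple 0 y z = 0.
Proof. by rewrite tripleE tf0l !cross0l; vring. Qed.

(** 18 = 27 + 1 - 10, from the identity, the rank-one term and [trace_cross]. This is the genus of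
    the triple system; it shows that D(x, y) = 0 forces (x|y) = 0. *)
Lemma trace_triple x y :
  \sum_k co k (triple x y (unit_vec R k)) = 18 * tf x (cj y).
Proof.
have -> : \sum_k co k (triple x y (unit_vec R k)) =
    tf x (cj y) * \sum_k co k (unit_vec R k) + \sum_k co k (tf (unit_vec R k) (cj y) *: x)
    - \sum_k (weight k)%:R^-1 * tf (x ** unit_vec R k) (cj y ** unit_vec R k).
  rewrite mulr_sumr -big_split -sumrB /=; apply: eq_bigr => k _.
  rewrite tripleE !coD coN !coZ; congr (_ - _).
  by rewrite co_tf tf_cross.
rewrite trace_id trace_cross.
have -> : \sum_k co k (tf (unit_vec R k) (cj y) *: x) = tf x (cj y).
  rewrite tf_sumE; apply: eq_bigr => k _; rewrite coZ tfC tf_unit; ring.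
by ring.
Qed.

Lemma orth_herm x y : (forall z, triple x y z = 0) -> tf x (cj y) = 0.
Proof.
move=> h; have := trace_triple x y; rewrite big1 => [/esym/eqP|k _]; last by rewrite h co0.
by rewrite mulf_eq0 pnatr_eq0 /= => /eqP.
Qed.

Definition quad e y := tf e (cj y) *: e - sharp e ** cj y.

Lemma quadE e y : 2^-1 *: triple e y e = quad e y.
Proof.
by rewrite tripleE crossxx !crossE; rewrite /quad; vpush; field.
Qed.

Lemma quadD e u v : quad e (u + v) = quad e u + quad e v.
Proof. by rewrite /quad !cjE !tfE !crossE; vring. Qed.
Lemma quadZ e a v : quad e (a *: v) = a^* *: quad e v.
Proof. by rewrite /quad !cjE !tfE !crossE; vring. Qed.
Lemma quadN e v : quad e (- v) = - quad e v.
Proof. by rewrite /quad !cjE !tfE !crossE; vring. Qed.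

Lemma quad_adj e u v : tf (quad e u) (cj v) = tf (quad e v) (cj u).
Proof.
rewrite /quad !tfE (tf_crossC _ (cj u)); ring.
Qed.

Lemma tripotentE e : tripotent triple e <-> sharp e ** cj e = (s1 e - 1) *: e.
Proof.
rewrite /tripotent tripleE crossxx crossZl -/(s1 e); split => h.
  apply: (@scalerI _ _ 2); first by rewrite pnatr_eq0.
  vpush; vpush_hyp h k.
  have -> : 2 * co k (sharp e ** cj e) = 2 * s1 e * co k e -
    (s1 e * co k e + s1 e * co k e - 2 * co k (sharp e ** cj e)) by ring.
  by rewrite h; ring.
by rewrite h; vring.
Qed.

Lemma tripotent_orthD (c f : H3O R) : tripotent triple c -> tripotent triple (c + f) ->
  (forall z, triple c f z = 0) -> tripotent triple f.
Proof.
rewrite /tripotent => hc hcf o; have o' := triple_eq0C o.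
move: hcf; rewrite !(tripleDl, tripleDm, tripleDr) !o !o'.
rewrite (tripleC c c f) o' (tripleC f f c) o hc !(addr0, add0r) scalerDr.
exact: addrI.
Qed.

End TripleProduct.

Section TripotentClasses.
Context {R : realType}.
Local Notation C := R[i].
Implicit Types (x y z u v w e : H3O R) (a b c t : C).

Lemma E1P e : E1 e <-> tf e (cj e) = 1 /\ sharp e = 0.
Proof. by rewrite /E1 /= hermE. Qed.

Lemma h3_detE e : h3_det e = hdet e. Proof. by rewrite hdet.unlock. Qed.

Lemma E2P e : E2 e <-> [/\ s1 e = 2, s2 e = 1 & hdet e = 0].
Proof. by rewrite /E2 /= !hermE h3_detE cj_sharp. Qed.

Lemma E3_s e : E3 e <-> [/\ s1 e = 3, s2 e = 3 & s3 e = 1].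
Proof. by rewrite /E3 /= !hermE h3_detE cj_sharp normCK. Qed.

Lemma E3P e : E3 e <->
  [/\ tf e (cj e) = 3, sharp e = hdet e *: cj e & hdet e * (hdet e)^* = 1].
Proof.
rewrite E3_s; split => [[h1 h2 h3]|[h1 h2 h3]]; split => //; last first.
  by rewrite /s2 -cj_sharp h2 !cjE !tfE (tfC _ e) h1 mulrA h3 mul1r.
apply/eqP; rewrite -subr_eq0; apply/eqP/herm_eq0.
rewrite !cjE !tfE tf_sharp tf_sharpC hdet_cj -/(s2 e) (tfC (cj e)) -/(s1 e).
rewrite h1 h2; move: h3; rewrite /s3 => h3.
by transitivity (3 - 3 * (hdet e * (hdet e)^* ) : C); [ring | rewrite h3; ring].
Qed.

Lemma E1_neq0 e : E1 e -> e != 0.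
Proof. by case/E1P => h _; exact: rank1_neq0. Qed.

Lemma s1_neq0 e n : s1 e = n.+1%:R -> e != 0.
Proof.
move=> h; apply/eqP => e0; move: h; rewrite e0 /s1 tf0l => /esym/eqP.
by rewrite pnatr_eq0.
Qed.

Lemma scaler_eq0P a x : x != 0 -> a *: x = 0 -> a = 0.
Proof. by move=> x0 /eqP; rewrite scaler_eq0 (negbTE x0) orbF => /eqP. Qed.

(** The equations of E2 amount to f1 = f2 = 0 and det e = 0. So [gap e] has norm 0, and with zero
    determinant its vanishing reads e = e# ** conj e; the remaining facts follow from it. *)
Lemma E2_facts e : E2 e -> let w := cj (sharp e) in
  [/\ E1 w, sharp e = cj w, w ** e = cj e, cj w ** (w ** e) = e & tf e (cj w) = 0].
Proof.
move=> /E2P [h1 h2 h3] w; have ew : sharp e = cj w by rewrite /w cjK.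
have g0 : gap e = 0.
  apply: herm_eq0; rewrite gap_gap h1 h2 /s3 h3; ring.
have h4 : cj w ** cj e = e.
  have : e - sharp e ** cj e = 0 by rewrite -[RHS]g0 gap.unlock h3 scale0r addr0.
  by move/eqP; rewrite subr_eq0 -ew => /eqP <-.
have h5 : w ** e = cj e by rewrite -[in RHS]h4 !cjE.
split => //; last 1 first.
- by rewrite -ew tf_sharpC h3 mulr0.
- apply/E1P; split; first by rewrite /w cjK cj_sharp tfC.
  by rewrite /w -cj_sharp sharpK h3 scale0r cj0.
- by rewrite h5.
Qed.

Lemma E2_intro e w : tf e (cj e) = 2 -> sharp e = cj w -> E1 w -> E2 e.
Proof.
move=> h1 h2 /E1P [h3 h4]; apply/E2P; split => //.
  by rewrite /s2 -cj_sharp h2 cjK tfC.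
have e0 : e != 0 by apply: (@s1_neq0 _ 1).
by apply: (scaler_eq0P e0); rewrite -sharpK h2 -cj_sharp h4 cj0.
Qed.

Lemma E1_tripotent e : E1 e -> tripotent triple e.
Proof.
by move=> /E1P [h1 h2]; apply/tripotentE; rewrite h2 cross0l /s1 h1 subrr scale0r.
Qed.

Lemma E2_tripotent e : E2 e -> tripotent triple e.
Proof.
move=> h; have [_ ew h4 h5 _] := E2_facts h; have /E2P [h1 _ _] := h.
apply/tripotentE; rewrite h1 ew -h4 h5 (_ : 2 - 1 = 1) ?scale1r //; ring.
Qed.

Lemma E3_tripotent e : E3 e -> tripotent triple e.
Proof.
move=> /E3P [h1 h2 h3]; apply/tripotentE; rewrite h2 crossZl crossxx -cj_sharp h2.
rewrite !cjE !scalerA (mulrC _ 2) -mulrA h3 /s1 h1; congr (_ *: _); ring.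
Qed.

(** Crossing the tripotent equation with e gives (s1 - 2) e# = det(e) conj e, and pairing this with
    e gives det(e) (2 s1 - 6) = 0. If det e = 0, then s1 = 2 or e# = 0; otherwise s1 = 3. *)
Lemma tripotent_cases e : tripotent triple e -> [\/ e = 0, E1 e, E2 e | E3 e].
Proof.
move/tripotentE => h.
have hA : (s1 e - 2) *: sharp e = hdet e *: cj e.
  have := cross_sharp e (cj e); rewrite h crossZr crossxx -/(s1 e) => hh.
  vpush; vpush_hyp hh k.
  have -> : hdet e * co k (cj e) = hdet e * co k (cj e) + s1 e * co k (sharp e)
     - s1 e * co k (sharp e) by ring.
  by rewrite -hh; ring.
have hC : 2 * s2 e = (s1 e - 1) * s1 e by rewrite -tf_cross_cj h tfZl.
have [e0|e0] := eqVneq e 0; first exact: Or41.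
have hB : hdet e * (2 * s1 e - 6) = 0.
  have := congr1 (fun z => tf z e) hA; rewrite /= !tfZl tf_sharp (tfC _ e) -/(s1 e) => hh.
  have -> : hdet e * (2 * s1 e - 6) = (s1 e - 2) * (3 * hdet e) - hdet e * s1 e by ring.
  by rewrite hh subrr.
have [n0|n0] := eqVneq (hdet e) 0.
  move/eqP: hA; rewrite n0 scale0r scaler_eq0 => /orP [/eqP s|/eqP s].
    have s' : s1 e = 2 by apply/eqP; rewrite -subr_eq0 s.
    apply: Or43; apply/E2P; split => //; apply: (@mulfI _ 2); first by rewrite pnatr_eq0.
    by rewrite hC s'; ring.
  apply: Or42; apply/E1P; split => //; move: hC; rewrite /s2 s tf0l mulr0 => /esym/eqP.
  rewrite mulf_eq0 => /orP [|/eqP s0]; first by rewrite subr_eq0 => /eqP.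
  by move: e0; rewrite (herm_eq0 s0) eqxx.
have s : s1 e = 3.
  move/eqP: hB; rewrite mulf_eq0 (negbTE n0) /= => /eqP hB; apply: (@mulfI _ 2).
    by rewrite pnatr_eq0.
  by apply/eqP; rewrite -subr_eq0 -[X in _ == X]hB; apply/eqP; ring.
have e2 : sharp e = hdet e *: cj e by rewrite -hA s (_ : 3 - 2 = 1) ?scale1r //; ring.
apply: Or44; apply/E3P; split => //.
have := sharpK e; rewrite {1}e2 sharpZ -cj_sharp e2 !cjE scalerA => /eqP.
rewrite -subr_eq0 -scalerBl scaler_eq0 (negbTE e0) orbF => /eqP hh.
apply: (mulfI n0); rewrite mulr1; apply/eqP; rewrite -subr_eq0 -[X in _ == X]hh.
by apply/eqP; ring.
Qed.

Lemma E3_triple e v : E3 e -> triple e e v = 2 *: v.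
Proof.
move=> /E3P [h1 h2 h3].
have h : cj e = (hdet e)^* *: sharp e by rewrite h2 scalerA mulrC h3 scale1r.
rewrite tripleE h1 [in X in _ - X]h crossZr (crossC (_ ** _)) sharp_cross h2 tfZl.
rewrite (tfC _ v); vpush.
have -> : (hdet e)^* * (hdet e * co k v + hdet e * tf v (cj e) * co k e) =
   (hdet e * (hdet e)^*) * (co k v + tf v (cj e) * co k e) by ring.
rewrite h3; ring.
Qed.

Lemma E1_triple w v : E1 w -> triple w w v = v + tf v (cj w) *: w - cj w ** (w ** v).
Proof. by move=> /E1P [h1 h2]; rewrite tripleE h1 scale1r (crossC (cj w)). Qed.

Lemma E2_E3 e : E2 e -> E3 (e + cj (sharp e)).
Proof.
move=> h; have /E2P [h1 _ _] := h; have [/E1P [w1 w0] ew h4 _ h5] := E2_facts h.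
move: (cj (sharp e)) w1 w0 ew h4 h5 => w w1 w0 ew h4 h5.
have h5' : tf w (cj e) = 0 by rewrite -tf_cjr h5 rmorph0.
have h1' : tf e (cj e) = 2 by [].
have n1 : tf (e + w) (cj (e + w)) = 3.
  by rewrite cjD !tfE h1' h5 h5' w1; ring.
have sh : sharp (e + w) = cj (e + w).
  by rewrite sharpD ew w0 addr0 crossC h4 cjD addrC.
have hd : hdet (e + w) = 1 by rewrite hdetE sh tfC n1 mulVf ?pnatr_eq0.
by apply/E3P; rewrite hd rmorph1 mulr1 scale1r.
Qed.

(** Completing e by the orthogonal tripotent w = conj(e#) gives a maximal one, for which D is twice
    the identity. Hence D(e, e) = 2 - D(w, w), which is why the Peirce spaces of e and w are the
    same in reverse order. *)
Lemma E2_triple e v : E2 e -> triple e e v = 2 *: v - triple (cj (sharp e)) (cj (sharp e)) v.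
Proof.
move=> h; have := E3_triple v (E2_E3 h).
have [/E1P [w1 w0] _ _ h4 _] := E2_facts h; set w := cj (sharp e) in w1 w0 h4 *.
have o z : triple w e z = 0 by exact: rank1_orth_triple.
rewrite tripleDl !tripleDm o (triple_eq0C o) addr0 add0r => <-.
by rewrite addrK.
Qed.

(** [sharp_cross_lin] with its last two arguments equal. *)
Lemma sharp_crossE x y :
  sharp (x ** y) = tf (sharp x) y *: y + tf x (sharp y) *: x - sharp x ** sharp y.
Proof.
have := sharp_cross_lin x y y; rewrite !crossxx crossZr tf_cross crossxx tfZr => h.
apply: (@scalerI _ _ 2); first by rewrite pnatr_eq0.
vpush; vpush_hyp h k.
have -> : 2 * co k (sharp (x ** y)) = 2 * co k (sharp (x ** y)) +
  2 * co k (sharp x ** sharp y) - 2 * co k (sharp x ** sharp y) by ring.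
by rewrite h; ring.
Qed.

End TripotentClasses.

(** * Peirce decomposition of a minimal tripotent *)

Section PeirceRankOne.
Context {R : realType}.
Local Notation C := R[i].
Implicit Types (x y z u v e : H3O R) (a b c t : C).
Variable w : H3O R.
Hypothesis Ew : E1 w.

Let w1 : tf w (cj w) = 1. Proof. by case/E1P: Ew. Qed.
Let w0 : sharp w = 0. Proof. by case/E1P: Ew. Qed.
Let w0' : sharp (cj w) = 0. Proof. by rewrite -cj_sharp w0 cj0. Qed.
Local Notation P0 v := (cj w ** (w ** v)).
Local Notation P2 v := (tf v (cj w) *: w).

Lemma rank1_P0_orth v : tf (P0 v) (cj w) = 0.
Proof. by rewrite tf_crossC crossxx w0' scaler0 tf0l. Qed.

Lemma rank1_P0K v : P0 (P0 v) = P0 v.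
Proof. by rewrite (rank1_cross w1 w0). Qed.

Lemma rank1_peirce0 v : (v \in peirce triple 0 w) <-> P0 v = v.
Proof.
rewrite peirceE scale0r E1_triple //; split => [/eqP h|h].
  have hv : tf v (cj w) = 0.
    have := congr1 (fun z => tf z (cj w)) h; rewrite /= !tfDl tfNl rank1_P0_orth tf0l tfZl w1.
    by rewrite mulr1 oppr0 addr0 -mulr2n => /eqP; rewrite mulrn_eq0 /= => /eqP.
  by move: h; rewrite hv scale0r addr0 => /eqP; rewrite subr_eq0 => /eqP <-.
by rewrite (rank1_orth w0 h) h scale0r addr0 subrr.
Qed.

Lemma rank1_peirce1 v : (v \in peirce triple 1 w) <-> tf v (cj w) = 0 /\ P0 v = 0.
Proof.
rewrite peirceE scale1r E1_triple //; split => [/eqP h|[-> ->]]; last first.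
  by rewrite scale0r addr0 subr0.
have hv : tf v (cj w) = 0.
  have := congr1 (fun z => tf z (cj w)) h; rewrite /= !tfDl tfNl rank1_P0_orth tfZl w1.
  by rewrite mulr1 oppr0 addr0 => /eqP; rewrite -subr_eq0 addrAC subrr add0r => /eqP.
split => //; move: h; rewrite hv scale0r addr0 => /eqP.
by rewrite -subr_eq0 addrAC subrr add0r oppr_eq0 => /eqP.
Qed.

Lemma rank1_peirce2 v : (v \in peirce triple 2 w) <-> v = P2 v.
Proof.
rewrite peirceE E1_triple //; split => [/eqP h|h].
  have h' : v = P2 v - P0 v.
    by move: h; rewrite scaler_nat mulr2n -addrA => /addrI.
  have : P0 v = 0.
    have h3 : P0 v = - P0 v.
      rewrite {1}h' !crossDr !crossNr !crossZr crossxx w0 !scaler0 cross0r scaler0 add0r.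
      by rewrite rank1_P0K.
    have : 2 *: P0 v = 0 by rewrite scaler_nat mulr2n {1}h3 addNr.
    by move/eqP; rewrite scaler_eq0 pnatr_eq0 => /eqP.
  by move: h' => /[swap] ->; rewrite subr0.
have -> : P0 v = 0 by rewrite h !crossZr crossxx w0 !scaler0 cross0r scaler0.
by rewrite subr0 -h scaler_nat mulr2n.
Qed.

Lemma rank1_P1 v : v - P2 v - P0 v \in peirce triple 1 w.
Proof.
apply/rank1_peirce1; split.
  by rewrite !tfDl !tfNl tfZl w1 rank1_P0_orth mulr1 subrr oppr0 addr0.
rewrite !crossDr !crossNr !crossZr crossxx w0 !scaler0 cross0r scaler0 oppr0 addr0.
by rewrite rank1_P0K subrr.
Qed.

Lemma rank1_P0 v : P0 v \in peirce triple 0 w.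
Proof. by apply/rank1_peirce0; rewrite rank1_P0K. Qed.

Lemma rank1_P2 v : P2 v \in peirce triple 2 w.
Proof. by apply/rank1_peirce2; rewrite tfZl w1 mulr1. Qed.

Lemma dim_rank1_peirce0 : \dim (peirce triple 0 w) = 10%N.
Proof.
have := @dim_trace R (peirce triple 0 w) _ (@rank1_cross_linear R w) rank1_P0.
move=> /(_ (fun v => proj1 (rank1_peirce0 v))).
by rewrite trace_rank1_V0 w1 mulr1 => /eqP; rewrite eqr_nat => /eqP.
Qed.

Lemma dim_rank1_peirce2 : \dim (peirce triple 2 w) = 1%N.
Proof.
have lP : linear (fun v => P2 v) by move=> a u v; rewrite tfDl tfZl; vring.
have := @dim_trace R (peirce triple 2 w) _ lP rank1_P2.
move=> /(_ (fun v h => esym (proj1 (rank1_peirce2 v) h))).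
by rewrite trace_rank1_V2 w1 => /eqP; rewrite (eqr_nat _ _ 1) => /eqP.
Qed.

Lemma dim_rank1_peirce1 : \dim (peirce triple 1 w) = 16%N.
Proof.
have lP : linear (fun v => v - P2 v - P0 v).
  by move=> a u v; rewrite tfDl tfZl !crossE; vring.
have := @dim_trace R (peirce triple 1 w) _ lP rank1_P1.
have h v : v \in peirce triple 1 w -> v - P2 v - P0 v = v.
  by move=> /rank1_peirce1 [-> ->]; rewrite scale0r !subr0.
move=> /(_ h).
have -> : \sum_k co k (unit_vec R k - P2 (unit_vec R k) - P0 (unit_vec R k)) =
  \sum_k co k (unit_vec R k) - \sum_k co k (P2 (unit_vec R k))
   - \sum_k co k (P0 (unit_vec R k)).
  by rewrite -!sumrB; apply: eq_bigr => k _; rewrite !coD !coN.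
rewrite trace_id trace_rank1_V2 trace_rank1_V0 w1 => {}h.
have : (\dim (peirce triple 1 w))%:R = 16%:R :> C by rewrite h; ring.
by move/eqP; rewrite eqr_nat => /eqP.
Qed.

(* The conjugation of V_0(w) whose fixed points form the real spin factor. *)
Definition peirce0_conj v := cj (w ** v).

Lemma peirce0_conjE v : peirce0_conj v = cj w ** cj v.
Proof. by rewrite /peirce0_conj cj_cross. Qed.

Lemma peirce0_conj_mem v : v \in peirce triple 0 w -> peirce0_conj v \in peirce triple 0 w.
Proof.
have w1' : tf (cj w) (cj (cj w)) = 1 by rewrite cjK tfC.
move=> _; apply/rank1_peirce0; rewrite peirce0_conjE.
by have := rank1_cross w1' w0' (cj v); rewrite cjK.
Qed.

Lemma peirce0_conjD u v : peirce0_conj (u + v) = peirce0_conj u + peirce0_conj v.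
Proof. by rewrite /peirce0_conj crossDr cjD. Qed.

Lemma peirce0_conjZ a v : peirce0_conj (a *: v) = a^* *: peirce0_conj v.
Proof. by rewrite /peirce0_conj crossZr cjZ. Qed.

Lemma peirce0_conjK v : v \in peirce triple 0 w -> peirce0_conj (peirce0_conj v) = v.
Proof.
by move=> /rank1_peirce0 h; rewrite peirce0_conjE /peirce0_conj cjK.
Qed.

Lemma peirce0_conj_isom u v : u \in peirce triple 0 w -> v \in peirce triple 0 w ->
  tf (peirce0_conj u) (cj (peirce0_conj v)) = (tf u (cj v))^*.
Proof.
move=> _ /rank1_peirce0 h; rewrite peirce0_conjE /peirce0_conj cjK (crossC (cj w)) tf_cross h.
by rewrite -tf_cj cjK.
Qed.

Lemma peirce0_cross u v : u \in peirce triple 0 w -> v \in peirce triple 0 w ->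
  u ** v = tf u (cj (peirce0_conj v)) *: cj w.
Proof.
move=> /rank1_peirce0 hu /rank1_peirce0 hv; rewrite (rank1_V0_cross w0 hu hv).
by rewrite tf_cross (crossC v) /peirce0_conj cjK.
Qed.

Lemma peirce0_triple u v z :
  u \in peirce triple 0 w -> v \in peirce triple 0 w -> z \in peirce triple 0 w ->
  triple u v z = tf u (cj v) *: z + tf z (cj v) *: u
    - tf u (cj (peirce0_conj z)) *: peirce0_conj v.
Proof.
by move=> hu hv hz; rewrite tripleE (peirce0_cross hu hz) crossZl -peirce0_conjE.
Qed.

Lemma peirce0_closed : triple_closed triple (peirce triple 0 w).
Proof.
move=> u v z hu hv hz; rewrite peirce0_triple //.
by rewrite rpredB ?rpredD // rpredZ // peirce0_conj_mem.
Qed.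

Lemma peirce0_real_basis : exists b : 'I_10 -> H3O R,
  [/\ forall i, b i \in peirce triple 0 w, forall i, peirce0_conj (b i) = b i,
    forall i j, tf (b i) (cj (b j)) = (i == j)%:R
    & forall v, v \in peirce triple 0 w -> v = \sum_i tf v (cj (b i)) *: b i].
Proof.
have [b [bW bf bo]] := real_form_basis peirce0_conj_mem peirce0_conjD peirce0_conjZ
   peirce0_conjK peirce0_conj_isom.
have := orthonormal_expand bW bo.
by move: b bW bf bo; rewrite dim_rank1_peirce0 => b ? ? ? ?; exists b.
Qed.

Lemma peirce0_extend (s : seq (H3O R)) : (size s < 10)%N ->
  {in s, forall x, x \in peirce triple 0 w /\ peirce0_conj x = x} ->
  (forall i j : nat, (i < size s)%N -> (j < size s)%N ->
     tf s`_i (cj s`_j) = (i == j)%:R) ->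
  exists u, [/\ u \in peirce triple 0 w, peirce0_conj u = u, tf u (cj u) = 1
    & {in s, forall x, tf u (cj x) = 0}].
Proof.
rewrite -dim_rank1_peirce0.
exact: (orthonormal_extend peirce0_conj_mem peirce0_conjD peirce0_conjZ
   peirce0_conjK peirce0_conj_isom).
Qed.

End PeirceRankOne.

(** * Minimal, rank 2 and maximal tripotents *)

Section Classification.
Context {R : realType}.
Local Notation C := R[i].
Implicit Types (x y z u v w e d p : H3O R) (a b t : C).

Lemma E1_unit_vec : E1 (unit_vec R (inl 0)).
Proof.
apply/E1P; split.
  rewrite tf_sumE (bigD1 (inl 0)) //= co_cj !co_unit eqxx rmorph_nat /= !mul1r big1 ?addr0 // => k k0.
  by rewrite co_unit (negbTE k0) mul0r mulr0.
have D i : diag_coef (unit_vec R (inl 0)) i = (i == 0)%:R.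
  by rewrite unit_vec.unlock /diag_coef mxE.
have O i : oct_coef (unit_vec R (inl 0)) i = 0.
  by rewrite unit_vec.unlock; apply/rowP => k; rewrite !mxE.
have o0 : onorm (0 : octonion C) = 0.
  by rewrite /onorm big1 // => j _; rewrite mxE expr0n.
have [hl _] := @omul_bilinear C; have hc := @oconj_linear C.
have om0 (q : octonion C) : omul 0 q = 0.
  by have := hl (-1) 0 0 q; rewrite scaler0 add0r scaleN1r addNr.
have oc0 : oconj 0 = 0 :> octonion C.
  by have := hc (-1) 0 0; rewrite scaler0 add0r scaleN1r addNr.
apply: H3O_eqP => i.
  rewrite diag_sharp !D O o0 subr0 [RHS]mxE.
  by case: i => [[|[|[|//]]] ?] /=; rewrite ?mulr0 ?mul0r.
by rewrite oct_sharp !O om0 oc0 scaler0 subr0; apply/rowP => k; rewrite !mxE.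
Qed.

Lemma rank1_orth0 w v : E1 w -> v \in peirce triple 0 w -> forall z, triple w v z = 0.
Proof. by move=> Ew /(rank1_peirce0 Ew) h z; have /E1P [h1 h2] := Ew; exact: rank1_orth_triple. Qed.

Let sqrt2 : C := sqrtC 2.
Let sqrt2K : sqrt2 * sqrt2 = 2. Proof. by rewrite -expr2 sqrtCK. Qed.
Let sqrt2_real : sqrt2^* = sqrt2.
Proof. by rewrite conj_Creal // ger0_real // sqrtC_ge0 ler0n. Qed.
Let sqrt2_neq0 : sqrt2 != 0. Proof. by rewrite sqrtC_eq0 pnatr_eq0. Qed.

(** For a real unit vector of the spin factor, u ** u = conj w is twice the adjoint of u, whence the
    factor sqrt 2. *)
Lemma peirce0_E2 w u : E1 w -> u \in peirce triple 0 w -> peirce0_conj w u = u ->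
  tf u (cj u) = 1 -> E2 (sqrt2 *: u) /\ sharp (sqrt2 *: u) = cj w.
Proof.
move=> Ew uW uf u1.
have su : sharp (sqrt2 *: u) = cj w.
  rewrite sharpZ expr2 sqrt2K -crossxx (peirce0_cross Ew uW uW) uf u1.
  by rewrite scale1r.
split => //; apply: (E2_intro _ su Ew).
by rewrite cjZ tfZl tfZr sqrt2_real mulrA sqrt2K u1 mulr1.
Qed.

(** Seen in V_0(w), e is a real vector of squared norm 2. For m = i sqrt 2 u with u a real unit
    vector orthogonal to e, the vectors (e + m)/2 and (e - m)/2 are isotropic in the spin factor,
    hence have zero adjoint, and they have norm 1. *)
Lemma E2_split e : E2 e -> exists c d,
  [/\ E1 c, E1 d, forall z, triple c d z = 0 & e = c + d].
Proof.
move=> Ee; have [Ew ew we eV0 _] := E2_facts Ee; have /E2P [e2 _ _] := Ee.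
set w := cj (sharp e) in Ew ew we eV0.
have eW : e \in peirce triple 0 w by apply/(rank1_peirce0 Ew).
have Je : peirce0_conj w e = e by rewrite /peirce0_conj we cjK.
have ir : (sqrt2^-1)^* = sqrt2^-1 by rewrite fmorphV /= sqrt2_real.
have ee : tf e (cj e) = 2 by [].
have [v|i j|u [uW uf u1 ue]] := peirce0_extend Ew (s := [:: sqrt2^-1 *: e]) isT.
- by rewrite inE => /eqP ->; rewrite rpredZ // peirce0_conjZ ir Je.
- rewrite !ltnS !leqn0 => /eqP -> /eqP ->; rewrite /= cjZ tfZl tfZr ir ee.
  by rewrite -sqrt2K; field.
have {}ue : tf u (cj e) = 0.
  have := ue (sqrt2^-1 *: e) (mem_head _ _); rewrite cjZ tfZr ir => /eqP.
  by rewrite mulf_eq0 invr_eq0 (negbTE sqrt2_neq0) => /eqP.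
have eu : tf e (cj u) = 0 by rewrite -tf_cjr ue rmorph0.
pose m := (sqrt2 * 'i) *: u.
have mW : m \in peirce triple 0 w by rewrite rpredZ.
have Jm : peirce0_conj w m = - m.
  by rewrite /m peirce0_conjZ uf rmorphM /= sqrt2_real conjCi mulrN scaleNr.
have mm : tf m (cj m) = 2.
  rewrite /m cjZ tfZl tfZr u1 mulr1 rmorphM /= sqrt2_real conjCi.
  by rewrite mulrN mulrN mulrACA sqrt2K -expr2 sqrCi; ring.
have em : tf e (cj m) = 0 by rewrite /m cjZ tfZr eu mulr0.
have me : tf m (cj e) = 0 by rewrite /m tfZl ue mulr0.
clearbody m.
have half : (2^-1 : C)^* = 2^-1 by rewrite fmorphV /= rmorph_nat.
(* The existential keeps [h] opaque; it is used only at s = 1 and s = -1. *)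
have [h hE] : exists h : C -> H3O R, forall s, h s = 2^-1 *: (e + s *: m) by eexists.
have hW s : h s \in peirce triple 0 w by rewrite hE rpredZ // rpredD ?rpredZ.
have Jh (s : C) : s^* = s -> peirce0_conj w (h s) = h (- s).
  move=> sr; rewrite !hE peirce0_conjZ peirce0_conjD peirce0_conjZ Je Jm sr half.
  by rewrite scalerN scaleNr.
have hh (s t : C) : s^* = s -> t^* = t ->
    tf (h s) (cj (h t)) = 2^-1 * (1 + s * t).
  move=> sr tr; rewrite !hE !cjZ cjD cjZ half tr !tfZl !tfZr !tfDl !tfDr !tfZl !tfZr.
  by rewrite ee mm em me; field.
have hx (s t : C) : s^* = s -> t^* = t -> h s ** h t = (2^-1 * (1 - s * t)) *: cj w.
  move=> sr tr; rewrite (peirce0_cross Ew) // Jh // hh // ?rmorphN /= ?tr //.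
  by rewrite mulrN.
have E (s : C) : s ^+ 2 = 1 -> s^* = s -> E1 (h s).
  move=> s2 sr; apply/E1P; split; first by rewrite hh // -expr2 s2; field.
  have := hx s s sr sr; rewrite -expr2 s2 subrr mulr0 scale0r crossxx => /eqP.
  by rewrite scaler_eq0 pnatr_eq0 /= => /eqP.
have r1 : (1 : C)^* = 1 by rewrite rmorph1.
have rN1 : (- 1 : C)^* = - 1 by rewrite rmorphN rmorph1.
have Ec : E1 (h 1) by apply: E => //; rewrite expr1n.
have Ed : E1 (h (-1)) by apply: E => //; rewrite sqrrN expr1n.
exists (h 1), (h (-1)); split => //; last by rewrite !hE; vpush; field.
apply: (rank1_orth0 Ec); apply/(rank1_peirce0 Ec).
have -> : h 1 ** h (-1) = cj w.
  by rewrite hx // -[RHS]scale1r; congr (_ *: _); field.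
by rewrite -cj_cross crossC -/(peirce0_conj w _) Jh.
Qed.

Lemma E3_quad e v : E3 e -> quad e v = tf e (cj v) *: e - hdet e *: (cj e ** cj v).
Proof. by move=> /E3P [_ h _]; rewrite /quad h crossZl. Qed.

Section RankThree.
Variable e : H3O R.
Hypothesis Ee : E3 e.
Let N := hdet e.
Let e1 : tf e (cj e) = 3. Proof. by case/E3P: Ee. Qed.
Let e2 : sharp e = N *: cj e. Proof. by case/E3P: Ee. Qed.
Let NN : N * N^* = 1. Proof. by case/E3P: Ee. Qed.
Let e2' : sharp (cj e) = N^* *: e. Proof. by rewrite -cj_sharp e2 cjZ cjK. Qed.
Let ce : cj e = N^* *: sharp e. Proof. by rewrite e2 scalerA mulrC NN scale1r. Qed.
Let quadE3 v : quad e v = tf e (cj v) *: e - N *: (cj e ** cj v). Proof. exact: E3_quad. Qed.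

Let cross_e (v : H3O R) : e ** (cj e ** v) = v + tf e v *: cj e.
Proof.
rewrite {1}ce crossZl crossZr cross_sharp e2 -/N; vpush.
transitivity (N * N^* * (co k v + tf e v * co k (cj e))); first by ring.
by rewrite NN mul1r.
Qed.

Let cross_ce v : cj e ** (e ** v) = v + tf (cj e) v *: e.
Proof. by have := congr1 (fun z => cj z) (cross_e (cj v)); rewrite /= !cjE -tf_cj cjK. Qed.

(** For maximal e, Q(e) is thus a conjugation of the whole space; its real form is a Euclidean
    Jordan algebra with unit e. *)
Lemma E3_quadK v : quad e (quad e v) = v.
Proof.
rewrite !quadE3 !cjE !tfE !crossE crossxx e2' cross_ce.
have -> : tf e (e ** v) = 2 * N * tf (cj e) v.
  by rewrite -tf_cross crossxx e2 !tfE mulrA.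
have -> : tf (cj e) v = (tf e (cj v))^* by rewrite -tf_cj cjK.
rewrite e1; vpush.
transitivity ((3 - 3 * (N * N^* )) * (tf e (cj v))^* * co k e + (N * N^* ) * co k v).
  by ring.
by rewrite NN; ring.
Qed.

Lemma E3_quad_isom u v : tf (quad e u) (cj (quad e v)) = (tf u (cj v))^*.
Proof. by rewrite quad_adj E3_quadK tf_cjr. Qed.

Lemma E3_quad_sharp v : sharp (quad e v) =
  (N ^+ 2 * tf (cj e) (sharp (cj v))) *: cj e - N *: (e ** sharp (cj v)).
Proof.
have h : e ** (cj e ** cj v) = cj v + tf e (cj v) *: cj e by exact: cross_e.
rewrite quadE3 sharpD sharpN !sharpZ sharp_crossE !crossE e2 e2' h tfZl crossZl.
vpush; transitivity (
  (N * N^* - 1) * N * tf e (cj v) * co k (cj v) + N ^+ 2 * tf (cj e) (sharp (cj v)) * co k (cj e)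
   - (N * N^*) * N * co k (e ** sharp (cj v))); first by ring.
by rewrite NN; ring.
Qed.

(** On the real form of Q(e), p -> det(e) conj(p#) is the adjoint map of the Jordan algebra with
    unit e, so it must preserve that form. *)
Lemma E3_quad_adjoint p : quad e p = p -> quad e (N *: cj (sharp p)) = N *: cj (sharp p).
Proof.
move=> hp; have h := E3_quad_sharp p; rewrite hp in h.
have h' := congr1 (fun z => N *: cj z) h; rewrite /= !cjE in h'.
rewrite quadE3 !cjE tfZr crossZr h' rmorphM rmorphXn /= -!tf_cj !cjE; vpush.
transitivity (N^* * tf e (sharp p) * co k e - (N * N^* ) * co k (cj e ** sharp p)); first by ring.
transitivity ((N * N^* ) * (N^* * tf e (sharp p) * co k e - co k (cj e ** sharp p))).
  by rewrite NN; ring.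
by ring.
Qed.

(** A rank-one element c of the real form of Q(e), suitably normalized, is an idempotent of the
    Jordan algebra with unit e, and e - c is its complement. *)
Lemma E3_split : exists c, [/\ E1 c, tripotent triple (e - c), e - c != 0
  & forall z, triple c (e - c) z = 0].
Proof.
have [c0 [c00 c0s c0q]] : exists c0, [/\ c0 != 0, sharp c0 = 0 & quad e c0 = c0].
  (* Both symmetrizations d + Q(e)d and i (d - Q(e)d) are fixed, and they have the same adjoint d **
     Q(e)d. If it is 0, a nonzero one among them has zero adjoint. If not, p = d + Q(e)d has zero
     determinant, so p## = 0 and det(e) conj(p#) is the required element. *)
  pose d := unit_vec R (inl 0); have /E1P [d1 d2] := E1_unit_vec; rewrite -/d in d1 d2.
  have dq2 : sharp (quad e d) = 0.
    by rewrite E3_quad_sharp -cj_sharp d2 cj0 tf0r cross0r mulr0 scale0r scaler0 subr0.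
  have sp : sharp (d + quad e d) = d ** quad e d by rewrite sharpD d2 dq2 add0r addr0.
  have sm : sharp ('i *: (d - quad e d)) = d ** quad e d.
    by rewrite sharpZ sqrCi sharpD sharpN d2 dq2 crossNr add0r addr0 scaleN1r opprK.
  have qp : quad e (d + quad e d) = d + quad e d by rewrite quadD E3_quadK addrC.
  have qm : quad e ('i *: (d - quad e d)) = 'i *: (d - quad e d).
    by rewrite quadZ conjCi quadD quadN E3_quadK; vring.
  have [k0|k0] := eqVneq (d ** quad e d) 0.
    have [p0|p0] := eqVneq (d + quad e d) 0; last by exists (d + quad e d); rewrite sp k0.
    exists ('i *: (d - quad e d)); rewrite sm k0; split => //.
    move/eqP: p0; rewrite addrC addr_eq0 => /eqP ->; rewrite opprK.
    rewrite scaler_eq0 negb_or neq0Ci -mulr2n -scaler_nat scaler_eq0 negb_or pnatr_eq0.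
    exact: E1_neq0 E1_unit_vec.
  exists (N *: cj (sharp (d + quad e d))); split; last exact: E3_quad_adjoint.
    rewrite sp scaler_eq0 negb_or; apply/andP; split.
      by apply/eqP => n0; move: NN; rewrite n0 mul0r => /esym/eqP; rewrite oner_eq0.
    by apply: contra k0 => /eqP /(congr1 (fun z => cj z)); rewrite cjK cj0 => ->.
  have -> : sharp (N *: cj (sharp (d + quad e d))) = 0; last by [].
  rewrite sharpZ -cj_sharp sharpK hdetE sp tfDr tf_crossC crossxx d2 scaler0 tf0l add0r.
  by rewrite tf_cross crossxx dq2 scaler0 tf0r mulr0 scale0r cj0 scaler0.
pose n := sqrtC (tf c0 (cj c0)).
have n0 : n != 0.
  by rewrite sqrtC_eq0; apply: contra c00 => /eqP /herm_eq0 ->.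
have nr : (n^-1)^* = n^-1.
  by rewrite conj_Creal // realV ger0_real // sqrtC_ge0 herm_ge0.
have [c1 [c1h c1s c1q]] : exists c1, [/\ tf c1 (cj c1) = 1, sharp c1 = 0 & quad e c1 = c1].
  exists (n^-1 *: c0); split; last by rewrite quadZ nr c0q.
    by rewrite cjZ tfZl tfZr nr -[tf c0 _]sqrtCK -/n; field.
  by rewrite sharpZ c0s scaler0.
(* Q(e) c1 = c1 forces b^2 = 1; multiplying c1 by the sign b makes the pairing with e equal to 1. *)
pose b := tf e (cj c1).
have b2 : b * b = 1.
  rewrite -c1h -{1}c1q quadE3 tfDl tfNl !tfZl tf_cross crossxx -cj_sharp c1s cj0.
  by rewrite scaler0 tf0r mulr0 subr0.
have br : b^* = b.
  have : b ^+ 2 == 1 by rewrite expr2 b2.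
  by rewrite sqrf_eq1 => /orP [] /eqP ->; rewrite ?rmorphN rmorph1.
have [c [ch cs cq ec]] : exists c,
    [/\ tf c (cj c) = 1, sharp c = 0, quad e c = c & tf e (cj c) = 1].
  exists (b *: c1); split; last by rewrite cjZ tfZr br.
  - by rewrite cjZ tfZl tfZr br c1h mulr1.
  - by rewrite sharpZ c1s scaler0.
  - by rewrite quadZ br c1q.
have Ec : E1 c by apply/E1P.
(* The equation Q(e) c = c expresses f as a multiple of conj e ** conj c, which places f in
   V_0(c). *)
pose f := e - c.
have fE : f = N *: (cj e ** cj c).
  by rewrite /f -[in LHS]cq quadE3 ec scale1r opprB addrC subrK.
have ef : cj e ** cj c = N^* *: f by rewrite fE scalerA mulrC NN scale1r.
have ce' : e ** c = N *: cj f.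
  by have := congr1 (fun z => cj z) ef; rewrite /= !cjE conjCK.
have fV0 : cj c ** (c ** f) = f.
  rewrite /f crossDr crossNr crossxx cs scaler0 subr0 (crossC c) ce' crossZr.
  rewrite /f cjD cjN crossDr crossNr crossxx -cj_sharp cs cj0 scaler0 subr0.
  by rewrite (crossC (cj c)) ef scalerA NN scale1r.
have o : forall z, triple c f z = 0.
  by apply: (rank1_orth0 Ec); apply/(rank1_peirce0 Ec).
exists c; split => //.
  by apply: (tripotent_orthD (c := c)) => //; [exact: E1_tripotent | rewrite addrC subrK; exact: E3_tripotent].
rewrite subr_eq0; apply/eqP => h; move: ec; rewrite -h e1 => /eqP.
by rewrite (eqr_nat _ 3 1).
Qed.

End RankThree.

(** Elements of E2 and E3 split. Elements of E1 cannot, because (e|e) is additive on orthogonal sums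
    and is at least 1 on every nonzero tripotent. *)
Lemma minimalP e : minimal_tripotent triple e <-> E1 e.
Proof.
split=> [[te e0 nsum]|Ee].
  have [h|//|h|h] := tripotent_cases te; first by rewrite h eqxx in e0.
    have [c [d [Ec Ed o h']]] := E2_split h; case: nsum; exists c, d.
    by split => //; split; rewrite ?E1_neq0 //; apply: E1_tripotent.
  have [c [Ec tf0 n0 o]] := E3_split h; case: nsum; exists c, (e - c).
  by split; [split; [exact: E1_tripotent | exact: E1_neq0] | | | rewrite addrC subrK].
split; [exact: E1_tripotent | exact: E1_neq0 | case=> c [d [[tc c0] [td d0] o h]]].
have /E1P [e1 _] := Ee.
have cd := orth_herm o; have dc : tf d (cj c) = 0 by rewrite -tf_cjr cd rmorph0.
have ge1 v : tripotent triple v -> v != 0 -> 1 <= tf v (cj v).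
  move=> tv v0; have [h'|/E1P [-> _]|/E2P [h' _ _]|/E3_s [h' _ _]] := tripotent_cases tv.
  - by rewrite h' eqxx in v0.
  - by [].
  - by rewrite [tf _ _]h' ler1n.
  - by rewrite [tf _ _]h' ler1n.
have := lerD (ge1 c tc c0) (ge1 d td d0).
have -> : tf c (cj c) + tf d (cj d) = 1.
  by rewrite -e1 h cjD !tfDl !tfDr cd dc addr0 add0r.
by rewrite (_ : 1 + 1 = 2%:R :> C) ?(ler_nat _ 2 1) //; ring.
Qed.

Lemma rank2P e : rank_tripotent triple 2 e <-> E2 e.
Proof.
split=> [[te [c [cm co ec]]]|Ee]; last first.
  split; first exact: E2_tripotent.
  have [c [d [Ec Ed o h]]] := E2_split Ee.
  exists (fun i : 'I_2 => if i == 0 then c else d); split.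
  - by move=> i; case: ifP => _; apply/minimalP.
  - move=> i j; have [i0|i0] := eqVneq i 0; have [j0|j0] := eqVneq j 0.
    + by move=> /eqP []; rewrite i0 j0.
    + by move=> _; exact: o.
    + by move=> _; exact: triple_eq0C.
    + move=> /eqP []; apply/val_inj; move: i0 j0; rewrite -!val_eqE.
      by case: i j => [[|[|i]] ?] [[|[|j]] ?].
  - by rewrite big_ord_recl big_ord1.
have := co 0 1 isT; have := cm 0; have := cm 1; rewrite big_ord_recl big_ord1 in ec.
rewrite (_ : lift ord0 ord0 = 1 :> 'I_2) in ec; last by exact/val_inj.
rewrite (_ : ord0 = 0 :> 'I_2) // in ec.
move: (c 0) (c 1) ec => {cm co}c d ec /minimalP /E1P [d1 d2] /minimalP /E1P [c1 c2] o.
have cd := orth_herm o; have dc : tf d (cj c) = 0 by rewrite -tf_cjr cd rmorph0.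
have e2 : s1 e = 2.
  by rewrite /s1 ec cjD !tfDl !tfDr cd dc c1 d1; ring.
have [h|/E1P [h _]|//|/E3_s [h _ _]] := tripotent_cases te.
- by move: e2; rewrite h /s1 tf0l => /esym/eqP; rewrite pnatr_eq0.
- by move: e2; rewrite /s1 h => /esym/eqP; rewrite (eqr_nat _ 2 1).
- by move: e2; rewrite h => /eqP; rewrite eqr_nat.
Qed.

(** Each tripotent outside E3 has a nonzero orthogonal one: a diagonal unit for 0, a rank 2
    tripotent built in V_0(e) for E1, and conj(e#) for E2. For e in E3, D(e, e) = 2 leaves room for
    none. *)
Lemma maximalP e : maximal_tripotent triple e <-> E3 e.
Proof.
split=> [[te em]|Ee]; last first.
  split; first exact: E3_tripotent.
  move=> f tf0 o; have := E3_triple f Ee.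
  rewrite (tripleC e e f) (triple_eq0C o) => /esym/eqP.
  by rewrite scaler_eq0 pnatr_eq0 => /eqP.
have [h|h|h|//] := tripotent_cases te.
- have Eu := E1_unit_vec; have := E1_neq0 Eu.
  rewrite (em _ (E1_tripotent Eu)) ?eqxx // => z.
  by rewrite h triple0l.
- have [//|//|u [uW uf u1 _]] := peirce0_extend h (s := [::]) isT.
  have [Eu su] := peirce0_E2 h uW uf u1.
  have u0 : sqrt2 *: u = 0.
    apply: em; first exact: E2_tripotent.
    by apply: (rank1_orth0 h); rewrite rpredZ.
  have /E2P [hu _ _] := Eu.
  by move: hu; rewrite u0 /s1 tf0l => /esym/eqP; rewrite pnatr_eq0.
- have [Ew _ _ eV0 _] := E2_facts h; have := E1_neq0 Ew.
  rewrite (em _ (E1_tripotent Ew)) ?eqxx //.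
  by apply: triple_eq0C; apply: (rank1_orth0 Ew); apply/(rank1_peirce0 Ew).
Qed.

End Classification.

(** * Polynomial maps and defining functions *)

Section PolynomialFunctions.
Context {R : realType} {m : nat}.
Local Notation E := 'rV[R]_m.
Local Notation C := R[i].

(* poly_fun f df: f is a polynomial with differential df. For a fixed v the
   directional derivative df ^~ v is again a polynomial, whence smoothness. *)
Inductive poly_fun : (E -> R) -> (E -> E -> R) -> Prop :=
| PFcst c : poly_fun (fun _ => c) (fun _ _ => 0)
| PFcoord i : poly_fun (fun y => y 0 i) (fun _ v => v 0 i)
| PFadd f g df dg : poly_fun f df -> poly_fun g dg ->
    poly_fun (fun y => f y + g y) (fun y v => df y v + dg y v)
| PFmul f g df dg : poly_fun f df -> poly_fun g dg ->
    poly_fun (fun y => f y * g y) (fun y v => f y * dg y v + g y * df y v).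

Lemma poly_fun_eq f g df dg : poly_fun f df -> f =1 g -> (forall y v, df y v = dg y v) ->
  poly_fun g dg.
Proof.
move=> h e1 e2; have <- : f = g by apply/funext.
by have <- : df = dg by apply/funext => y; apply/funext => v.
Qed.

Lemma poly_fun_diff f df : poly_fun f df -> forall y, is_diff y f (df y).
Proof.
elim=> [c|i|{}f g {}df dg _ IHf _ IHg|{}f g {}df dg _ IHf _ IHg] y.
- exact: is_diff_cst.
- apply: DiffDef; first exact: differentiable_coord.
  have @l : {linear E -> R}.
    by exists (fun N : E => N 0 i); do 2![eexists]; do ?[constructor];
       rewrite ?mxE// => ? *; rewrite ?mxE//; move=> ?; rewrite !mxE.
  by rewrite (_ : (fun _ => _) = l) // diff_lin //; exact: coord_continuous.
- exact: (is_diffD (IHf y) (IHg y)).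
- exact: (is_diffM (IHf y) (IHg y)).
Qed.

Lemma poly_fun_differentiable f df y : poly_fun f df -> differentiable f y.
Proof. by move=> /poly_fun_diff /(_ y) []. Qed.

Lemma poly_fun_diffE f df y v : poly_fun f df -> 'd f y v = df y v.
Proof. by move=> /poly_fun_diff /(_ y) [_ ->]. Qed.

Lemma poly_fun_continuous f df : poly_fun f df -> continuous f.
Proof. by move=> h y; apply: differentiable_continuous; apply: poly_fun_differentiable h. Qed.

Lemma poly_fun_derive f df v : poly_fun f df -> exists d, poly_fun (fun y => df y v) d.
Proof.
elim=> [c|i|{}f g {}df dg _ [d1 h1] _ [d2 h2]|{}f g {}df dg pf [d1 h1] pg [d2 h2]].
- by exists (fun _ _ => 0); apply: PFcst.
- by exists (fun _ _ => 0); apply: PFcst.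
- by eexists; apply: PFadd; eassumption.
- by eexists; apply: PFadd; apply: PFmul; eassumption.
Qed.

Lemma poly_fun_smooth f df (O : set E) : poly_fun f df -> smooth_on O f.
Proof.
move=> pf k; elim: k f df pf => [|k IH] f df pf /=.
  by move=> y _; apply: (poly_fun_continuous pf).
split=> [y _|v]; first exact: poly_fun_differentiable pf.
have [d hd] := poly_fun_derive v pf; rewrite (_ : 'D_v f = fun y => df y v); first exact: IH hd.
by apply/funext => y; rewrite deriveE ?(poly_fun_diffE _ _ pf) //; apply: poly_fun_differentiable pf.
Qed.

Lemma poly_fun_sum (I : Type) (r : seq I) (f : I -> E -> R) df :
  (forall i, poly_fun (f i) (df i)) ->
  poly_fun (fun y => \sum_(i <- r) f i y) (fun y v => \sum_(i <- r) df i y v).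
Proof.
move=> h; elim: r => [|i r IH].
  by apply: (poly_fun_eq (PFcst 0)) => [y|y v]; rewrite big_nil.
by apply: (poly_fun_eq (PFadd (h i) IH)) => [y|y v]; rewrite big_cons.
Qed.

Lemma poly_fun_prod (I : Type) (r : seq I) (f : I -> E -> R) :
  (forall i, exists df, poly_fun (f i) df) ->
  exists df, poly_fun (fun y => \prod_(i <- r) f i y) df.
Proof.
move=> h; elim: r => [|i r [d IH]].
  by eexists; apply: (poly_fun_eq (PFcst 1)) => [y|y v]; rewrite ?big_nil //.
have [di hi] := h i.
by eexists; apply: (poly_fun_eq (PFmul hi IH)) => [y|y v]; rewrite ?big_cons //.
Qed.

Lemma poly_fun_det n (A : E -> 'M[R]_n) :
  (forall i j, exists d, poly_fun (fun y => A y i j) d) ->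
  exists d, poly_fun (fun y => \det (A y)) d.
Proof.
move=> h.
have hs (s : 'S_n) : exists d, poly_fun (fun y => (-1) ^+ s * \prod_i A y i (s i)) d.
  have [d hd] := poly_fun_prod (index_enum 'I_n) (fun i => h i (s i)).
  by eexists; apply: (PFmul (PFcst _) hd).
have [d hd] := choice hs.
eexists; apply: (poly_fun_eq (poly_fun_sum (index_enum _) hd)) => // y.
Qed.

Definition poly_funC (f : E -> C) (df : E -> E -> C) :=
  poly_fun (fun y => complex.Re (f y)) (fun y v => complex.Re (df y v)) /\
  poly_fun (fun y => complex.Im (f y)) (fun y v => complex.Im (df y v)).

Lemma poly_funC_eq f g df dg : poly_funC f df -> f =1 g -> (forall y v, df y v = dg y v) ->
  poly_funC g dg.
Proof.
by move=> [h1 h2] e1 e2; split; [apply: (poly_fun_eq h1)|apply: (poly_fun_eq h2)] => [y|y v|y|y v];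
   rewrite ?e1 ?e2.
Qed.

Lemma poly_funC_cst c : poly_funC (fun _ => c) (fun _ _ => 0).
Proof. by split; apply: PFcst. Qed.

Let ReD (a b : C) : complex.Re (a + b) = complex.Re a + complex.Re b.
Proof. by case: a b => [? ?] []. Qed.
Let ImD (a b : C) : complex.Im (a + b) = complex.Im a + complex.Im b.
Proof. by case: a b => [? ?] []. Qed.

Lemma poly_funC_add f g df dg : poly_funC f df -> poly_funC g dg ->
  poly_funC (fun y => f y + g y) (fun y v => df y v + dg y v).
Proof.
move=> [f1 f2] [g1 g2]; split.
  by apply: (poly_fun_eq (PFadd f1 g1)) => [y|y v]; rewrite ReD.
by apply: (poly_fun_eq (PFadd f2 g2)) => [y|y v]; rewrite ImD.
Qed.

Let ReM (a b : C) : complex.Re (a * b) =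
  complex.Re a * complex.Re b + (-1) * (complex.Im a * complex.Im b).
Proof. by case: a b => [? ?] [] * /=; rewrite mulN1r. Qed.
Let ImM (a b : C) : complex.Im (a * b) =
  complex.Re a * complex.Im b + complex.Im a * complex.Re b.
Proof. by case: a b => [? ?] [] * /=. Qed.

Lemma poly_funC_mul f g df dg : poly_funC f df -> poly_funC g dg ->
  poly_funC (fun y => f y * g y) (fun y v => f y * dg y v + g y * df y v).
Proof.
move=> [f1 f2] [g1 g2]; split.
  apply: (poly_fun_eq (PFadd (PFmul f1 g1) (PFmul (PFcst (-1)) (PFmul f2 g2)))) => [y|y v].
    by rewrite ReM.
  by rewrite ReD !ReM /=; ring.
apply: (poly_fun_eq (PFadd (PFmul f1 g2) (PFmul f2 g1))) => [y|y v]; first by rewrite ImM.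
by rewrite ImD !ImM; ring.
Qed.

Lemma poly_funC_conj f df : poly_funC f df ->
  poly_funC (fun y => (f y)^*) (fun y v => (df y v)^*).
Proof.
move=> [f1 f2]; split.
  by apply: (poly_fun_eq f1) => [y|y v] /=; [case: (f _)|case: (df _ _)].
apply: (poly_fun_eq (PFmul (PFcst (-1)) f2)) => [y|y v] /=.
  by rewrite mulN1r; case: (f _).
by rewrite mulr0 addr0 mulN1r; case: (df _ _).
Qed.

Lemma poly_funC_sum (I : Type) (r : seq I) (f : I -> E -> C) df :
  (forall i, poly_funC (f i) (df i)) ->
  poly_funC (fun y => \sum_(i <- r) f i y) (fun y v => \sum_(i <- r) df i y v).
Proof.
move=> h; elim: r => [|i r IH].
  by apply: (poly_funC_eq (poly_funC_cst 0)) => [y|y v]; rewrite big_nil.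
by apply: (poly_funC_eq (poly_funC_add (h i) IH)) => [y|y v]; rewrite big_cons.
Qed.

Definition poly_funV (F : E -> H3O R) (dF : E -> E -> H3O R) :=
  forall k, poly_funC (fun y => co k (F y)) (fun y v => co k (dF y v)).

Lemma poly_funV_eq F G dF dG : poly_funV F dF -> F =1 G -> (forall y v, dF y v = dG y v) ->
  poly_funV G dG.
Proof. by move=> h e1 e2 k; apply: (poly_funC_eq (h k)) => [y|y v]; rewrite ?e1 ?e2. Qed.

Lemma poly_funV_cst x : poly_funV (fun _ => x) (fun _ _ => 0).
Proof. by move=> k; apply: (poly_funC_eq (poly_funC_cst _)) => [y|y v]; rewrite ?co0. Qed.

Lemma poly_funV_add F G dF dG : poly_funV F dF -> poly_funV G dG ->
  poly_funV (fun y => F y + G y) (fun y v => dF y v + dG y v).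
Proof.
by move=> hF hG k; apply: (poly_funC_eq (poly_funC_add (hF k) (hG k))) => [y|y v]; rewrite coD.
Qed.

Lemma poly_funV_scale f F df dF : poly_funC f df -> poly_funV F dF ->
  poly_funV (fun y => f y *: F y) (fun y v => f y *: dF y v + df y v *: F y).
Proof.
move=> hf hF k; apply: (poly_funC_eq (poly_funC_mul hf (hF k))) => [y|y v]; first by rewrite coZ.
by rewrite coD !coZ; congr (_ + _); exact: mulrC.
Qed.

Lemma poly_funV_opp F dF : poly_funV F dF -> poly_funV (fun y => - F y) (fun y v => - dF y v).
Proof.
move=> hF; apply: (poly_funV_eq (poly_funV_scale (poly_funC_cst (-1)) hF)) => [y|y v].
  by rewrite scaleN1r.
by rewrite scale0r addr0 scaleN1r.
Qed.

Lemma poly_funV_cj F dF : poly_funV F dF ->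
  poly_funV (fun y => cj (F y)) (fun y v => cj (dF y v)).
Proof.
by move=> hF k; apply: (poly_funC_eq (poly_funC_conj (hF k))) => [y|y v]; rewrite co_cj.
Qed.

Lemma poly_funC_tf F G dF dG : poly_funV F dF -> poly_funV G dG ->
  poly_funC (fun y => tf (F y) (G y)) (fun y v => tf (dF y v) (G y) + tf (F y) (dG y v)).
Proof.
move=> hF hG.
have h k := poly_funC_mul (poly_funC_cst ((weight k)%:R)) (poly_funC_mul (hF k) (hG k)).
apply: (poly_funC_eq (poly_funC_sum (index_enum _) h)) => [y|y v]; first by rewrite tf_sumE.
by rewrite !tf_sumE -big_split; apply: eq_bigr => k _; rewrite mulr0 addr0 /=; ring.
Qed.

Lemma poly_funV_cross F G dF dG : poly_funV F dF -> poly_funV G dG ->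
  poly_funV (fun y => F y ** G y) (fun y v => dF y v ** G y + F y ** dG y v).
Proof.
move=> hF hG k.
have hx (x y : H3O R) :
    co k (x ** y) = \sum_i \sum_j co k (unit_vec R i ** unit_vec R j) * (co i x * co j y).
  rewrite {1}(co_sumE x) {1}(co_sumE y) (big_morph (fun z => z ** _) (fun a b => crossDl a b _) (cross0l _)).
  rewrite co_sum; apply: eq_bigr => i _.
  rewrite (big_morph (fun z => _ ** z) (fun a b => crossDr a b _) (cross0r _)) co_sum.
  by apply: eq_bigr => j _; rewrite crossZl crossZr !coZ; ring.
have h i j := poly_funC_mul (poly_funC_cst (co k (unit_vec R i ** unit_vec R j)))
                (poly_funC_mul (hF i) (hG j)).
apply: (poly_funC_eq (poly_funC_sum (index_enum _) (fun i => poly_funC_sum (index_enum _) (h i))))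
  => [y|y v]; first by rewrite hx.
rewrite coD !hx -big_split; apply: eq_bigr => i _ /=; rewrite -big_split; apply: eq_bigr => j _.
by rewrite mulr0 addr0 /=; ring.
Qed.

Lemma poly_funV_sharp F dF : poly_funV F dF ->
  poly_funV (fun y => sharp (F y)) (fun y v => F y ** dF y v).
Proof.
move=> hF.
apply: (poly_funV_eq (poly_funV_scale (poly_funC_cst 2^-1) (poly_funV_cross hF hF))) => [y|y v].
  by rewrite crossxx; vpush; field.
by rewrite (crossC (dF y v)); vpush; field.
Qed.

Lemma poly_funC_hdet F dF : poly_funV F dF ->
  poly_funC (fun y => hdet (F y)) (fun y v => tf (sharp (F y)) (dF y v)).
Proof.
move=> hF.
apply: (poly_funC_eq (poly_funC_mul (poly_funC_cst 3^-1) (poly_funC_tf (poly_funV_sharp hF) hF))) => [y|y v].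
  by rewrite hdetE.
by rewrite tf_crossC crossxx tfZl; field.
Qed.

End PolynomialFunctions.

(** * Passage to real coordinates *)

Section Unrealify.
Import VectorInternalTheory.
Context {R : realType}.
Local Notation C := R[i].
Local Notation n := (dim (H3O R)).
Local Notation E := 'rV[R]_(n + n).
Implicit Types (x : H3O R) (y z v : E).

Definition unreal (y : E) : H3O R := r2v (\row_i (lsubmx y 0 i +i* rsubmx y 0 i)%C).

Lemma realifyK : cancel (@realify R (H3O R)) unreal.
Proof.
move=> x; rewrite /unreal /realify row_mxKl row_mxKr -[RHS]v2rK; congr r2v.
by apply/rowP => i; rewrite !mxE; case: (v2r x 0 i).
Qed.

Lemma unrealK : cancel unreal (@realify R (H3O R)).
Proof.
move=> y; rewrite /unreal /realify r2vK -[RHS]hsubmxK.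
by congr row_mx; apply/rowP => i; rewrite !mxE.
Qed.

Lemma realifyD x x' : realify (x + x') = realify x + realify x'.
Proof.
rewrite /realify linearD add_row_mx; congr row_mx; apply/rowP => i; rewrite !mxE;
by case: (v2r x 0 i) (v2r x' 0 i) => [? ?] [].
Qed.

Lemma realifyZ (t : R) x : realify (t%:C *: x) = t *: realify x.
Proof.
rewrite /realify linearZ scale_row_mx; congr row_mx; apply/rowP => i; rewrite !mxE;
by case: (v2r x 0 i) => [? ?] /=; rewrite mul0r ?subr0 ?addr0.
Qed.

Lemma unrealD (y z : E) : unreal (y + z) = unreal y + unreal z.
Proof. by apply: (can_inj realifyK); rewrite realifyD !unrealK. Qed.

Lemma unrealZ t (y : E) : unreal (t *: y) = t%:C *: unreal y.
Proof. by apply: (can_inj realifyK); rewrite realifyZ !unrealK. Qed.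

Lemma realify_image (A : set (H3O R)) (y : E) : (realify @` A) y <-> A (unreal y).
Proof.
split=> [[x Ax <-]|Ay]; first by rewrite realifyK.
by exists (unreal y) => //; rewrite unrealK.
Qed.

Lemma poly_fun_linear (f : E -> R) :
  (forall y z : E, f (y + z) = f y + f z) -> (forall t (y : E), f (t *: y) = t * f y) ->
  poly_fun f (fun _ v => f v).
Proof.
move=> fD fZ.
have f0 : f 0 = 0 by rewrite -(scale0r 0) fZ mul0r.
have fE (y : E) : f y = \sum_i f (delta_mx 0 i) * y 0 i.
  rewrite {1}[y]row_sum_delta (big_morph f fD f0); apply: eq_bigr => i _.
  by rewrite fZ mulrC.
have h i := PFmul (PFcst (f (delta_mx 0 i))) (PFcoord i).
apply: (poly_fun_eq (poly_fun_sum (index_enum _) h)) => [y|y v]; rewrite [RHS]fE //.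
by apply: eq_bigr => i _; rewrite mulr0 addr0.
Qed.

Lemma poly_funV_unreal : poly_funV unreal (fun _ v => unreal v).
Proof.
move=> k; split; apply: poly_fun_linear => [y z|t y].
- by rewrite unrealD coD; case: (co k _) (co k _) => [? ?] [].
- by rewrite unrealZ coZ; case: (co k _) => [? ?] /=; rewrite mul0r subr0.
- by rewrite unrealD coD; case: (co k _) (co k _) => [? ?] [].
- by rewrite unrealZ coZ; case: (co k _) => [? ?] /=; rewrite mul0r addr0.
Qed.

End Unrealify.

(** * Defining functions from vector-valued equations *)

Section DefiningFunctions.
Context {R : realType}.
Local Notation C := R[i].
Local Notation V := (H3O R).
Local Notation n := (dim (H3O R)).
Local Notation E := 'rV[R]_(n + n).
Local Notation Re := (@complex.Re R).
Local Notation Im := (@complex.Im R).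
Implicit Types (x u v : V) (y z : E).

Lemma ReD (a b : C) : Re (a + b) = Re a + Re b.
Proof. by case: a b => [? ?] []. Qed.
Lemma ImD (a b : C) : Im (a + b) = Im a + Im b.
Proof. by case: a b => [? ?] []. Qed.
Lemma ReZ (t : R) (a : C) : Re (t%:C * a) = t * Re a.
Proof. by case: a => [? ?] /=; rewrite mul0r subr0. Qed.
Lemma ImZ (t : R) (a : C) : Im (t%:C * a) = t * Im a.
Proof. by case: a => [? ?] /=; rewrite mul0r addr0. Qed.
Lemma ReN (a : C) : Re (- a) = - Re a. Proof. by case: a. Qed.
Lemma cplx_ReJ (a : C) : Re (a^*) = Re a. Proof. by case: a. Qed.
Lemma conj_real (t : R) : (t%:C)^* = t%:C :> C.
Proof. by rewrite conj_Creal // complex_real. Qed.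
Lemma Re_sum (I : finType) (F : I -> C) : Re (\sum_i F i) = \sum_i Re (F i).
Proof. by elim/big_rec2: _ => [|i a b _ <-] //; rewrite ReD. Qed.

Lemma row_linearE m (f : 'rV[R]_m -> R) :
  (forall y z : 'rV_m, f (y + z) = f y + f z) ->
  (forall t (y : 'rV_m), f (t *: y) = t * f y) ->
  forall y : 'rV_m, f y = \sum_j y 0 j * f (delta_mx 0 j).
Proof.
move=> fD fZ y; have f0 : f 0 = 0 by rewrite -(scale0r 0) fZ mul0r.
rewrite {1}[y]row_sum_delta (big_morph f fD f0); apply: eq_bigr => i _.
by rewrite fZ.
Qed.

Lemma realify_expand x j : realify x 0 j = \sum_k (Re (co k x) * realify (unit_vec R k) 0 j
     + Im (co k x) * realify ('i *: unit_vec R k) 0 j).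
Proof.
rewrite {1}(co_sumE x).
have r0 : realify (0 : V) 0 j = 0.
  by have := realifyZ 0 (0 : V); rewrite scaler0 scale0r => ->; rewrite mxE.
have rD u v : realify (u + v) 0 j = realify u 0 j + realify v 0 j.
  by rewrite realifyD mxE.
rewrite (big_morph (fun u : V => realify u 0 j) rD r0); apply: eq_bigr => k _.
rewrite {1}[co k x]complexE scalerDl realifyD mulrC -scalerA !realifyZ !mxE.
by [].
Qed.

Lemma poly_fun_realify (F : E -> V) dF j : poly_funV F dF ->
  exists d, poly_fun (fun y => realify (F y) 0 j) d.
Proof.
move=> hF.
have h k := PFadd (PFmul (proj1 (hF k)) (PFcst (realify (unit_vec R k) 0 j)))
   (PFmul (proj2 (hF k)) (PFcst (realify ('i *: unit_vec R k) 0 j))).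
eexists; apply: (poly_fun_eq (poly_fun_sum (index_enum _) h)) => [y|y v].
  by rewrite realify_expand.
reflexivity.
Qed.

(* If K satisfies real-linear syzygies L x (K x) = 0, l x (K x) = 0 such that
   L p, l p and the pairings with the b i are jointly injective, then near p
   the equation K x = 0 reduces to its pairings with the b i: joint injectivity
   gives a left inverse at p, and a determinant that stays nonzero near p. *)
Lemma syzygy_defining_functions (M U : set V) (p : V) q (b : 'I_q -> V)
    (K : V -> V) (dK : V -> V -> V) (L : V -> V -> V) (l : V -> V -> C) :
  U p -> open (realify @` U) -> (forall x, U x -> M x <-> K x = 0) ->
  poly_funV (fun y => K (unreal y)) (fun y z => dK (unreal y) (unreal z)) ->
  (forall v, exists d, poly_funV (fun y => L (unreal y) v) d) ->
  (forall v, exists d, poly_funC (fun y => l (unreal y) v) d) ->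
  (forall x u v, L x (u + v) = L x u + L x v) ->
  (forall x (t : R) v, L x (t%:C *: v) = t%:C *: L x v) ->
  (forall x u v, l x (u + v) = l x u + l x v) ->
  (forall x (t : R) v, l x (t%:C *: v) = t%:C * l x v) ->
  (forall x, L x (K x) = 0) -> (forall x, l x (K x) = 0) ->
  (forall v, L p v = 0 -> l p v = 0 -> (forall i, Re (tf v (cj (b i))) = 0) -> v = 0) ->
  (forall c : 'I_q -> R,
     (forall v, Re (tf (dK p v) (cj (\sum_i (c i)%:C *: b i))) = 0) -> forall i, c i = 0) ->
  exists (O : set E) (F : 'I_q -> E -> R), defining_functions (realify @` M) (realify p) O F /\
    forall i v, 'd (F i) (realify p) (realify v) = Re (tf (dK p v) (cj (b i))).
Proof.
move=> Up Uo MK pK pL pl LD LZ lD lZ LK lK inj indep.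
(* All real-linear conditions on v are stacked into one row: the n + n coordinates of [L x v], the
   real and imaginary parts of [l x v], and the q pairings. In the row basis this is the matrix
   [A y], polynomial in y. *)
pose S x v : 'rV[R]_(n + n + 2 + q) := row_mx (row_mx (realify (L x v))
   (\row_(j < 2) if j == 0 then Re (l x v) else Im (l x v))) (\row_i Re (tf v (cj (b i)))).
have SD x u v : S x (u + v) = S x u + S x v.
  rewrite /S LD lD realifyD !add_row_mx; congr (row_mx (row_mx _ _) _);
    apply/rowP => j; rewrite !mxE ?tfDl ?ReD ?ImD //.
  by case: ifP.
have SZ x (t : R) v : S x (t%:C *: v) = t *: S x v.
  rewrite /S LZ lZ realifyZ !scale_row_mx; congr (row_mx (row_mx _ _) _);
    apply/rowP => j; rewrite !mxE ?tfZl ?ReZ ?ImZ //.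
  by case: ifP.
pose A y : 'M[R]_(n + n, n + n + 2 + q) :=
  \matrix_(j, k) S (unreal y) (unreal (delta_mx 0 j)) 0 k.
have AE y z : z *m A y = S (unreal y) (unreal z).
  apply/rowP => k; rewrite mxE.
  have fD (z1 z2 : E) : S (unreal y) (unreal (z1 + z2)) 0 k =
      S (unreal y) (unreal z1) 0 k + S (unreal y) (unreal z2) 0 k.
    by rewrite unrealD SD mxE.
  have fZ t (z1 : E) : S (unreal y) (unreal (t *: z1)) 0 k = t * S (unreal y) (unreal z1) 0 k.
    by rewrite unrealZ SZ mxE.
  rewrite [RHS](row_linearE (f := fun z => S (unreal y) (unreal z) 0 k) fD fZ).
  by apply: eq_bigr => j _; rewrite !mxE.
have pS v k : exists d, poly_fun (fun y => S (unreal y) v 0 k) d.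
  have [d1 h1] := pL v; have [d2 [h2 h3]] := pl v.
  rewrite /S; case: (split_ordP k) => k1 ->; last first.
    eexists; apply: (poly_fun_eq (PFcst _)) => [y|y z].
      by rewrite row_mxEr mxE; reflexivity.
    reflexivity.
  case: (split_ordP k1) => k2 ->.
    have [d hd] := poly_fun_realify k2 h1.
    by exists d; apply: (poly_fun_eq hd) => [y|//]; rewrite !row_mxEl.
  have [k0|k0] := eqVneq k2 0.
    by eexists; apply: (poly_fun_eq h2) => [y|y z]; [rewrite row_mxEl row_mxEr mxE k0 eqxx|reflexivity].
  by eexists; apply: (poly_fun_eq h3) => [y|y z]; [rewrite row_mxEl row_mxEr mxE (negbTE k0)|reflexivity].
have /row_freeP [B hB] : row_free (A (realify p)).
  apply: inj_row_free => z; rewrite AE realifyK => h.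
  have : unreal z = 0.
    move: h; rewrite /S => h.
    have h1 := congr1 (fun M => lsubmx (lsubmx M)) h.
    have h2 := congr1 (fun M => rsubmx (lsubmx M)) h.
    have h3 := congr1 rsubmx h.
    rewrite /= !row_mxKl !linear0 in h1; rewrite /= row_mxKl row_mxKr !linear0 in h2.
    rewrite /= row_mxKr !linear0 in h3.
    apply: inj.
    - by apply: (can_inj (@realifyK R)); rewrite h1; have := realifyZ 0 (0 : V);
         rewrite scaler0 scale0r => ->.
    - have a1 := congr1 (fun M : 'rV[R]_2 => M 0 0) h2.
      have a2 := congr1 (fun M : 'rV[R]_2 => M 0 1) h2.
      by rewrite /= !mxE /= in a1 a2; move: a1 a2; case: (l p _) => [? ?] /= -> ->.
    - by move=> i; have := congr1 (fun M : 'rV[R]_q => M 0 i) h3; rewrite /= !mxE.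
  move/(congr1 (@realify R V)); rewrite unrealK => ->.
  by have := realifyZ 0 (0 : V); rewrite scaler0 scale0r.
have [dd hdet] : exists d, poly_fun (fun y => \det (A y *m B)) d.
  apply: poly_fun_det => i j.
  have h k : exists d, poly_fun (fun y => A y i k * B k j) d.
    have [d hd] := pS (unreal (delta_mx 0 i)) k.
    by eexists; apply: (poly_fun_eq (PFmul hd (PFcst (B k j)))) => [y|y z]; [rewrite [A y i k]mxE|reflexivity].
  have [d hd] := choice h.
  by eexists; apply: (poly_fun_eq (poly_fun_sum (index_enum _) hd)) => [y|y z]; [rewrite mxE|reflexivity].
pose F (i : 'I_q) (y : E) := Re (tf (K (unreal y)) (cj (b i))).
have pF i : poly_fun (F i) (fun y z => Re (tf (dK (unreal y) (unreal z)) (cj (b i)))).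
  have [h _] := poly_funC_tf pK (poly_funV_cst (cj (b i))).
  by apply: (poly_fun_eq h) => [y|y v] //; rewrite tf0r addr0.
exists ((realify @` U) `&` [set y | \det (A y *m B) != 0]), F; split; last first.
  by move=> i v; rewrite (poly_fun_diffE _ _ (pF i)) !realifyK.
split.
- split; first apply: openI => //.
    apply: (open_comp (f := fun y => \det (A y *m B)) (D := [set x | x != 0])).
      by move=> y _; exact: (poly_fun_continuous hdet).
    exact: open_neq.
  split; first by exists p.
  by rewrite /= hB det1 oner_eq0.
- by move=> i; apply: poly_fun_smooth (pF i).
- move=> c h; apply: indep => v; rewrite (big_morph (@cj R) (@cjD R) (cj0 (R := R))).
  rewrite (big_morph (tf (dK p v)) (fun u u0 => tfDr u u0 _) (tf0r _)) Re_sum.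
  rewrite -[RHS](h (realify v)); apply: eq_bigr => i _.
  by rewrite (poly_fun_diffE _ _ (pF i)) !realifyK cjZ conj_real tfZr ReZ.
- apply/seteqP; split => y /=.
    move=> [/realify_image My [Uy dy]]; split => // i.
    by rewrite /F (proj1 (MK _ (proj1 (realify_image _ _) Uy)) My) tf0l.
  move=> [[Uy dy] Fy]; split => //; apply/realify_image/MK; first exact/realify_image.
  apply: (can_inj (@realifyK R)).
  have h0 : realify (K (unreal y)) *m A y = 0.
    rewrite AE realifyK /S LK lK.
    have -> : realify (0 : V) = 0 by have := realifyZ 0 (0 : V); rewrite scaler0 scale0r.
    rewrite (_ : \row_(j < 2) _ = 0); last by apply/rowP => j; rewrite !mxE /=; case: ifP.
    by rewrite (_ : \row_i _ = 0) ?row_mx0 //; apply/rowP => i; rewrite !mxE; exact: Fy.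
  have u : A y *m B \in unitmx by rewrite unitmxE unitfE.
  rewrite -[LHS]mulmx1 -(mulmxV u) mulmxA mulmxA h0 !mul0mx.
  by have := realifyZ 0 (0 : V); rewrite scaler0 scale0r.
Qed.

End DefiningFunctions.

Lemma peirceP (R : realType) (e v : H3O R) (j : nat) :
  v \in peirce triple j e <-> triple e e v = j%:R *: v.
Proof. by rewrite peirceE; split=> [/eqP|/eqP]. Qed.

Lemma tripleZl (R : realType) a (x y z : H3O R) : triple (a *: x) y z = a *: triple x y z.
Proof. by rewrite ![triple _ y z]tripleC tripleZr. Qed.

Lemma tripleZm (R : realType) a (x y z : H3O R) : triple x (a *: y) z = a^* *: triple x y z.
Proof. by rewrite !tripleE !cjE !tfE !crossE; vring. Qed.

(** * Equations of the boundary components *)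

Section BoundaryEquations.
Context {R : realType}.
Local Notation C := R[i].
Implicit Types (x y z u v w e p : H3O R) (a b c t : C).

Lemma boundary1P x : boundary 1 x <-> [/\ f1 x = 0, 0 < f2 x & 0 < f3 x].
Proof.
split=> [[h1 h2]|[h1 h2 h3]]; first by split; [exact: h1 1%N _|exact: h2 2%N _|exact: h2 3%N _].
by split=> [[|[|j]] //|[|[|[|[|j]]]] //].
Qed.

Lemma boundary2P x : boundary 2 x <-> [/\ f1 x = 0, f2 x = 0 & 0 < f3 x].
Proof.
split=> [[h1 h2]|[h1 h2 h3]]; first by split; [exact: h1 1%N _|exact: h1 2%N _|exact: h2 3%N _].
by split=> [[|[|[|j]]] //|[|[|[|[|j]]]] //].
Qed.

Lemma boundary3P x : boundary 3 x <-> [/\ f1 x = 0, f2 x = 0 & f3 x = 0].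
Proof.
split=> [[h1 h2]|[h1 h2 h3]]; first by split; [exact: h1 1%N _|exact: h1 2%N _|exact: h1 3%N _].
by split=> [[|[|[|[|j]]]] //|[|[|[|[|j]]]] //].
Qed.

Lemma boundary2_s x : boundary 2 x <-> [/\ s1 x = 2 + s3 x, s2 x = 1 + 2 * s3 x & s3 x < 1].
Proof.
rewrite boundary2P f1E f2E f3E; split=> [[h1 h2 h3]|[-> -> h]]; last first.
  split; [ring | ring | rewrite (_ : _ - _ = 1 - s3 x) ?subr_gt0 //; ring].
have e1 : s1 x = 2 + s3 x.
  apply/esym/eqP; rewrite -subr_eq0; apply/eqP.
  transitivity (3 - 2 * s1 x + s2 x - (1 - s1 x + s2 x - s3 x)); first by ring.
  by rewrite h1 h2 subrr.
have e2 : s2 x = 1 + 2 * s3 x.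
  transitivity (3 - 2 * s1 x + s2 x - 3 + 2 * s1 x); first by ring.
  by rewrite h2 e1; ring.
split=> //; rewrite -subr_gt0; move: h3; rewrite e1 (_ : _ - _ = 1 - s3 x) //; ring.
Qed.

Lemma boundary3_E3 x : boundary 3 x <-> E3 x.
Proof.
rewrite boundary3P E3_s f1E f2E f3E; split=> [[h1 h2 h3]|[-> -> ->]]; last by split; ring.
have e1 : s1 x = 3 by apply/esym/eqP; rewrite -subr_eq0 h3.
have e2 : s2 x = 3.
  transitivity (3 - 2 * s1 x + s2 x - 3 + 2 * s1 x); first by ring.
  by rewrite h2 e1; ring.
split=> //; transitivity (1 - s1 x + s2 x - (1 - s1 x + s2 x - s3 x)); first by ring.
by rewrite h1 e1 e2; ring.
Qed.

Lemma E1_boundary1 e : E1 e -> boundary 1 e.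
Proof.
move=> /E1P [h1 h2]; have [e1 e2 e3] : [/\ s1 e = 1, s2 e = 0 & s3 e = 0].
  by rewrite /s1 /s2 /s3 hdetE h1 h2 !tf0l mulr0 mul0r.
apply/boundary1P; rewrite f1E f2E f3E e1 e2 e3; split; first by ring.
  by rewrite (_ : _ + _ = 1) ?ltr01 //; ring.
by rewrite (_ : _ - _ = 2) ?ltr0n //; ring.
Qed.

Lemma E2_boundary2 e : E2 e -> boundary 2 e.
Proof.
move=> /E2P [h1 h2 h3]; apply/boundary2_s; rewrite h1 h2 /s3 h3 mul0r ltr01.
by split => //; ring.
Qed.

Lemma boundary2_gap x : boundary 2 x -> gap x = 0.
Proof.
move=> /boundary2P [h1 h2 h3]; apply: herm_eq0; rewrite gap_gap.
by rewrite -f1E -f2E -f3E h1 h2 mul0r expr0n subr0.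
Qed.

(** If x = e + t w with e# = conj w and w# = 0, then t = det x and conj(x#) = w + conj(t) e. Solving
    this 2 by 2 system, of determinant 1 - |t|^2, dictates the formulas for e and w; the equation
    [gap x = 0] then verifies them. *)
Lemma boundary2_decomp x : boundary 2 x -> exists e, E2 e /\ x = e + hdet x *: cj (sharp e).
Proof.
move=> bx; have g0 := boundary2_gap bx; have /boundary2_s [e1 e2 r1] := bx.
have nr : 1 - s3 x != 0 by rewrite subr_eq0 eq_sym lt_eqF.
have rr : ((1 - s3 x)^-1)^* = (1 - s3 x)^-1.
  by rewrite fmorphV rmorphB /= rmorph1 conj_s3.
set n := hdet x; have s3E : s3 x = n * n^* by [].
have nr' : 1 - n * n^* != 0 by rewrite -s3E.
have g1 : sharp x ** cj x = x + n *: sharp (cj x).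
  have := g0; rewrite gap.unlock -/n => h; vpush; vpush_hyp h k.
  transitivity (co k (sharp x ** cj x) + (co k x - co k (sharp x ** cj x) + n * co k (sharp (cj x)))).
    by rewrite h addr0.
  by ring.
have g1' : sharp (cj x) ** x = cj x + n^* *: sharp x.
  by have := congr1 (fun z => cj z) g1; rewrite /= !cjE.
pose w := (1 - s3 x)^-1 *: (sharp (cj x) - n^* *: x).
pose e := (1 - s3 x)^-1 *: (x - n *: sharp (cj x)).
have xE : x = e + n *: w.
  by rewrite /e /w s3E; vpush; field.
have cw : cj w = (1 - s3 x)^-1 *: (sharp x - n *: cj x).
  by rewrite /w !cjE rr conjCK.
have w0 : sharp w = 0.
  rewrite /w sharpZ sharpD sharpN !sharpZ !crossE sharpK hdet_cj -/n g1'.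
  by vpush; ring.
have w1 : tf w (cj w) = 1.
  rewrite cw /w !tfE -/(s2 x) tf_sharpC tf_sharp -!/(s1 x) (tfC (sharp (cj x)) (sharp x)) -/(s2 x) hdet_cj -/n.
  by rewrite e1 e2 s3E; field.
have ee : tf e (cj e) = 2.
  rewrite /e !cjE rr !tfE tf_sharp tf_sharpC (tfC (sharp (cj x)) (sharp x)) -/(s2 x) -/(s1 x) hdet_cj -/n.
  by rewrite e1 e2 s3E; field.
have se : sharp e = cj w.
  rewrite cw /e sharpZ sharpD sharpN !sharpZ !crossE sharpK hdet_cj -/n (crossC x) g1' s3E.
  by vpush; field.
exists e; split; last by rewrite se cjK.
by apply: (E2_intro ee se); apply/E1P.
Qed.

End BoundaryEquations.

Lemma rank1_decomp (R : realType) (w v : H3O R) : E1 w -> exists a v1 : H3O R,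
  [/\ a \in peirce triple 0 w, v1 \in peirce triple 1 w & v = a + v1 + tf v (cj w) *: w].
Proof.
move=> Ew; exists (cj w ** (w ** v)), (v - tf v (cj w) *: w - cj w ** (w ** v)).
split; [exact: rank1_P0 | exact: rank1_P1 | by vring].
Qed.

(** * Rank 2 tripotents and the discs e + t w *)

Section RankTwo.
Context {R : realType}.
Local Notation C := R[i].
Implicit Types (x y z u v : H3O R) (a b c t : C).
Variables e w : H3O R.
Hypotheses (Ee : E2 e) (se : sharp e = cj w).

Let wE : cj (sharp e) = w. Proof. by rewrite se cjK. Qed.
Let facts : [/\ E1 w, w ** e = cj e, cj w ** (w ** e) = e & tf e (cj w) = 0].
Proof. by have [] := E2_facts Ee; rewrite wE. Qed.
Let Ew : E1 w. Proof. by case: facts. Qed.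
Let w1 : tf w (cj w) = 1. Proof. by case/E1P: Ew. Qed.
Let w0 : sharp w = 0. Proof. by case/E1P: Ew. Qed.
Let w0' : sharp (cj w) = 0. Proof. by rewrite -cj_sharp w0 cj0. Qed.
Let we : w ** e = cj e. Proof. by case: facts. Qed.
Let eW : e \in peirce triple 0 w.
Proof. by apply/(rank1_peirce0 Ew); case: facts. Qed.
Let ew : tf e (cj w) = 0. Proof. by case: facts. Qed.
Let we' : tf w (cj e) = 0. Proof. by rewrite -tf_cjr ew rmorph0. Qed.
Let ee : tf e (cj e) = 2. Proof. by case/E2P: Ee. Qed.
Let de : hdet e = 0. Proof. by case/E2P: Ee. Qed.
Let Je : peirce0_conj w e = e. Proof. by rewrite /peirce0_conj we cjK. Qed.

Lemma E2_peirce (j : nat) : (j <= 2)%N -> peirce triple j e = peirce triple (2 - j) w.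
Proof.
move=> j2; apply/vspaceP => v; apply/idP/idP => /peirceP h; apply/peirceP;
  move: h; rewrite (E2_triple _ Ee) (natrB _ j2) wE => h.
  vpush; vpush_hyp h k.
  transitivity (2 * co k v - (2 * co k v - co k (triple w w v))); first by ring.
  by rewrite h; ring.
by vpush; vpush_hyp h k; rewrite h; ring.
Qed.

Lemma dim_E2_peirce1 : \dim (peirce triple 1 e) = 16%N.
Proof. by rewrite E2_peirce // dim_rank1_peirce1. Qed.
Lemma dim_E2_peirce0 : \dim (peirce triple 0 e) = 1%N.
Proof. by rewrite E2_peirce // dim_rank1_peirce2. Qed.

Lemma E2_quad v : quad e v = tf e (cj v) *: e - peirce0_conj w v.
Proof. by rewrite /quad se peirce0_conjE. Qed.

Lemma E2_quad_mem v : quad e v \in peirce triple 0 w.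
Proof.
rewrite E2_quad rpredB ?rpredZ //; apply/(rank1_peirce0 Ew).
have w1' : tf (cj w) (cj (cj w)) = 1 by rewrite cjK tfC.
by rewrite peirce0_conjE; have := rank1_cross w1' w0' (cj v); rewrite cjK.
Qed.

Lemma E2_peirce0_conj_tf v : v \in peirce triple 0 w ->
  tf e (cj (peirce0_conj w v)) = (tf e (cj v))^*.
Proof. by move=> vW; rewrite -{1}Je (peirce0_conj_isom Ew). Qed.

(** On V_0(w) one has Q(e) v = (e|v) e - Jv with Je = e and (e|e) = 2, up to sign a reflection along
    e composed with the conjugation J. *)
Lemma E2_quadK v : v \in peirce triple 0 w -> quad e (quad e v) = v.
Proof.
move=> vW; rewrite [quad e v]E2_quad quadD quadN quadZ !E2_quad ee Je.
rewrite (E2_peirce0_conj_tf vW) (peirce0_conjK Ew vW); vring.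
Qed.

Lemma E2_quad_isom u v : u \in peirce triple 0 w -> v \in peirce triple 0 w ->
  tf (quad e u) (cj (quad e v)) = (tf u (cj v))^*.
Proof. by move=> uW vW; rewrite quad_adj E2_quadK // tf_cjr. Qed.

Lemma E2_V2p v : peirce2_plus triple e v <-> quad e v = v.
Proof. by rewrite /peirce2_plus /= quadE. Qed.

Lemma E2_V2p_mem v : quad e v = v -> v \in peirce triple 0 w.
Proof. by move=> <-; exact: E2_quad_mem. Qed.

Lemma E2_V2p_basis : exists b : 'I_10 -> H3O R,
  [/\ forall i, b i \in peirce triple 0 w, forall i, quad e (b i) = b i,
    forall i j, tf (b i) (cj (b j)) = (i == j)%:R
    & forall v, v \in peirce triple 0 w -> v = \sum_i tf v (cj (b i)) *: b i].
Proof.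
have [b [bW bf bo]] := real_form_basis (fun v _ => E2_quad_mem v) (@quadD R e) (@quadZ R e)
   E2_quadK E2_quad_isom.
have := orthonormal_expand bW bo.
by move: b bW bf bo; rewrite (dim_rank1_peirce0 Ew) => b ? ? ? ?; exists b.
Qed.

Lemma E2_V2p_real u v : quad e u = u -> quad e v = v -> (tf u (cj v))^* = tf u (cj v).
Proof. by move=> hu hv; rewrite -E2_quad_isom ?E2_V2p_mem // hu hv. Qed.

Section Disc.
Variable t : C.
Local Notation p := (e + t *: w).

Lemma disc_sharp : sharp p = cj w + t *: cj e.
Proof. by rewrite sharpD sharpZ w0 scaler0 addr0 crossZr (crossC e) we se. Qed.

Lemma disc_hdet : hdet p = t.
Proof.
rewrite hdetE disc_sharp !tfE (tfC (cj w) e) (tfC (cj w) w) (tfC (cj e) e) (tfC (cj e) w).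
by rewrite ew w1 ee we'; field.
Qed.

Lemma disc_s1 : s1 p = 2 + t * t^*.
Proof. by rewrite /s1 !cjD cjZ !tfE ew w1 ee we'; ring. Qed.

Lemma disc_s2 : s2 p = 1 + 2 * (t * t^*).
Proof.
rewrite /s2 -cj_sharp disc_sharp !cjD cjZ !cjK !tfE.
by rewrite (tfC (cj w) e) (tfC (cj w) w) (tfC (cj e) e) (tfC (cj e) w) ew w1 ee we'; ring.
Qed.

Lemma disc_boundary2 : t * t^* < 1 -> boundary 2 p.
Proof. by move=> h; apply/boundary2_s; rewrite disc_s1 disc_s2 /s3 disc_hdet. Qed.

Lemma disc_triple v : triple p p v = 2 *: v - (1 - t * t^*) *: triple w w v.
Proof.
have o z : triple w e z = 0 by apply: (rank1_orth0 Ew).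
have o' := triple_eq0C o.
rewrite tripleDl !tripleDm !tripleZl !tripleZm o o' !scaler0 addr0 add0r (E2_triple _ Ee) wE; vring.
Qed.

Lemma rank1_V1_cross v : v \in peirce triple 1 w -> w ** v = 0.
Proof.
move=> /(rank1_peirce1 Ew) [_ h]; rewrite -(rank1_cross w1 w0) h.
by rewrite cross0r.
Qed.

End Disc.

Local Notation N v := (cj (e ** v)).

(** The involution comes from [cross_sharp] at the conjugate of e + w, which has determinant 1: on
    V_1(w) every term involving w drops out and only conj e ** (e ** v) = v is left. *)
Lemma rank2_V1_conj v : v \in peirce triple 1 w -> N v \in peirce triple 1 w /\ N (N v) = v.
Proof.
move=> h; have [v1 v2] := proj1 (rank1_peirce1 Ew v) h.
have wv := rank1_V1_cross h.
have cv : cj w ** (e ** v) = 0.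
  by rewrite -se sharp_cross de scale0r add0r se tfC v1 scale0r.
have tv : tf v (cj e) = 0.
  have ce : cj e = w ** (cj w ** cj e).
    by have [_ _ e0 _] := facts; rewrite -{1}e0 !cjE.
  by rewrite ce -tf_cross (crossC v) wv tf0l.
split.
  apply/(rank1_peirce1 Ew); split.
    by rewrite tf_cj tf_crossC crossC we tfC tv rmorph0.
  have -> : w ** N v = 0 by rewrite -[w]cjK -cj_cross cv cj0.
  by rewrite cross0r.
rewrite cj_cross cjK.
have su := disc_sharp 1; have hu := disc_hdet 1; rewrite scale1r in su hu.
have := cross_sharp (cj (e + w)) v.
rewrite hdet_cj hu rmorph1 scale1r -cj_sharp su scale1r !cjD !cjK.
rewrite tfDl (tfC (cj e)) tv (tfC (cj w)) v1 addr0 scale0r addr0.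
by rewrite (crossDl w e) wv add0r crossDl cv addr0.
Qed.

Section DiscKernel.
Variable t : C.
Local Notation p := (e + t *: w).
Local Notation r := (t * t^* ).

(** Q(p) respects the Peirce decomposition and is antilinear on each summand: Q(e) on V_0(w), - t N
    on V_1(w) and t^2 times conjugation on the line of w. *)
Lemma disc_quad (a v1 : H3O R) tau : a \in peirce triple 0 w -> v1 \in peirce triple 1 w ->
  quad p (a + v1 + tau *: w) = quad e a - t *: N v1 + (t ^+ 2 * tau^* ) *: w.
Proof.
move=> aW vW; rewrite !quadD.
have a0 : tf w (cj a) = 0.
  rewrite -tf_cjr (rank1_orth w0) ?rmorph0 //; exact/(rank1_peirce0 Ew).
have -> : quad p a = quad e a.
  rewrite [quad e a]E2_quad /quad disc_sharp crossDl crossZl tfDl tfZl a0 peirce0_conjE.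
  have -> : cj e ** cj a = tf e (cj a) *: w.
    rewrite -cj_cross (peirce0_cross Ew eW aW) cjZ cjK (E2_peirce0_conj_tf aW) conjCK //.
  by vring.
have wv := rank1_V1_cross vW; have [v1w _] := proj1 (rank1_peirce1 Ew v1) vW.
have -> : quad p v1 = - (t *: N v1).
  have tv : tf e (cj v1) = 0.
    have ce : e = cj w ** (w ** e) by have [_ _ -> _] := facts.
    by rewrite ce crossC tf_cross -cj_cross wv cj0 tf0r.
  have tw : tf w (cj v1) = 0 by rewrite -tf_cjr v1w rmorph0.
  rewrite /quad disc_sharp crossDl crossZl tfDl tfZl tv tw -!cj_cross wv cj0.
  by vring.
have -> : quad p (tau *: w) = (t ^+ 2 * tau^* ) *: w.
  rewrite /quad disc_sharp cjZ crossZr tfZr crossDl crossZl crossxx w0' scaler0 add0r.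
  rewrite (crossC (cj e)) -cj_cross we cjK tfDl tfZl ew w1; vring.
by [].
Qed.

Lemma disc_sk (a v1 : H3O R) tau : a \in peirce triple 0 w -> v1 \in peirce triple 1 w ->
  sk p (a + v1 + tau *: w) = 2 *: (a - quad e a) + ((1 + r) *: v1 + (2 * t) *: N v1)
     + (2 * (r * tau - t ^+ 2 * tau^* )) *: w.
Proof.
move=> aW vW.
have -> : sk p (a + v1 + tau *: w) =
    triple p p (a + v1 + tau *: w) - 2 *: quad p (a + v1 + tau *: w).
  by rewrite sk.unlock -quadE scalerA mulfV ?scale1r // pnatr_eq0.
rewrite (disc_quad _ aW vW) disc_triple.
have -> : triple w w (a + v1 + tau *: w) = v1 + (2 * tau) *: w.
  rewrite !tripleDr tripleZr.
  have /peirceP -> := aW; have /peirceP -> := vW.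
  have /peirceP -> : w \in peirce triple 2 w by apply/(rank1_peirce2 Ew); rewrite w1 scale1r.
  by vring.
by vring.
Qed.

(** On V_0(w) the kernel condition is Q(e) a = a. On V_1(w) it is (1 + r) v1 + 2 t N v1 = 0; with
    its image under N this is a system of determinant (1 + r)^2 - 4 r = (1 - r)^2, so v1 = 0. What
    survives along w is left to [disc_syz]. *)
Lemma disc_sk_ker v : r < 1 -> sk p v = 0 ->
  exists (a : H3O R) tau, [/\ a \in peirce triple 0 w, quad e a = a & v = a + tau *: w].
Proof.
move=> r1; have [a [v1 [aW vW vE]]] := rank1_decomp v Ew.
move: vE; set tau := tf v (cj w) => vE; rewrite vE (disc_sk _ aW vW) => h.
have [nW NN] := rank2_V1_conj vW.
have aq : a - quad e a \in peirce triple 0 w := rpredB aW (E2_quad_mem a).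
have a0 : quad e a = a.
  have := congr1 (fun z => cj w ** (w ** z)) h.
  rewrite /= !crossDr !(crossZr _ _ w) (rank1_V1_cross vW) (rank1_V1_cross nW) crossxx w0.
  rewrite !crossZr.
  have /(rank1_peirce0 Ew) := aq; rewrite crossDr crossNr crossDr crossNr => ->.
  rewrite !cross0r !scaler0 !addr0 => /eqP.
  by rewrite scaler_eq0 pnatr_eq0 /= subr_eq0 => /eqP.
exists a, tau; split=> //.
suff -> : v1 = 0 by rewrite addr0.
have h1 : (1 + r) *: v1 + (2 * t) *: N v1 = 0.
  have c0 : 2 * (r * tau - t ^+ 2 * tau^* ) = 0.
    have [v1w _] := proj1 (rank1_peirce1 Ew v1) vW.
    have [nw _] := proj1 (rank1_peirce1 Ew _) nW.
    have := congr1 (fun z => tf z (cj w)) h.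
    by rewrite /= a0 subrr scaler0 add0r !tfDl !tfZl v1w nw w1 tf0l !mulr0 !add0r mulr1.
  by move: h; rewrite a0 subrr scaler0 add0r c0 scale0r addr0.
have h2 : (1 + r) *: N v1 + (2 * t^* ) *: v1 = 0.
  have := congr1 (fun z => cj (e ** z)) h1.
  rewrite /= crossDr !crossZr cjD !cjZ NN cross0r cj0.
  by rewrite rmorphD rmorphM /= conjCK rmorph1 rmorphM /= rmorph_nat [t^* * t]mulrC.
have : ((1 - r) ^+ 2) *: v1 = 0.
  vpush; vpush_hyp h1 k; vpush_hyp h2 k.
  transitivity ((1 + r) * ((1 + r) * co k v1 + 2 * t * co k (N v1))
     - 2 * t * ((1 + r) * co k (N v1) + 2 * t^* * co k v1)); first by ring.
  by rewrite h1 h2; ring.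
move/eqP; rewrite scaler_eq0 expf_eq0 /= subr_eq0 eq_sym lt_eqF //= => /eqP //.
Qed.

Definition gap_diff x v := v - ((x ** v) ** cj x + sharp x ** cj v)
  + (tf (sharp x) v *: sharp (cj x) + hdet x *: (cj x ** cj v)).

(** The differential of [gap] paired with b in V_2^+(e) only sees the real part of (v|Jb). Since J
    permutes V_2^+(e), ten such pairings cut out the orthogonal of V_2^+(e), the same for all points
    of the disc. *)
Lemma disc_gap_diff (v b : H3O R) : quad e b = b ->
  tf (gap_diff p v) (cj b) =
  - (1 - r) * (tf v (cj (peirce0_conj w b)) + (tf v (cj (peirce0_conj w b)))^* ).
Proof.
move=> hb; have bW := E2_V2p_mem hb; set hat := peirce0_conj w b.
set beta := tf e (cj b).
have br : beta^* = beta by apply: E2_V2p_real => //; rewrite E2_quad ee Je; vring.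
have bE : b = beta *: e - hat by rewrite -{1}hb E2_quad.
have hatW : hat \in peirce triple 0 w by exact: peirce0_conj_mem.
have hatK : peirce0_conj w hat = b by exact: (peirce0_conjK Ew bW).
have wb : cj w ** cj b = hat by rewrite /hat peirce0_conjE.
have eb : cj e ** cj b = beta *: w.
  rewrite -cj_cross (peirce0_cross Ew eW bW) cjZ cjK (E2_peirce0_conj_tf bW) conjCK //.
have whe : w ** hat = cj b by rewrite -hatK /peirce0_conj cjK.
have ehat : e ** hat = beta *: cj w.
  by rewrite (peirce0_cross Ew eW hatW) hatK.
have pB : cj p ** cj b = beta *: w + t^* *: hat.
  by rewrite cjD cjZ crossDl crossZl eb wb.
have bw0 : tf w (cj b) = 0.
  by rewrite -tf_cjr (rank1_orth w0) ?rmorph0 //; exact/(rank1_peirce0 Ew).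
have T2 : tf ((p ** v) ** cj p) (cj b) = beta * tf v (cj e) + t^* * beta * tf v (cj w) + r * tf v (cj b).
  rewrite tf_cross pB (crossC p) tf_cross crossDr !crossZr !crossDl !crossZl.
  rewrite ehat whe crossxx w0 (crossC e) we !tfE tf0r; ring.
have T3 : tf (sharp p ** cj v) (cj b) = tf (cj v) hat + t * beta * tf (cj v) w.
  rewrite disc_sharp (crossC _ (cj v)) tf_cross crossDl crossZl wb eb !tfE; ring.
have T4 : tf (sharp (cj p)) (cj b) = t^* * beta.
  by rewrite -cj_sharp disc_sharp cjD cjZ !cjK tfDl tfZl bw0 add0r.
have T5 : tf (cj p ** cj v) (cj b) = beta * tf (cj v) w + t^* * tf (cj v) hat.
  by rewrite (crossC _ (cj v)) tf_cross pB !tfE.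
rewrite /gap_diff !tfDl tfNl !tfDl !tfZl T2 T3 T4 T5 disc_hdet disc_sharp tfDl tfZl.
rewrite (tfC (cj w) v) (tfC (cj e) v).
have -> : (tf v (cj hat))^* = tf (cj v) hat by rewrite -tf_cj cjK.
have -> : tf v (cj hat) = beta * tf v (cj e) - tf v (cj b).
  have -> : cj hat = beta *: cj e - cj b.
    by rewrite bE cjD cjN cjZ br; vring.
  by rewrite !tfE.
ring.
Qed.

(** With rho = 2 Re(tau conj t) the syzygy reads 2 tau = t rho. Substituting this into rho gives (1
    - r) rho = 0, hence rho = 0 and tau = 0. *)
Lemma disc_syz tau : r < 1 -> gap_syzygy p (tau *: w) = 0 -> tau = 0.
Proof.
move=> r1; rewrite gap_syzygy.unlock /= disc_s1 disc_s2 disc_hdet disc_sharp.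
rewrite (boundary2_gap (disc_boundary2 r1)) scaler0 subr0.
have rr : r^* = r by rewrite conj_Creal // ger0_real // mul_conjC_ge0.
have -> : 2 * (3 - (2 + r)) + (3 - 2 * (2 + r) + (1 + 2 * r)) = 2 * (1 - r) by ring.
have -> : 3 - (2 + r) - (3 - 2 * (2 + r) + (1 + 2 * r)) = 1 - r by ring.
have cr : (2 * (1 - r))^* = 2 * (1 - r).
  by rewrite conj_Creal // rpredM ?realn // rpredB ?rpred1 // ger0_real // mul_conjC_ge0.
have -> : tf (tau *: w) (cj ((2 * (1 - r)) *: p)) = 2 * (1 - r) * (tau * t^* ).
  by rewrite cjZ cr cjD cjZ !tfE w1 we'; ring.
have -> : tf (tau *: w) (cj w + t *: cj e) = tau by rewrite !tfE w1 we'; ring.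
rewrite [(2 * (1 - r) * _)^*]rmorphM /= cr rmorphM /= conjCK => h.
have nr : 1 - r != 0 by rewrite subr_eq0 eq_sym lt_eqF.
have h1 : 2 * tau = t * (tau * t^* + tau^* * t).
  apply: (mulfI nr); apply/eqP; rewrite -subr_eq0; apply/eqP.
  by rewrite -[RHS]h; field.
set rho := tau * t^* + tau^* * t in h1.
have rhor : rho^* = rho by rewrite /rho rmorphD !rmorphM /= !conjCK addrC.
have h2 : 2 * tau^* = t^* * rho.
  by have := congr1 (fun z1 : C => z1^*) h1; rewrite /= !rmorphM /= rhor rmorph_nat.
have : 2 * (1 - r) * rho = 0.
  have e2 : 2 * rho = t^* * (2 * tau) + t * (2 * tau^* ) by rewrite /rho; ring.
  transitivity (2 * rho - 2 * r * rho); first by ring.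
  by rewrite e2 h1 h2; ring.
move/eqP; rewrite !mulf_eq0 pnatr_eq0 (negbTE nr) /= => /eqP rho0.
by move/eqP: h1; rewrite rho0 mulr0 mulf_eq0 pnatr_eq0 /= => /eqP.
Qed.

End DiscKernel.
End RankTwo.

(** * Submanifolds *)

Section PolynomialMaps.
Context {R : realType}.
Local Notation C := R[i].
Local Notation V := (H3O R).
Local Notation n := (dim (H3O R)).
Local Notation E := 'rV[R]_(n + n).
Implicit Types (x u v : V) (y z : E).

Definition polyV (F : E -> V) := exists d, poly_funV F d.
Definition polyC (f : E -> C) := exists d, poly_funC f d.

Lemma polyV_unreal : polyV unreal. Proof. by eexists; exact: poly_funV_unreal. Qed.
Lemma polyV_cst x : polyV (fun _ => x). Proof. by eexists; exact: poly_funV_cst. Qed.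
Lemma polyV_add F G : polyV F -> polyV G -> polyV (fun y => F y + G y).
Proof. by move=> [? ?] [? ?]; eexists; apply: poly_funV_add; eassumption. Qed.
Lemma polyV_opp F : polyV F -> polyV (fun y => - F y).
Proof. by move=> [? ?]; eexists; apply: poly_funV_opp; eassumption. Qed.
Lemma polyV_scale f F : polyC f -> polyV F -> polyV (fun y => f y *: F y).
Proof. by move=> [? ?] [? ?]; eexists; apply: poly_funV_scale; eassumption. Qed.
Lemma polyV_cj F : polyV F -> polyV (fun y => cj (F y)).
Proof. by move=> [? ?]; eexists; apply: poly_funV_cj; eassumption. Qed.
Lemma polyV_cross F G : polyV F -> polyV G -> polyV (fun y => F y ** G y).
Proof. by move=> [? ?] [? ?]; eexists; apply: poly_funV_cross; eassumption. Qed.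
Lemma polyV_sharp F : polyV F -> polyV (fun y => sharp (F y)).
Proof. by move=> [? ?]; eexists; apply: poly_funV_sharp; eassumption. Qed.
Lemma polyC_cst c : polyC (fun _ => c). Proof. by eexists; exact: poly_funC_cst. Qed.
Lemma polyC_add f g : polyC f -> polyC g -> polyC (fun y => f y + g y).
Proof. by move=> [? ?] [? ?]; eexists; apply: poly_funC_add; eassumption. Qed.
Lemma polyC_mul f g : polyC f -> polyC g -> polyC (fun y => f y * g y).
Proof. by move=> [? ?] [? ?]; eexists; apply: poly_funC_mul; eassumption. Qed.
Lemma polyC_opp f : polyC f -> polyC (fun y => - f y).
Proof.
move=> hf; have -> : (fun y => - f y) = (fun y => (-1) * f y).
  by apply/funext => y; rewrite mulN1r.
by apply: polyC_mul => //; exact: polyC_cst.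
Qed.
Lemma polyC_conj f : polyC f -> polyC (fun y => (f y)^* ).
Proof. by move=> [? ?]; eexists; apply: poly_funC_conj; eassumption. Qed.
Lemma polyC_tf F G : polyV F -> polyV G -> polyC (fun y => tf (F y) (G y)).
Proof. by move=> [? ?] [? ?]; eexists; apply: poly_funC_tf; eassumption. Qed.
Lemma polyC_hdet F : polyV F -> polyC (fun y => hdet (F y)).
Proof. by move=> [? ?]; eexists; apply: poly_funC_hdet; eassumption. Qed.

Ltac poly := repeat first
  [ exact: polyV_unreal | exact: polyV_cst | exact: polyC_cst
  | apply: polyV_add | apply: polyV_opp | apply: polyV_scale | apply: polyV_cj
  | apply: polyV_sharp | apply: polyV_cross
  | apply: polyC_add | apply: polyC_opp | apply: polyC_mul | apply: polyC_conj
  | apply: polyC_tf | apply: polyC_hdet ].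

Lemma polyC_s1 : polyC (fun y => s1 (unreal y)).
Proof. rewrite /s1; poly. Qed.
Lemma polyC_f1 : polyC (fun y => f1 (unreal y)).
Proof.
rewrite (_ : (fun _ => _) = fun y => 1 - s1 (unreal y) + s2 (unreal y) - s3 (unreal y)).
  by poly.
by apply/funext => y; rewrite f1E.
Qed.
Lemma polyC_f2 : polyC (fun y => f2 (unreal y)).
Proof.
rewrite (_ : (fun _ => _) = fun y => 3 - 2 * s1 (unreal y) + s2 (unreal y)).
  by poly.
by apply/funext => y; rewrite f2E.
Qed.
Lemma polyC_f3 : polyC (fun y => f3 (unreal y)).
Proof.
rewrite (_ : (fun _ => _) = fun y => 3 - s1 (unreal y)).
  by poly.
by apply/funext => y; rewrite f3E.
Qed.

Lemma poly_funV_gap : poly_funV (fun y => gap (unreal y))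
  (fun y z => gap_diff (unreal y) (unreal z)).
Proof.
have hx := @poly_funV_unreal R; have hc := poly_funV_cj hx.
apply: (poly_funV_eq (poly_funV_add (poly_funV_add hx (poly_funV_opp
   (poly_funV_cross (poly_funV_sharp hx) hc)))
   (poly_funV_scale (poly_funC_hdet hx) (poly_funV_sharp hc)))) => [y|y z].
  by rewrite gap.unlock.
by rewrite /gap_diff; vring.
Qed.

Definition tripotent_defect_diff x v := v - triple x x v - quad x v.

Lemma poly_funV_tdef : poly_funV (fun y => tripotent_defect (unreal y))
  (fun y z => tripotent_defect_diff (unreal y) (unreal z)).
Proof.
have hx := @poly_funV_unreal R; have hc := poly_funV_cj hx.
apply: (poly_funV_eq (poly_funV_add (poly_funV_add hx (poly_funV_opp
   (poly_funV_scale (poly_funC_tf hx hc) hx)))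
   (poly_funV_cross (poly_funV_sharp hx) hc))) => [y|y z].
  by rewrite tdefE.
by rewrite /tripotent_defect_diff tripleE /quad; vring.
Qed.

Lemma polyV_sk v : polyV (fun y => sk (unreal y) v).
Proof.
rewrite (_ : (fun _ => _) = fun y => s1 (unreal y) *: v + tf v (cj (unreal y)) *: unreal y
  - (unreal y ** v) ** cj (unreal y) - (2 * tf (unreal y) (cj v)) *: unreal y
  + 2 *: (sharp (unreal y) ** cj v)).
  by poly.
by apply/funext => y; rewrite skE.
Qed.

Lemma polyC_syz v : polyC (fun y => gap_syzygy (unreal y) v).
Proof.
have hg : polyV (fun y => gap (unreal y)) by eexists; exact: poly_funV_gap.
rewrite gap_syzygy.unlock; poly; exact: hg.
Qed.

Lemma open_Re_gt0 f : polyC f -> open [set y | 0 < complex.Re (f y)].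
Proof.
move=> [d [hd _]].
apply: (open_comp (f := fun y => complex.Re (f y)) (D := [set x | 0 < x])).
  by move=> y _; exact: (poly_fun_continuous hd).
exact: open_gt.
Qed.

Lemma closed_Re_eq0 f : polyC f -> closed [set y | complex.Re (f y) = 0].
Proof.
move=> [d [hd _]].
apply: (preimage_closed (f := fun y => complex.Re (f y)) (D := [set x | x = 0])).
  by move=> y _; exact: (poly_fun_continuous hd).
exact: closed_eq.
Qed.

Lemma realify_imageE (A : set V) : realify @` A = [set y | A (unreal y)].
Proof. by apply/seteqP; split=> y /realify_image. Qed.

End PolynomialMaps.

Section RealParts.
Context {R : realType}.
Local Notation C := R[i].
Local Notation V := (H3O R).
Implicit Types (x u v : V).

Lemma real_Re (a : C) : a^* = a -> a = (complex.Re a)%:C.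
Proof. by move=> h; rewrite RRe_real //; apply/CrealP. Qed.

Lemma lt0_Re (a : C) : a^* = a -> (0 < a) = (0 < complex.Re a).
Proof. by move=> /real_Re {1}->; rewrite ltcR. Qed.

Lemma eq0_Re (a : C) : a^* = a -> (a = 0) <-> (complex.Re a = 0).
Proof. by move=> h; split=> [->//|e]; rewrite (real_Re h) e. Qed.

Lemma conj_f1 x : (f1 x)^* = f1 x.
Proof. by rewrite f1E !(rmorphB, rmorphD) /= rmorph1 conj_s1 conj_s2 conj_s3. Qed.
Lemma conj_f2 x : (f2 x)^* = f2 x.
Proof.
by rewrite f2E rmorphD rmorphB rmorphM /= !rmorph_nat conj_s1 conj_s2.
Qed.
Lemma conj_f3 x : (f3 x)^* = f3 x.
Proof. by rewrite f3E rmorphB /= rmorph_nat conj_s1. Qed.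

Lemma tripotent_s1 x : tripotent triple x -> exists m : nat, s1 x = m%:R.
Proof.
case/tripotent_cases => [->|/E1P [h _]|/E2P [h _ _]|/E3_s [h _ _]].
- by exists 0%N; rewrite /s1 tf0l.
- by exists 1%N.
- by exists 2%N.
- by exists 3%N.
Qed.

Lemma E1_tripotentP x : E1 x <-> tripotent triple x /\ s1 x = 1%:R.
Proof.
split=> [h|[h s]]; first by split; [exact: E1_tripotent | case/E1P: h].
have [h'|//|/E2P [h' _ _]|/E3_s [h' _ _]] := tripotent_cases h; move: s.
- by rewrite h' /s1 tf0l => /esym/eqP; rewrite oner_eq0.
- by rewrite h' => /eqP; rewrite eqr_nat.
- by rewrite h' => /eqP; rewrite eqr_nat.
Qed.

Lemma E2_tripotentP x : E2 x <-> tripotent triple x /\ s1 x = 2%:R.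
Proof.
split=> [h|[h s]]; first by split; [exact: E2_tripotent | case/E2P: h].
have [h'|/E1P [h' _]|//|/E3_s [h' _ _]] := tripotent_cases h; move: s.
- by rewrite h' /s1 tf0l => /esym/eqP; rewrite pnatr_eq0.
- by rewrite /s1 h' => /eqP; rewrite (eqr_nat _ 1 2).
- by rewrite h' => /eqP; rewrite eqr_nat.
Qed.

Lemma E3_tripotentP x : E3 x <-> tripotent triple x /\ s1 x = 3%:R.
Proof.
split=> [h|[h s]]; first by split; [exact: E3_tripotent | case/E3P: h].
have [h'|/E1P [h' _]|/E2P [h' _ _]|//] := tripotent_cases h; move: s.
- by rewrite h' /s1 tf0l => /esym/eqP; rewrite pnatr_eq0.
- by rewrite /s1 h' => /eqP; rewrite (eqr_nat _ 1 3).
- by rewrite h' => /eqP; rewrite eqr_nat.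
Qed.

Lemma tripotent_tdef x : tripotent triple x <-> tripotent_defect x = 0.
Proof.
rewrite /tripotent tripotent_defect.unlock; split=> [->|h].
  by rewrite scalerA mulVf ?pnatr_eq0 // scale1r subrr.
move/eqP: h; rewrite subr_eq0 => /eqP h.
by rewrite {4}h scalerA mulfV ?pnatr_eq0 // scale1r.
Qed.

Lemma orthonormal_rfree q (b : 'I_q -> V) (c : 'I_q -> C) :
  (forall i j, tf (b i) (cj (b j)) = (i == j)%:R) ->
  \sum_i c i *: b i = 0 -> forall i, c i = 0.
Proof.
move=> bo h i; have := congr1 (fun z => tf z (cj (b i))) h.
rewrite /= tf_suml tf0l (bigD1 i) //= tfZl bo eqxx mulr1 big1 ?addr0 // => j ji.
by rewrite tfZl bo (negbTE ji) mulr0.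
Qed.

(** Since s1 takes integer values on tripotents, the shell |s1 - m| < 1/2 separates those of rank m,
    and in it M is the zero set of the tripotent defect. *)
Lemma tripotent_defining_functions (m : nat) (M : set V) (p : V) q (b : 'I_q -> V) :
  (forall x, M x <-> tripotent triple x /\ s1 x = m%:R) -> M p ->
  (forall v, sk p v = 0 -> (forall i, complex.Re (tf v (cj (b i))) = 0) -> v = 0) ->
  (forall c : 'I_q -> R, tripotent_defect_diff p (\sum_i (c i)%:C *: b i) = 0 -> forall i, c i = 0) ->
  exists O (F : 'I_q -> _), defining_functions (realify @` M) (realify p) O F /\
    forall i v, 'd (F i) (realify p) (realify v) = complex.Re (tf (tripotent_defect_diff p v) (cj (b i))).
Proof.
move=> MP Mp inj indep; have [tp sp] := proj1 (MP p) Mp.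
pose U := [set x : V | 0 < complex.Re (s1 x - m%:R + 2^-1) /\ 0 < complex.Re (m%:R + 2^-1 - s1 x)].
have half : complex.Re (2^-1 : C) = 2^-1.
  have -> : (2^-1 : C) = (2^-1)%:C by rewrite rmorphV ?unitfE ?pnatr_eq0 //= rmorph_nat.
  by [].
have Ren (k : nat) : complex.Re (k%:R : C) = k%:R.
  by rewrite -(rmorph_nat (real_complex R)).
apply: (@syzygy_defining_functions R M U p q b (@tripotent_defect R) (@tripotent_defect_diff R) (@sk R) (fun _ _ => 0)).
- by split; rewrite /= sp ?subrr ?add0r ?(addrC m%:R) ?addrK half invr_gt0 ltr0n.
- rewrite realify_imageE.
  have -> : [set y | U (unreal y)] = [set y | 0 < complex.Re (s1 (unreal y) - m%:R + 2^-1)]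
     `&` [set y | 0 < complex.Re (m%:R + 2^-1 - s1 (unreal y))] by [].
  apply: openI; apply: open_Re_gt0.
    by apply: polyC_add; [apply: polyC_add; [exact: polyC_s1|exact: polyC_cst]|exact: polyC_cst].
  by apply: polyC_add; [exact: polyC_cst|apply: polyC_opp; exact: polyC_s1].
- move=> x [h1 h2]; rewrite -tripotent_tdef MP; split=> [[]//|tx]; split=> //.
  have [k sk] := tripotent_s1 tx; move: h1 h2; rewrite sk !(ReD, ReN) half !Ren.
  move=> h1 h2; have [km|mk|->//] := ltngtP k m; exfalso.
    have : (k.+1%:R : R) <= m%:R by rewrite ler_nat.
    by rewrite -natr1 => h3; clear -h1 h3; lra.
  have : (m.+1%:R : R) <= k%:R by rewrite ler_nat.
  by rewrite -natr1 => h3; clear -h2 h3; lra.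
- exact: poly_funV_tdef.
- exact: polyV_sk.
- by move=> v; exact: polyC_cst.
- exact: skD.
- by move=> x t v; rewrite skZ // conj_real.
- by move=> *; rewrite addr0.
- by move=> *; rewrite mulr0.
- exact: sk_tripotent_defect.
- by [].
- by move=> v h _; exact: inj.
- move=> c h; apply: indep; set beta := \sum_i _ in h *.
  (* The differential of the defect is self-adjoint for the real inner product. Hence beta is
     orthogonal to its image exactly when it is in its kernel, and independence becomes injectivity
     on the real span of the b i. *)
  have sa u v : complex.Re (tf (tripotent_defect_diff p u) (cj v)) = complex.Re (tf (tripotent_defect_diff p v) (cj u)).
    have e u' z : complex.Re (tf (tripotent_defect_diff p u') z) = complex.Re (tf u' z)
        - complex.Re (tf (triple p p u') z) - complex.Re (tf (quad p u') z).
      rewrite /tripotent_defect_diff (tfDl (u' - triple p p u') (- quad p u')) (tfDl u' (- triple p p u')).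
      by rewrite (tfNl (triple p p u')) (tfNl (quad p u')) !ReD !ReN.
    rewrite !e; congr (_ - _ - _).
    - by rewrite -tf_cjr cplx_ReJ.
    - by apply: etrans (congr1 _ (triple_adj p p u v)) _; rewrite -[LHS]cplx_ReJ tf_cjr.
    - by rewrite quad_adj.
  apply: herm_eq0; apply/eq0_Re; first by rewrite tf_cjr.
  by rewrite sa h.
Qed.

End RealParts.

Section Submanifolds.
Context {R : realType}.
Local Notation C := R[i].
Local Notation V := (H3O R).
Implicit Types (x u v e p : V).

Lemma ReM_i (a : C) : complex.Re ('i * a) = - complex.Im a.
Proof. by case: a => ? ? /=; rewrite mul0r sub0r mul1r. Qed.

Lemma Re_Im_eq0 (a : C) : complex.Re a = 0 -> complex.Re ('i * a) = 0 -> a = 0.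
Proof. by rewrite ReM_i; case: a => a b /= -> /eqP; rewrite oppr_eq0 => /eqP ->. Qed.

Lemma conj_i : ('i : C)^* = - 'i.
Proof. by apply/eqP; rewrite eq_complex /= oppr0 !eqxx. Qed.

Lemma Re_tf_i v u : complex.Re (tf v (cj ('i *: u))) = complex.Im (tf v (cj u)).
Proof. by rewrite cjZ conj_i tfZr mulNr ReN ReM_i opprK. Qed.

Lemma Re_tf_sym v u : complex.Re (tf v (cj u)) = complex.Re (tf u (cj v)).
Proof. by rewrite -tf_cjr cplx_ReJ. Qed.

Lemma cplxC_inj (a b : R) : a%:C + b%:C * 'i = 0 :> C -> a = 0 /\ b = 0.
Proof.
by move=> /eqP; rewrite eq_complex /= !(mulr0, mul0r, mulr1, subr0, addr0, add0r) => /andP [/eqP -> /eqP ->].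
Qed.

Lemma sk_quad x v : sk x v = triple x x v - 2 *: quad x v.
Proof. by rewrite sk.unlock -quadE scalerA mulfV ?scale1r // pnatr_eq0. Qed.

Lemma E1_quad e v : E1 e -> quad e v = tf e (cj v) *: e.
Proof. by move=> /E1P [_ h]; rewrite /quad h cross0l subr0. Qed.

Lemma rank1_V0_orth e a v : E1 e -> a \in peirce triple 0 e -> v \in peirce triple 1 e ->
  tf a (cj v) = 0.
Proof.
move=> Ee /(rank1_peirce0 Ee) aE /(rank1_peirce1 Ee) [_ h].
rewrite -aE crossC tf_cross (crossC e) tf_cross.
have -> : e ** (cj e ** cj v) = cj (cj e ** (e ** v)) by rewrite !cjE.
by rewrite h cj0 tf0r.
Qed.

Lemma rank1_V0_orth0 e a : E1 e -> a \in peirce triple 0 e -> tf a (cj e) = 0.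
Proof. by move=> Ee /(rank1_peirce0 Ee); apply: rank1_orth; case/E1P: Ee. Qed.

(** Codimension 21 = 1 + 20: the normal space of E1 at p is the real line of p plus V_0(p), whose
    complex basis is doubled by multiplication by i. *)
Lemma E1_defining_functions p : E1 p -> exists O (F : 'I_21 -> _),
  defining_functions (realify @` (E1 : set V)) (realify p) O F.
Proof.
move=> Ep; have [p1 p0] := proj1 (E1P p) Ep.
have [b [bW _ bo bE]] := peirce0_real_basis Ep.
pose fam (i : 'I_(1 + (10 + 10))) : V := match fintype.split i with
  | inl _ => p | inr j => match fintype.split j with inl k => b k | inr k => 'i *: b k end end.
have famp : fam (lshift _ 0) = p by rewrite /fam (unsplitK (inl _)).
have faml k : fam (rshift 1 (lshift 10 k)) = b k.
  by rewrite /fam (unsplitK (inr _)) (unsplitK (inl _)).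
have famr k : fam (rshift 1 (rshift 10 k)) = 'i *: b k.
  by rewrite /fam (unsplitK (inr _)) (unsplitK (inr _)).
have [||O [F [h _]]] := @tripotent_defining_functions R 1 (E1 : set V) p _ fam (@E1_tripotentP R) Ep.
- move=> v h hv.
  have [a [v1 [aW vW vE]]] := rank1_decomp v Ep.
  move: vE; set tau := tf v (cj p) => vE.
  have pa : tf p (cj a) = 0 by rewrite -tf_cjr (rank1_V0_orth0 Ep aW) rmorph0.
  have pv : tf p (cj v1) = 0 by rewrite -tf_cjr (proj1 (proj1 (rank1_peirce1 Ep v1) vW)) rmorph0.
  have tv : triple p p v = v1 + (2 * tau) *: p.
    rewrite vE !tripleDr tripleZr.
    have /peirceP -> := aW; have /peirceP -> := vW.
    have /peirceP -> : p \in peirce triple 2 p by apply/(rank1_peirce2 Ep); rewrite p1 scale1r.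
    by vring.
  have qv : quad p v = tau^* *: p.
    by rewrite (E1_quad v Ep) vE !cjD cjZ !tfDr tfZr pa pv p1 mulr1 !add0r.
  have v10 : v1 = 0.
    have h' : v1 + (2 * (tau - tau^* )) *: p = 0.
      by rewrite -[RHS]h sk_quad tv qv; vring.
    have c0 : 2 * (tau - tau^* ) = 0.
      have := congr1 (fun z => tf z (cj p)) h'.
      by rewrite /= tfDl tfZl p1 mulr1 -(tf_cjr p v1) pv rmorph0 add0r tf0l.
    by move: h'; rewrite c0 scale0r addr0.
  have a0 : a = 0.
    rewrite (bE a aW) big1 // => k _.
    have vb : tf v (cj (b k)) = tf a (cj (b k)).
      by rewrite vE v10 addr0 tfDl tfZl -(tf_cjr (b k) p) (rank1_V0_orth0 Ep (bW k)) rmorph0 mulr0 addr0.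
    have := hv (rshift 1 (lshift 10 k)); have := hv (rshift 1 (rshift 10 k)).
    rewrite faml famr Re_tf_i vb => h2 h1.
    rewrite (_ : tf a (cj (b k)) = 0) ?scale0r //.
    by apply: Re_Im_eq0 => //; rewrite ReM_i h2 oppr0.
  have t0 : tau = 0.
    have tr : complex.Re tau = 0 by have := hv (lshift _ 0); rewrite famp.
    have : 2 * (tau - tau^* ) = 0.
      have : sk p v = (2 * (tau - tau^* )) *: p by rewrite sk_quad tv qv v10; vring.
      by rewrite h => /esym /eqP; rewrite scaler_eq0 (negbTE (E1_neq0 Ep)) orbF => /eqP.
    move/eqP; rewrite mulf_eq0 pnatr_eq0 /= subr_eq0 => /eqP e.
    by apply/(eq0_Re (esym e)).
  by rewrite vE a0 v10 t0 scale0r !addr0.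
- move=> c.
  rewrite big_split_ord big_ord1 big_split_ord /= famp.
  set c0 := c _; under eq_bigr do rewrite faml; under [X in _ + (_ + X)]eq_bigr do rewrite famr.
  rewrite -big_split /=.
  pose d k := (c (rshift 1 (lshift 10 k)))%:C + (c (rshift 1 (rshift 10 k)))%:C * 'i : C.
  rewrite (eq_bigr (fun k => d k *: b k)) => [|k _]; last by rewrite scalerA -scalerDl.
  set a := \sum_k _.
  have aW : a \in peirce triple 0 p by rewrite rpred_sum // => k _; rewrite rpredZ.
  have pa : tf p (cj a) = 0 by rewrite -tf_cjr (rank1_V0_orth0 Ep aW) rmorph0.
  have pP : p \in peirce triple 2 p by apply/(rank1_peirce2 Ep); rewrite p1 scale1r.
  rewrite /tripotent_defect_diff tripleDr tripleZr (E1_quad _ Ep) cjD cjZ tfDr tfZr pa p1 conj_real mulr1 addr0.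
  have /peirceP -> := aW; have /peirceP -> := pP => h.
  have a0 : a = 0.
    have : a + (- 2 * c0%:C) *: p = 0 by rewrite -[RHS]h; vring.
    move=> h'; have c00 : - 2 * c0%:C = 0 :> C.
      have := congr1 (fun z => tf z (cj p)) h'.
      by rewrite /= tfDl tfZl p1 mulr1 (rank1_V0_orth0 Ep aW) add0r tf0l.
    by move: h'; rewrite c00 scale0r addr0.
  have c00 : c0 = 0.
    move: h; rewrite a0 => h; have : (- 2 * c0%:C) *: p = 0 by rewrite -[RHS]h; vring.
    move/eqP; rewrite scaler_eq0 (negbTE (E1_neq0 Ep)) orbF mulf_eq0 oppr_eq0 pnatr_eq0 /=.
    by move/eqP/(@complexI R).
  have dk := orthonormal_rfree bo a0.
  move=> i; case: (split_ordP i) => [j ->|j ->]; first by rewrite [j]ord1.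
  by case: (split_ordP j) => k ->; have [] := cplxC_inj (dk k).
- by exists O, F.
Qed.

End Submanifolds.

Section HigherSubmanifolds.
Context {R : realType}.
Local Notation C := R[i].
Local Notation V := (H3O R).
Local Notation n := (dim (H3O R)).
Local Notation E := 'rV[R]_(n + n).
Implicit Types (x u v e p : V).

Lemma sum_realZ q (b : 'I_q -> V) (c : 'I_q -> R) (f : V -> V) :
  (forall u v, f (u + v) = f u + f v) -> (forall a v, f (a *: v) = a^* *: f v) ->
  f (\sum_i (c i)%:C *: b i) = \sum_i (c i)%:C *: f (b i).
Proof.
move=> fD fZ; have f0 : f 0 = 0 by have := fZ 0 0; rewrite rmorph0 !scale0r.
by rewrite (big_morph f fD f0); apply: eq_bigr => i _; rewrite fZ conj_real.
Qed.

Lemma real_rfree q (b : 'I_q -> V) (c : 'I_q -> R) :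
  (forall i j, tf (b i) (cj (b j)) = (i == j)%:R) ->
  \sum_i (c i)%:C *: b i = 0 -> forall i, c i = 0.
Proof.
move=> bo h i; have := orthonormal_rfree (c := fun i => (c i)%:C) bo h i.
by move/(@complexI R).
Qed.

(** Codimension 12 = 10 + 2: the normal space of E2 at p is V_2^+(p) plus the complex line V_0(p) of
    w. The kernel of [sk] is read off from [disc_sk_ker] at t = 0. *)
Lemma E2_defining_functions p : E2 p -> exists O (F : 'I_12 -> _),
  defining_functions (realify @` (E2 : set V)) (realify p) O F.
Proof.
move=> Ep; pose w := cj (sharp p); have se : sharp p = cj w by rewrite cjK.
have [Ew _ _ _ pw] : [/\ E1 w, sharp p = cj w, w ** p = cj p, cj w ** (w ** p) = p & tf p (cj w) = 0].
  exact: E2_facts Ep.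
have [w1 w0] := proj1 (E1P w) Ew.
have [b [bW bq bo bE]] := E2_V2p_basis Ep se.
pose fam (i : 'I_(10 + (1 + 1))) : V := match fintype.split i with
  | inl k => b k | inr j => match fintype.split j with inl _ => w | inr _ => 'i *: w end end.
have faml k : fam (lshift (1 + 1) k) = b k by rewrite /fam (unsplitK (inl _)).
have fam1 : fam (rshift 10 (lshift 1 (0 : 'I_1))) = w.
  by rewrite /fam (unsplitK (inr _)) (unsplitK (inl _)).
have fam2 : fam (rshift 10 (rshift 1 (0 : 'I_1))) = 'i *: w.
  by rewrite /fam (unsplitK (inr _)) (unsplitK (inr _)).
have wb k : tf w (cj (b k)) = 0 by rewrite -tf_cjr (rank1_V0_orth0 Ew (bW k)) rmorph0.
have [||O [F [h _]]] := @tripotent_defining_functions R 2 (E2 : set V) p _ fam (@E2_tripotentP R) Ep.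
- move=> v h hv.
  have r0 : (0 : C) * 0^* < 1 by rewrite mul0r ltr01.
  have h' : sk (p + 0 *: w) v = 0 by rewrite scale0r addr0.
  have [a [tau [aW aq vE]]] := disc_sk_ker Ep se r0 h'.
  have a0 : a = 0.
    rewrite (bE a aW) big1 // => k _.
    have := hv (lshift (1 + 1) k); rewrite faml vE tfDl tfZl wb mulr0 addr0 => hk.
    rewrite (_ : tf a (cj (b k)) = 0) ?scale0r //.
    by apply/(eq0_Re (E2_V2p_real Ep se aq (bq k))).
  have t0 : tau = 0.
    have := hv (rshift 10 (lshift 1 0)); have := hv (rshift 10 (rshift 1 0)).
    rewrite fam1 fam2 Re_tf_i vE a0 add0r tfZl w1 mulr1 => h2 h1.
    by apply: Re_Im_eq0 => //; rewrite ReM_i h2 oppr0.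
  by rewrite vE a0 t0 scale0r addr0.
- move=> c.
  rewrite big_split_ord big_split_ord !big_ord1 /= fam1 fam2.
  under eq_bigr do rewrite faml.
  set c1 := c _; set c2 := c _; set a := \sum_k _.
  have aW : a \in peirce triple 0 w by rewrite rpred_sum // => k _; rewrite rpredZ.
  have aq : quad p a = a.
    by rewrite /a (sum_realZ _ _ (quadD p) (quadZ p)); apply: eq_bigr => k _; rewrite bq.
  rewrite scalerA -scalerDl; set tau := (c1%:C + _).
  have pE : p = p + 0 *: w by rewrite scale0r addr0.
  have ap : a \in peirce triple 2 p by rewrite (E2_peirce Ep se (leqnn 2)); exact: aW.
  have wp : w \in peirce triple 0 p.
    by rewrite (E2_peirce Ep se (leq0n 2)); apply/(rank1_peirce2 Ew); rewrite w1 scale1r.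
  have qw : quad p w = 0.
    by rewrite (E2_quad se) pw /peirce0_conj crossxx w0 scaler0 cj0 scale0r subr0.
  rewrite /tripotent_defect_diff tripleDr tripleZr quadD quadZ qw aq.
  have /peirceP -> := ap; have /peirceP -> := wp => h.
  have h' : (-2) *: a + tau *: w = 0 by rewrite -[RHS]h; vring.
  have t0 : tau = 0.
    have := congr1 (fun z => tf z (cj w)) h'.
    by rewrite /= tfDl !tfZl w1 mulr1 (rank1_V0_orth0 Ew aW) mulr0 add0r tf0l.
  have a0 : a = 0.
    move/eqP: h'; rewrite t0 scale0r addr0 scaler_eq0 oppr_eq0 pnatr_eq0 /=.
    by move/eqP.
  have [c10 c20] := cplxC_inj t0.
  have ck := real_rfree bo a0.
  move=> i; case: (split_ordP i) => [j ->|j ->]; first exact: ck.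
  by case: (split_ordP j) => k ->; rewrite (ord1 k).
- by exists O, F.
Qed.

Lemma E3_quad_basis p : E3 p -> exists b : 'I_27 -> V,
  [/\ forall i, quad p (b i) = b i,
    forall i j, tf (b i) (cj (b j)) = (i == j)%:R
    & forall v, v = \sum_i tf v (cj (b i)) *: b i].
Proof.
move=> Ep.
have [b [bW bf bo]] := real_form_basis (W := fullv) (fun v _ => memvf _) (@quadD R p) (@quadZ R p)
   (fun v _ => E3_quadK Ep v) (fun u v _ _ => E3_quad_isom Ep u v).
have := orthonormal_expand bW bo.
have dF : \dim {:H3O R} = 27%N by rewrite dimvf.
by move: b bW bf bo; rewrite dF => b _ ? ? bE; exists b; split=> // v; apply: bE; exact: memvf.
Qed.

(** The tangent space is the real orthogonal of V_2^+(p), which is a real form of the whole space.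
    If v and i v both lie in it, v is orthogonal to a complex basis; this is total reality. *)
Lemma E3_defining_functions p : E3 p -> exists O (F : 'I_27 -> _),
  defining_functions (realify @` (E3 : set V)) (realify p) O F /\
  forall v, (forall i, 'd (F i) (realify p) (realify v) = 0) ->
    (forall i, 'd (F i) (realify p) (realify ('i *: v)) = 0) -> v = 0.
Proof.
move=> Ep; have [b [bq bo bE]] := E3_quad_basis Ep.
have breal u k : quad p u = u -> (tf u (cj (b k)))^* = tf u (cj (b k)).
  by move=> uq; rewrite -(E3_quad_isom Ep) uq bq.
have dE v : tripotent_defect_diff p v = - v - quad p v by rewrite /tripotent_defect_diff (E3_triple _ Ep); vring.
have [||O [F [h dF]]] := @tripotent_defining_functions R 3 (E3 : set V) p _ b (@E3_tripotentP R) Ep.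
- move=> v h hv.
  have vq : quad p v = v.
    move/eqP: h; rewrite sk_quad (E3_triple _ Ep) -scalerBr scaler_eq0 pnatr_eq0 /= subr_eq0.
    by move/eqP.
  rewrite (bE v) big1 // => k _; rewrite (_ : tf v (cj (b k)) = 0) ?scale0r //.
  by apply/(eq0_Re (breal v k vq)).
- move=> c; set a := \sum_k _ => h.
  have aq : quad p a = a.
    by rewrite /a (sum_realZ _ _ (quadD p) (quadZ p)); apply: eq_bigr => k _; rewrite bq.
  apply: (real_rfree bo); rewrite -/a.
  have : (-2) *: a = 0 by rewrite -[RHS]h dE aq; vring.
  by move/eqP; rewrite scaler_eq0 oppr_eq0 pnatr_eq0 /= => /eqP.
exists O, F; split=> // v h1 h2.
have re u k : complex.Re (tf (tripotent_defect_diff p u) (cj (b k))) = - 2 * complex.Re (tf u (cj (b k))).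
  rewrite dE (tfDl (- u) (- quad p u)) (tfNl u) (tfNl (quad p u)) quad_adj bq ReD !ReN.
  by rewrite (Re_tf_sym (b k) u); ring.
have z u k : (forall i, 'd (F i) (realify p) (realify u) = 0) -> complex.Re (tf u (cj (b k))) = 0.
  move=> hu; have := hu k; rewrite dF re => /eqP; rewrite mulf_eq0 oppr_eq0 pnatr_eq0 /=.
  by move/eqP.
rewrite (bE v) big1 // => k _; rewrite (_ : tf v (cj (b k)) = 0) ?scale0r //.
apply: Re_Im_eq0; first exact: z.
by rewrite -tfZl; exact: z.
Qed.

Definition f1_diff x v : C := - (tf v (cj x) + tf x (cj v))
  + (tf (x ** v) (sharp (cj x)) + tf (sharp x) (cj x ** cj v))
  - (hdet x * (tf (sharp x) v)^* + (hdet x)^* * tf (sharp x) v).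

Lemma poly_funC_f1 : poly_funC (fun y : E => f1 (unreal y))
  (fun y z => f1_diff (unreal y) (unreal z)).
Proof.
have hx := @poly_funV_unreal R; have hc := poly_funV_cj hx; have hd := poly_funC_hdet hx.
apply: (poly_funC_eq (poly_funC_add (poly_funC_add (poly_funC_add (poly_funC_cst 1)
   (poly_funC_mul (poly_funC_cst (-1)) (poly_funC_tf hx hc)))
   (poly_funC_tf (poly_funV_sharp hx) (poly_funV_sharp hc)))
   (poly_funC_mul (poly_funC_cst (-1)) (poly_funC_mul hd (poly_funC_conj hd))))) => [y|y z].
  by rewrite f1E /s1 /s2 /s3; ring.
by rewrite /f1_diff; ring.
Qed.

(** The radial derivative of f1. On the first component it equals - 2 f2 < 0, so there f1 alone is a
    defining function. *)
Lemma df1_self x : f1_diff x x = 6 * f1 x - 2 * f2 x.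
Proof.
rewrite /f1_diff !crossxx !tfZl !tfZr tf_sharp f1E f2E /s1 /s2 /s3 rmorphM /= rmorph_nat; ring.
Qed.

Lemma boundary1_defining_functions p : boundary 1 p -> exists O (F : 'I_1 -> _),
  defining_functions (realify @` (boundary 1 : set V)) (realify p) O F /\
  forall i v, 'd (F i) (realify p) (realify v) = complex.Re (f1_diff p v).
Proof.
move=> /boundary1P [p1 p2 p3].
have [pF _] := poly_funC_f1; pose F (i : 'I_1) (y : E) := complex.Re (f1 (unreal y)).
exists ([set y | 0 < complex.Re (f2 (unreal y))] `&` [set y | 0 < complex.Re (f3 (unreal y))]), F.
have dF i v : 'd (F i) (realify p) (realify v) = complex.Re (f1_diff p v).
  by rewrite (poly_fun_diffE _ _ pF) !realifyK.
split=> //; split.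
- split; first by apply: openI; apply: open_Re_gt0; [exact: polyC_f2|exact: polyC_f3].
  by rewrite /= realifyK; split; rewrite -lt0_Re ?conj_f2 ?conj_f3.
- by move=> i; apply: poly_fun_smooth pF.
- move=> c h i; have := h (realify p); rewrite big_ord1 dF df1_self p1 mulr0 sub0r ReN.
  have -> : complex.Re (2 * f2 p) = 2 * complex.Re (f2 p).
    by rewrite -[2 in LHS](rmorph_nat (real_complex R)) ReZ.
  move/eqP; rewrite mulf_eq0 oppr_eq0 mulf_eq0 pnatr_eq0 /= (ord1 i).
  have := p2; rewrite lt0_Re ?conj_f2 // => /lt0r_neq0 /negbTE ->.
  by rewrite orbF => /eqP.
- apply/seteqP; split=> y /=.
    by move=> [/realify_image /boundary1P [h1 h2 h3] [h4 h5]]; split=> // i; rewrite /F h1.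
  move=> [[h2 h3] h1]; split=> //; apply/realify_image/boundary1P.
  split; first by apply/(eq0_Re (conj_f1 _)); exact: (h1 0).
    by rewrite lt0_Re ?conj_f2.
  by rewrite lt0_Re ?conj_f3.
Qed.

Section DiscDefining.
Variables (e w : V) (t : C).
Hypotheses (Ee : E2 e) (se : sharp e = cj w) (r1 : t * t^* < 1).
Local Notation p := (e + t *: w).

Let Ew : E1 w. Proof. by have [h _ _ _ _] := E2_facts Ee; rewrite se cjK in h. Qed.

(** On V_2^+(e) the conjugation J is u -> (e|u) e - u with real coefficient, so it preserves
    V_2^+(e). *)
Lemma E2_V2p_conj u : quad e u = u ->
  quad e (peirce0_conj w u) = peirce0_conj w u /\ peirce0_conj w (peirce0_conj w u) = u.
Proof.
move=> hu; have uW := E2_V2p_mem Ee se hu.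
have [_ _ we _ _] := E2_facts Ee; rewrite se cjK in we.
have Je : peirce0_conj w e = e by rewrite /peirce0_conj we cjK.
have ee : tf e (cj e) = 2 by case/E2P: Ee.
have qe : quad e e = e by rewrite (E2_quad se) ee Je; vring.
have br : (tf e (cj u))^* = tf e (cj u) by exact: (E2_V2p_real Ee se qe hu).
have hE : peirce0_conj w u = tf e (cj u) *: e - u.
  by rewrite -{3}hu (E2_quad se); vring.
by split; [rewrite hE quadD quadN quadZ qe br hu | exact: (peirce0_conjK Ew uW)].
Qed.

Lemma E2_V2p_perp (b : 'I_10 -> V) v :
  (forall i, quad e (b i) = b i) ->
  (forall v, v \in peirce triple 0 w -> v = \sum_i tf v (cj (b i)) *: b i) ->
  (forall i, complex.Re (tf v (cj (b i))) = 0) ->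
  forall u, quad e u = u -> complex.Re (tf v (cj u)) = 0.
Proof.
move=> bq bE h u hu; have uW := E2_V2p_mem Ee se hu.
rewrite Re_tf_sym (bE u uW) tf_suml Re_sum big1 // => k _.
by rewrite tfZl (real_Re (E2_V2p_real Ee se hu (bq k))) ReZ (Re_tf_sym (b k) v) h mulr0.
Qed.

Lemma boundary2_defining_functions (b : 'I_10 -> V) :
  (forall i, quad e (b i) = b i) ->
  (forall i j, tf (b i) (cj (b j)) = (i == j)%:R) ->
  (forall v, v \in peirce triple 0 w -> v = \sum_i tf v (cj (b i)) *: b i) ->
  exists O (F : 'I_10 -> _),
  defining_functions (realify @` (boundary 2 : set V)) (realify p) O F /\
  forall v, (forall i, 'd (F i) (realify p) (realify v) = 0) <->
    (forall i, complex.Re (tf v (cj (b i))) = 0).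
Proof.
move=> bq bo bE.
pose J := peirce0_conj w.
pose r : R := complex.Re (t * t^* ).
have rE : t * t^* = r%:C by apply: real_Re; rewrite conj_Creal // ger0_real // mul_conjC_ge0.
have r10 : 1 - r != 0.
  by move: r1; rewrite rE -[1]/(1%:C) ltcR subr_eq0 => h; rewrite gt_eqF.
have dE v u : quad e u = u ->
    complex.Re (tf (gap_diff p v) (cj u)) = - (1 - r) * (2 * complex.Re (tf v (cj (J u)))).
  move=> hu; rewrite (disc_gap_diff Ee se t v hu) rE.
  have -> : - (1 - r%:C) = (- (1 - r))%:C :> C by rewrite rmorphN rmorphB /= rmorph1.
  by rewrite ReZ ReD cplx_ReJ; ring.
(* Zeros of [gap] satisfy f2 = 3 f1 and f1 (6 f1 - 2 f3) = 0. The second inequality discards the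
   branch f3 = 3 f1, which contains for instance x = 0. *)
pose U := [set x : V | 0 < complex.Re (f3 x) /\ 0 < complex.Re (f3 x - 3 * f1 x)].
have p2 : boundary 2 p by exact: disc_boundary2.
have [p21 p22 p23] := proj1 (boundary2P p) p2.
have Re3 (a : C) : complex.Re (3 * a) = 3 * complex.Re a.
  by rewrite -[3 in LHS](rmorph_nat (real_complex R)) ReZ.
have [||||||||||||||O [F [h dF]]] := @syzygy_defining_functions R (boundary 2) U p 10 b
   (@gap R) (@gap_diff R) (@sk R) (@gap_syzygy R); last first.
- exists O, F; split=> // v; split=> hv.
    have h1 i : complex.Re (tf v (cj (J (b i)))) = 0.
      have := hv i; rewrite dF dE // => /eqP; rewrite mulf_eq0 oppr_eq0 (negbTE r10) /=.
      by rewrite mulf_eq0 pnatr_eq0 /= => /eqP.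
    move=> i; have [Jq JJ] := E2_V2p_conj (bq i).
    have JW := E2_V2p_mem Ee se Jq.
    rewrite -JJ (bE _ JW).
    rewrite (eq_bigr (fun k => (complex.Re (tf (peirce0_conj w (b i)) (cj (b k))))%:C *: b k)) => [|k _].
      rewrite (sum_realZ _ _ (peirce0_conjD w) (peirce0_conjZ w)) Re_tf_sym tf_suml Re_sum big1 // => k _.
      by rewrite tfZl ReZ (Re_tf_sym _ v) h1 mulr0.
    by rewrite -(real_Re (E2_V2p_real Ee se Jq (bq k))).
  move=> i; rewrite dF dE //.
  by rewrite (E2_V2p_perp bq bE hv) ?mulr0 //; case: (E2_V2p_conj (bq i)).
- move=> c hc; set a := \sum_k _ in hc.
  have aq : quad e a = a.
    by rewrite /a (sum_realZ _ _ (quadD e) (quadZ e)); apply: eq_bigr => k _; rewrite bq.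
  apply: (real_rfree bo); rewrite -/a.
  have [Jq JJ] := E2_V2p_conj aq.
  have Ja : J a = 0.
    apply: herm_eq0; apply/eq0_Re; first by rewrite tf_cjr.
    have := hc (J a); rewrite dE // => /eqP; rewrite mulf_eq0 oppr_eq0 (negbTE r10) /=.
    by rewrite mulf_eq0 pnatr_eq0 /= => /eqP.
  by rewrite -JJ -/(J a) Ja /J /peirce0_conj cross0r cj0.
- move=> v h1 h2 hv.
  have [a [tau [aW aq vE]]] := disc_sk_ker Ee se r1 h1.
  have a0 : a = 0.
    rewrite (bE a aW) big1 // => k _.
    have := hv k; rewrite vE tfDl tfZl -(tf_cjr (b k) w).
    rewrite (rank1_V0_orth0 Ew (E2_V2p_mem Ee se (bq k))) rmorph0 mulr0 addr0 => hk.
    rewrite (_ : tf a (cj (b k)) = 0) ?scale0r //.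
    by apply/(eq0_Re (E2_V2p_real Ee se aq (bq k))).
  move: h2; rewrite vE a0 add0r => /(disc_syz Ee se r1) ->.
  by rewrite scale0r.
- exact: syz_gap.
- exact: sk_gap.
- by move=> x s v; rewrite syzZ // conj_real.
- exact: syzD.
- by move=> x s v; rewrite skZ // conj_real.
- exact: skD.
- exact: polyC_syz.
- exact: polyV_sk.
- exact: poly_funV_gap.
- move=> x [h1 h2]; split; first exact: boundary2_gap.
  move=> g0.
  have e1 : f2 x = 3 * f1 x.
    have := gap_herm x; rewrite g0 tf0l => /esym h; rewrite f1E f2E.
    by apply/eqP; rewrite -subr_eq0; apply/eqP; rewrite -[RHS]h; ring.
  have e2 : f1 x * (6 * f1 x - 2 * f3 x) = 0.
    have := gap_gap x; rewrite g0 tf0l -f1E -f2E -f3E e1 => h.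
    by rewrite [RHS]h; ring.
  have f10 : f1 x = 0.
    move/eqP: e2; rewrite mulf_eq0 => /orP [/eqP //|/eqP h].
    have h' : f3 x - 3 * f1 x = 0.
      apply: (@mulfI _ (- 2)); first by rewrite oppr_eq0 pnatr_eq0.
      by rewrite mulr0 -[RHS]h; ring.
    by rewrite h' ltxx in h2.
  by apply/boundary2P; rewrite e1 f10 mulr0 lt0_Re // conj_f3.
- rewrite realify_imageE.
  have -> : [set y | U (unreal y)] = [set y | 0 < complex.Re (f3 (unreal y))]
     `&` [set y | 0 < complex.Re (f3 (unreal y) - 3 * f1 (unreal y))] by [].
  apply: openI; apply: open_Re_gt0; first exact: polyC_f3.
  apply: polyC_add; first exact: polyC_f3.
  by apply: polyC_opp; apply: polyC_mul; [exact: polyC_cst | exact: polyC_f1].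
- by rewrite /U /= p21 mulr0 subr0 -lt0_Re ?conj_f3.
Qed.

End DiscDefining.

End HigherSubmanifolds.

(** * Tangent spaces and CR structure *)

Section Tangents.
Context {R : realType}.
Local Notation C := R[i].
Local Notation V := (H3O R).
Local Notation n := (dim (H3O R)).
Local Notation E := 'rV[R]_(n + n).
Implicit Types (x u v e p w : V).

Lemma Re_tfZ (t : R) v u : complex.Re (tf (t%:C *: v) u) = t * complex.Re (tf v u).
Proof. by rewrite tfZl ReZ. Qed.

Lemma herm_eq0P v : complex.Re (tf v (cj v)) = 0 -> v = 0.
Proof. by move=> h; apply: herm_eq0; apply/(eq0_Re (tf_cjr v v)). Qed.

Lemma locally_closed_boundary1 : locally_closed (realify @` (boundary 1 : set V)).
Proof.
exists ([set y : E | 0 < complex.Re (f2 (unreal y))] `&` [set y | 0 < complex.Re (f3 (unreal y))]),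
  [set y | complex.Re (f1 (unreal y)) = 0]; split.
- by apply: openI; apply: open_Re_gt0; [exact: polyC_f2 | exact: polyC_f3].
- by apply: closed_Re_eq0; exact: polyC_f1.
- rewrite realify_imageE; apply/seteqP; split=> y /=.
    move=> /boundary1P [h1 h2 h3]; split; last by rewrite h1.
    by split; rewrite -lt0_Re ?conj_f2 ?conj_f3.
  move=> [[h2 h3] h1]; apply/boundary1P; split; first exact/(eq0_Re (conj_f1 _)).
    by rewrite lt0_Re ?conj_f2.
  by rewrite lt0_Re ?conj_f3.
Qed.

Lemma locally_closed_boundary2 : locally_closed (realify @` (boundary 2 : set V)).
Proof.
exists [set y | 0 < complex.Re (f3 (unreal y))],
  ([set y : E | complex.Re (f1 (unreal y)) = 0] `&` [set y | complex.Re (f2 (unreal y)) = 0]); split.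
- by apply: open_Re_gt0; exact: polyC_f3.
- by apply: closedI; apply: closed_Re_eq0; [exact: polyC_f1 | exact: polyC_f2].
- rewrite realify_imageE; apply/seteqP; split=> y /=.
    by move=> /boundary2P [h1 h2 h3]; rewrite h1 h2 -lt0_Re ?conj_f3.
  move=> [h3 [h1 h2]]; apply/boundary2P; split; [exact/(eq0_Re (conj_f1 _))|exact/(eq0_Re (conj_f2 _))|].
  by rewrite lt0_Re ?conj_f3.
Qed.

Lemma compact_boundary3 : compact (realify @` (boundary 3 : set V)).
Proof.
apply: bounded_closed_compact; last first.
  rewrite realify_imageE.
  have -> : [set y : E | boundary 3 (unreal y)] = [set y | complex.Re (f1 (unreal y)) = 0] `&`
     ([set y | complex.Re (f2 (unreal y)) = 0] `&` [set y | complex.Re (f3 (unreal y)) = 0]).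
    apply/seteqP; split=> y /=; first by move=> /boundary3P [-> -> ->].
    move=> [h1 [h2 h3]]; apply/boundary3P.
    by split; [exact/(eq0_Re (conj_f1 _))|exact/(eq0_Re (conj_f2 _))|exact/(eq0_Re (conj_f3 _))].
  apply: closedI; [|apply: closedI]; apply: closed_Re_eq0;
    [exact: polyC_f1 | exact: polyC_f2 | exact: polyC_f3].
(* All weights are at least 1, so each coordinate has squared modulus at most (x|x) = 3; 2 is a
   convenient bound above sqrt 3. *)
have co3 x k : s1 x = 3 -> `|complex.Re (co k x)| <= 2 /\ `|complex.Im (co k x)| <= 2.
  move=> s; have h : co k x * (co k x)^* <= 3.
    rewrite -s /s1 tf_sumE (bigD1 k) //= co_cj.
    have h1 : co k x * (co k x)^* <= (weight k)%:R * (co k x * (co k x)^* ).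
      by apply: ler_peMl; [exact: mul_conjC_ge0 | rewrite (ler_nat _ 1); case: k].
    apply: (le_trans h1); rewrite lerDl; apply: sumr_ge0 => j _.
    by rewrite co_cj mulr_ge0 ?ler0n ?mul_conjC_ge0.
  move: h; rewrite -normCK -add_Re2_Im2 -(rmorph_nat (real_complex R)) lecR.
  move: (complex.Re _) (complex.Im _) => a b h.
  have sq (c : R) : c ^+ 2 <= 3 -> `|c| <= 2.
    by move=> hc; rewrite ler_norml; apply/andP; split; nra.
  by split; apply: sq; apply: le_trans h; rewrite ?lerDl ?lerDr sqr_ge0.
have expand x j : realify x 0 j = \sum_k (complex.Re (co k x) * realify (unit_vec R k) 0 j
     + complex.Im (co k x) * realify ('i *: unit_vec R k) 0 j).
  exact: realify_expand.
(* Summing over all j as well gives a single bound that serves every real coordinate. *)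
pose B := \sum_j \sum_k (2 * `|realify (unit_vec R k) 0 j| + 2 * `|realify ('i *: unit_vec R k) 0 j|).
have B0 : 0 <= B.
  by apply: sumr_ge0 => j _; apply: sumr_ge0 => k _; rewrite addr_ge0 // mulr_ge0.
exists B; split; first exact: num_real.
move=> M BM y /= [x /boundary3_E3 /E3_s [s _ _] <-].
apply: (le_trans _ (ltW BM)); rewrite [leLHS]/Num.norm /= mx_normrE.
apply/bigmax_leP; split=> // -[i j] _ /=; rewrite (ord1 i) expand.
apply: (le_trans (ler_norm_sum _ _ _)).
rewrite /B (bigD1 j) //= ler_wpDr //.
  by apply: sumr_ge0 => l _; apply: sumr_ge0 => k _; rewrite addr_ge0 // mulr_ge0.
apply: ler_sum => k _; apply: (le_trans (ler_normD _ _)); rewrite !normrM.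
have [h1 h2] := co3 x k s.
by apply: lerD; apply: ler_wpM2r.
Qed.

Lemma submanifold_E1 : submanifold 33 (E1 : set V).
Proof. by exists 21%N; split=> // p Ep; exact: E1_defining_functions. Qed.

Lemma submanifold_E2 : submanifold 42 (E2 : set V).
Proof. by exists 12%N; split=> // p Ep; exact: E2_defining_functions. Qed.

Lemma submanifold_boundary3 : submanifold 27 (boundary 3 : set V).
Proof.
have -> : boundary 3 = E3 :> set V by apply/seteqP; split=> x /boundary3_E3.
exists 27%N; split=> // p Ep.
by have [OO [F [h _]]] := E3_defining_functions Ep; exists OO, F.
Qed.

Lemma submanifold_boundary1 : submanifold_codim 1 (boundary 1 : set V).
Proof. by move=> p bp; have [OO [F [h _]]] := boundary1_defining_functions bp; exists OO, F. Qed.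

Lemma submanifold_boundary2 : submanifold 44 (boundary 2 : set V).
Proof.
exists 10%N; split=> // p bp; have [e [Ee pE]] := boundary2_decomp bp.
have se : sharp e = cj (cj (sharp e)) by rewrite cjK.
have [b [bW bq bo bE]] := E2_V2p_basis Ee se.
have r1 : hdet p * (hdet p)^* < 1 by have /boundary2_s [_ _] := bp.
have [OO [F [h _]]] := boundary2_defining_functions Ee se r1 bq bo bE.
by exists OO, F; rewrite pE.
Qed.

Lemma totally_real_boundary3 : totally_real (boundary 3 : set V).
Proof.
split; first by exists 27%N; exact: submanifold_boundary3.
have d3E : boundary 3 = E3 :> set V by apply/seteqP; split=> x /boundary3_E3.
rewrite d3E => p Ep; have [OO [F [h hF]]] := E3_defining_functions Ep.
eexists; split; first by exists 27%N, OO, F; split; [exact: h | reflexivity].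
split=> [v /=|W' hW].
  rewrite memv0 => /eqP -> i.
  have -> : realify (0 : V) = 0 by have := realifyZ 0 (0 : V); rewrite scaler0 scale0r.
  by rewrite linear0.
apply/subvP => v vW; rewrite memv0; apply/eqP; apply: hF => i; apply: hW => //=.
by rewrite rpredZ.
Qed.

Lemma peirce_indep w (tau : C) v1 v0 : E1 w -> v1 \in peirce triple 1 w ->
  v0 \in peirce triple 0 w -> tau *: w + v1 + v0 = 0 -> [/\ tau *: w = 0, v1 = 0 & v0 = 0].
Proof.
move=> Ew h1 h0 h; have /E1P [w1 _] := Ew.
have t0 : tau = 0.
  have := congr1 (fun z => tf z (cj w)) h.
  rewrite /= (tfDl (tau *: w + v1)) (tfDl (tau *: w)) tfZl w1 mulr1 (rank1_V0_orth0 Ew h0).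
  by rewrite (proj1 (proj1 (rank1_peirce1 Ew v1) h1)) !addr0 tf0l.
have v00 : v0 = 0.
  have := congr1 (fun z => cj w ** (w ** z)) h.
  rewrite /= t0 scale0r add0r !crossDr (proj1 (rank1_peirce0 Ew v0) h0).
  by rewrite (proj2 (proj1 (rank1_peirce1 Ew v1) h1)) add0r !cross0r.
by split=> //; [rewrite t0 scale0r | move: h; rewrite t0 v00 scale0r add0r addr0].
Qed.

Section RankOneTangent.
Variable e : V.
Hypothesis Ee : E1 e.
Let e1 : tf e (cj e) = 1. Proof. by case/E1P: Ee. Qed.
Let T1 := sum3 (imaginary (real_line e)) [set` peirce triple 1 e] [set` peirce triple 0 e].

Lemma E1_tangent_set : T1 = [set v | complex.Re (tf v (cj e)) = 0].
Proof.
apply/seteqP; split=> v.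
  move=> [_ [b [d [[_ [t _ <-] <-] hb hd ->]]]] /=.
  rewrite (tfDl ('i *: (t%:C *: e) + b)) (tfDl ('i *: (t%:C *: e))) !tfZl e1 mulr1.
  rewrite (rank1_V0_orth0 Ee hd) (proj1 (proj1 (rank1_peirce1 Ee b) hb)) !addr0.
  by rewrite ReM_i /= oppr0.
move=> /= h; have [a [v1 [aW vW vE]]] := rank1_decomp v Ee.
exists ('i *: ((complex.Im (tf v (cj e)))%:C *: e)), v1, a.
split; [|exact: vW|exact: aW|].
  exists ((complex.Im (tf v (cj e)))%:C *: e); last by [].
  by exists (complex.Im (tf v (cj e))).
rewrite {1}vE; have -> : tf v (cj e) = 'i * (complex.Im (tf v (cj e)))%:C.
  by rewrite {1}[tf v (cj e)]complexE h add0r.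
have -> : complex.Im ('i * (complex.Im (tf v (cj e)))%:C) = complex.Im (tf v (cj e)).
  by rewrite /= mul0r mul1r add0r.
by vring.
Qed.

Lemma E1_tangent : tangent_direction (boundary 1) e T1.
Proof.
have [OO [F [h dF]]] := boundary1_defining_functions (E1_boundary1 Ee).
exists 1%N, OO, F; split=> //; rewrite E1_tangent_set.
have dE v : complex.Re (f1_diff e v) = - 2 * complex.Re (tf v (cj e)).
  have e0 : sharp e = 0 by case/E1P: Ee.
  have d0 : hdet e = 0 by rewrite hdetE e0 tf0l mulr0.
  rewrite /f1_diff -cj_sharp e0 d0 cj0 tf0r !tf0l rmorph0 !mul0r !addr0 subr0 ReN ReD.
  by rewrite (Re_tf_sym e v); ring.
apply/seteqP; split=> v /= hv; first by move=> i; rewrite dF dE hv mulr0.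
have := hv 0; rewrite dF dE => /eqP; rewrite mulf_eq0 oppr_eq0 pnatr_eq0 /=.
by move/eqP.
Qed.

Lemma E1_direct :
  direct3 (imaginary (real_line e)) [set` peirce triple 1 e] [set` peirce triple 0 e].
Proof.
move=> _ b d [_ [t _ <-] <-] hb hd; rewrite scalerA => h.
exact: peirce_indep Ee hb hd h.
Qed.

Lemma E1_normal : normal_directions T1 = real_line e.
Proof.
rewrite E1_tangent_set; apply/seteqP; split=> v.
  move=> hv; have hv' u : complex.Re (tf u (cj e)) = 0 -> complex.Re (tf v (cj u)) = 0.
    by move=> hu; rewrite -hermE; exact: hv.
  have [a [v1 [aW vW vE]]] := rank1_decomp v Ee.
  move: vE; set tau := tf v (cj e) => vE.
  have ae := rank1_V0_orth0 Ee aW; have ve := proj1 (proj1 (rank1_peirce1 Ee v1) vW).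
  have av := rank1_V0_orth Ee aW vW.
  have ea : tf e (cj a) = 0 by rewrite -tf_cjr ae rmorph0.
  have ev : tf e (cj v1) = 0 by rewrite -tf_cjr ve rmorph0.
  have va : tf v1 (cj a) = 0 by rewrite -tf_cjr av rmorph0.
  have a0 : a = 0.
    apply: herm_eq0P; have := hv' a; rewrite ae => /(_ erefl); rewrite vE.
    by rewrite !tfDl tfZl va ea mulr0 !addr0.
  have v0 : v1 = 0.
    apply: herm_eq0P; have := hv' v1; rewrite ve => /(_ erefl); rewrite vE.
    by rewrite !tfDl tfZl av ev mulr0 addr0 add0r.
  have t0 : complex.Im tau = 0.
    have := hv' ('i *: e); rewrite tfZl e1 mulr1 => /(_ erefl).
    by rewrite Re_tf_i vE a0 v0 add0r add0r tfZl e1 mulr1.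
  exists (complex.Re tau) => //; rewrite [RHS]vE a0 v0 !add0r; congr (_ *: _).
  by rewrite [RHS]complexE t0 mulr0 addr0.
move=> [t _ <-] u /= hu.
by rewrite hermE Re_tfZ Re_tf_sym hu mulr0.
Qed.

End RankOneTangent.

End Tangents.

(** * Tangent and normal directions at a rank 2 tripotent *)

Section RankTwoTangent.
Context {R : realType}.
Local Notation C := R[i].
Local Notation V := (H3O R).
Implicit Types (x u v : V).

(** D(w, w) is positive: it has eigenvalues 0, 1, 2 on orthogonal Peirce spaces. *)
Lemma rank1_triple_ge0 w v : E1 w -> 0 <= tf (triple w w v) (cj v).
Proof.
move=> Ew; have [a [v1 [aW vW vE]]] := rank1_decomp v Ew.
have /E1P [w1 _] := Ew.
move: vE; set t := tf v (cj w) => vE.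
have aw := rank1_V0_orth0 Ew aW; have vw := proj1 (proj1 (rank1_peirce1 Ew v1) vW).
have av := rank1_V0_orth Ew aW vW.
have wa : tf w (cj a) = 0 by rewrite -tf_cjr aw rmorph0.
have wv : tf w (cj v1) = 0 by rewrite -tf_cjr vw rmorph0.
have va : tf v1 (cj a) = 0 by rewrite -tf_cjr av rmorph0.
have wW : triple w w w = 2 *: w := E1_tripotent Ew.
have -> : triple w w v = v1 + (2 * t) *: w.
  move/peirceP: aW; move/peirceP: vW; rewrite scale1r scale0r => h1 h0.
  rewrite vE (tripleDr w w (a + v1)) (tripleDr w w a) (tripleZr t w w w) h0 h1 wW.
  rewrite add0r scalerA (mulrC t 2); reflexivity.
have vv : tf v1 (cj v) = tf v1 (cj v1).
  by rewrite vE !cjD cjZ !tfDr tfZr va vw mulr0 add0r addr0.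
have wv' : tf w (cj v) = t^* by rewrite vE !cjD cjZ !tfDr tfZr wa wv w1 mulr1 !add0r.
rewrite (tfDl v1) tfZl vv wv' -mulrA.
by rewrite addr_ge0 ?herm_ge0 // mulr_ge0 ?ler0n ?mul_conjC_ge0.
Qed.

Lemma rank1_peirce2_line w v : E1 w -> v \in peirce triple 2 w <-> exists t, v = t *: w.
Proof.
move=> Ew; have /E1P [w1 _] := Ew.
split=> [/(rank1_peirce2 Ew) ->|[t ->]]; first by exists (tf v (cj w)).
by apply/(rank1_peirce2 Ew); rewrite tfZl w1 mulr1.
Qed.

Variables e w : V.
Hypotheses (Ee : E2 e) (se : sharp e = cj w).
Let Ew : E1 w. Proof. by have [] := E2_facts Ee; rewrite se cjK. Qed.
Let P1 : peirce triple 1 e = peirce triple 1 w.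
Proof. exact: (E2_peirce Ee se (j := 1)). Qed.
Let P0 : peirce triple 0 e = peirce triple 2 w.
Proof. exact: (E2_peirce Ee se (j := 0)). Qed.
Let T2 := sum3 (imaginary (peirce2_plus triple e)) [set` peirce triple 1 e] [set` peirce triple 0 e].

Lemma E2_quad_fixed (a : V) : a \in peirce triple 0 w ->
  quad e (a + quad e a) = a + quad e a.
Proof. by move=> aW; rewrite quadD (E2_quadK Ee se aW) addrC. Qed.

(** Q(e) is isometric on V_0(w), so the squared norm of a + Q(e)a is twice Re (a | a + Q(e)a). *)
Lemma E2_quad_anti (a : V) : a \in peirce triple 0 w ->
  complex.Re (tf a (cj (a + quad e a))) = 0 -> quad e a = - a.
Proof.
move=> aW; have : tf (quad e a) (cj (quad e a)) = tf a (cj a).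
  by rewrite (E2_quad_isom Ee se aW aW) tf_cjr.
move: (quad e a) => u uu h.
suff : a + u = 0 by move/eqP; rewrite addrC addr_eq0 => /eqP.
apply: herm_eq0P; move: h; rewrite cjD !tfDl !tfDr !ReD uu (Re_tf_sym u a) => h.
by rewrite [complex.Re (tf a (cj u)) + _]addrC h add0r.
Qed.

Lemma E2_imaginaryP (a : V) : a \in peirce triple 0 w -> quad e a = - a ->
  imaginary (peirce2_plus triple e) a.
Proof.
move=> aW h; exists (- 'i *: a).
  apply/(E2_V2p e); rewrite quadZ h rmorphN /= conj_i opprK scalerN scaleNr; reflexivity.
by rewrite scalerA mulrN mulCii opprK scale1r.
Qed.

(** The tangent direction is the real orthogonal of V_2^+(e), the form in which it can be compared
    with the differentials of the defining functions. *)
Lemma E2_tangent_set : T2 = [set v | forall u, quad e u = u -> complex.Re (tf v (cj u)) = 0].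
Proof.
apply/seteqP; split=> v.
  move=> [_ [b [d [[u /E2_V2p uq <-] hb hd ->]]]] /= z hz.
  have zW := E2_V2p_mem Ee se hz.
  move: hb hd; rewrite /= P1 P0 => hb /(rank1_peirce2_line _ Ew) [t ->].
  rewrite (tfDl ('i *: u + b)) (tfDl ('i *: u)) !tfZl.
  have -> : tf b (cj z) = 0 by rewrite -tf_cjr (rank1_V0_orth Ew zW hb) rmorph0.
  have -> : tf w (cj z) = 0 by rewrite -tf_cjr (rank1_V0_orth0 Ew zW) rmorph0.
  by rewrite mulr0 !addr0 (real_Re (E2_V2p_real Ee se uq hz)) ReM_i /= oppr0.
move=> /= h; have [a [v1 [aW vW vE]]] := rank1_decomp v Ew.
exists a, v1, (tf v (cj w) *: w); split; [|by rewrite /= P1| |exact: vE].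
  apply: (E2_imaginaryP aW); apply: (E2_quad_anti aW).
  have sW := E2_V2p_mem Ee se (E2_quad_fixed aW).
  have := h _ (E2_quad_fixed aW); set s := a + quad e a in sW *.
  have va : tf v1 (cj s) = 0 by rewrite -tf_cjr (rank1_V0_orth Ew sW vW) rmorph0.
  have wa : tf w (cj s) = 0 by rewrite -tf_cjr (rank1_V0_orth0 Ew sW) rmorph0.
  by rewrite vE (tfDl (a + v1)) (tfDl a) tfZl va wa mulr0 !addr0.
by rewrite /= P0; apply/(rank1_peirce2_line _ Ew); exists (tf v (cj w)).
Qed.

Lemma E2_tangent_setP (b : 'I_10 -> V) v :
  (forall i, quad e (b i) = b i) ->
  (forall v, v \in peirce triple 0 w -> v = \sum_i tf v (cj (b i)) *: b i) ->
  T2 v <-> forall i, complex.Re (tf v (cj (b i))) = 0.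
Proof.
move=> bq bE; rewrite E2_tangent_set; split=> h; first by move=> i; apply: h.
exact: (E2_V2p_perp Ee se bq bE).
Qed.

Lemma E2_tangent : tangent_direction (boundary 2) e T2.
Proof.
have [b [bW bq bo bE]] := E2_V2p_basis Ee se.
have r0 : 0 * 0^* < 1 :> C by rewrite mul0r ltr01.
have [OO [F [h dF]]] := boundary2_defining_functions Ee se r0 bq bo bE.
exists 10%N, OO, F; move: h dF; rewrite scale0r addr0 => h dF; split; first exact: h.
by apply/seteqP; split=> v /= hv; [apply/dF; apply/(E2_tangent_setP v bq bE)|
  apply/(E2_tangent_setP v bq bE); apply/dF].
Qed.

Lemma E2_direct : direct3 (imaginary (peirce2_plus triple e))
  [set` peirce triple 1 e] [set` peirce triple 0 e].
Proof.
move=> _ b d [u /E2_V2p uq <-] /=; rewrite P1 P0 => hb /(rank1_peirce2_line _ Ew) [t ->].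
have uW : 'i *: u \in peirce triple 0 w by apply: rpredZ; exact: (E2_V2p_mem Ee se uq).
have -> : 'i *: u + b + t *: w = t *: w + b + 'i *: u by vring.
by move=> h; have [h1 h2 h3] := peirce_indep Ew hb uW h; split; [exact: h3 | exact: h2 | exact: h1].
Qed.

Lemma E2_normal : normal_directions T2 = peirce2_plus triple e.
Proof.
rewrite E2_tangent_set; apply/seteqP; split=> v; last first.
  by move=> /E2_V2p hv u /= hu; rewrite hermE Re_tf_sym; apply: hu.
move=> hv; have hv' u : (forall z, quad e z = z -> complex.Re (tf u (cj z)) = 0) ->
    complex.Re (tf v (cj u)) = 0.
  by move=> hu; rewrite -hermE; exact: hv.
have [a [v1 [aW vW vE]]] := rank1_decomp v Ew.
move: vE; set t := tf v (cj w) => vE.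
have aw := rank1_V0_orth0 Ew aW; have vw := proj1 (proj1 (rank1_peirce1 Ew v1) vW).
have av := rank1_V0_orth Ew aW vW.
have wv : tf w (cj v1) = 0 by rewrite -tf_cjr vw rmorph0.
have v0 : v1 = 0.
  apply: herm_eq0P; have := hv' v1; rewrite {1}vE.
  rewrite (tfDl (a + v1)) (tfDl a) tfZl av wv mulr0 add0r addr0; apply=> z hz.
  by rewrite -tf_cjr (rank1_V0_orth Ew (E2_V2p_mem Ee se hz) vW) rmorph0.
have wz z : quad e z = z -> tf w (cj z) = 0.
  by move=> hz; rewrite -tf_cjr (rank1_V0_orth0 Ew (E2_V2p_mem Ee se hz)) rmorph0.
have t0 : t = 0.
  have h1 : complex.Re t = 0 by rewrite /t; apply: (hv' w) => z hz; rewrite (wz z hz).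
  have h2 : complex.Im t = 0.
    rewrite /t -Re_tf_i; apply: (hv' ('i *: w)) => z hz.
    by rewrite tfZl (wz z hz) mulr0.
  by rewrite (complexE t) h1 h2 mulr0 addr0.
have va : v = a by rewrite vE v0 t0 scale0r !addr0.
apply/E2_V2p; rewrite va.
(* By antilinearity, Q(e)a = a is the same as Q(e)(i a) = - i a, so [E2_quad_anti] applies to i a
   once i a is seen to be orthogonal to the fixed vector [u]. *)
have iW : 'i *: a \in peirce triple 0 w by apply: rpredZ; exact: aW.
have := E2_quad_anti iW; rewrite quadZ conj_i scaleNr => /(_ _)/oppr_inj h.
apply: (scalerI (a := 'i)); first by rewrite neq0Ci.
apply: h; set u := 'i *: a + _.
have uq : quad e u = u by rewrite /u -scaleNr -conj_i -quadZ; exact: E2_quad_fixed.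
have h' : complex.Re (tf a (cj ('i *: u))) = 0.
  rewrite -va; apply: (hv' ('i *: u)) => z hz.
  by rewrite tfZl (real_Re (E2_V2p_real Ee se uq hz)) ReM_i /= oppr0.
have -> : tf ('i *: a) (cj u) = - tf a (cj ('i *: u)) by rewrite cjZ conj_i tfZr tfZl; ring.
by rewrite ReN h' oppr0.
Qed.

End RankTwoTangent.

(** * CR structure and affine discs of the second component *)

Section RankTwoBoundary.
Context {R : realType}.
Local Notation C := R[i].
Local Notation V := (H3O R).
Implicit Types (x u v : V).

Section Peirce.
Variables e w : V.
Hypotheses (Ee : E2 e) (se : sharp e = cj w).
Let Ew : E1 w. Proof. by have [] := E2_facts Ee; rewrite se cjK. Qed.
Let w1 : tf w (cj w) = 1. Proof. by case/E1P: Ew. Qed.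

Lemma E2_V2p_dim : is_real_dim (peirce2_plus triple e) 10.
Proof.
have [b [bW bq bo bE]] := E2_V2p_basis Ee se.
pose s := [tuple realify (b i) | i < 10].
have r0 : realify (0 : V) = 0 by have := realifyZ 0 (0 : V); rewrite scaler0 scale0r.
have rs (c : 'I_10 -> R) : realify (\sum_i (c i)%:C *: b i) = \sum_i c i *: s`_i.
  rewrite (big_morph realify (@realifyD R) r0); apply: eq_bigr => i _.
  by rewrite realifyZ -tnth_nth tnth_mktuple.
exists (span s); split; last first.
  apply/eqP; rewrite -[X in _ == X](size_tuple s); apply/freeP => c hc.
  apply: (real_rfree bo).
  by rewrite -[LHS]realifyK rs hc -r0 realifyK.
apply/seteqP; split=> y /=.
  move=> [v /E2_V2p hv <-]; rewrite (bE v (E2_V2p_mem Ee se hv)).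
  have -> : \sum_i tf v (cj (b i)) *: b i = \sum_i (complex.Re (tf v (cj (b i))))%:C *: b i.
    by apply: eq_bigr => i _; rewrite [in LHS](real_Re (E2_V2p_real Ee se hv (bq i))).
  rewrite rs; apply: memv_suml => i _; apply/memvZ/memv_span/mem_nth.
  by rewrite size_tuple.
move=> ys; exists (\sum_i (coord s i y)%:C *: b i); last by rewrite rs; exact/esym/coord_span.
apply/E2_V2p; rewrite (sum_realZ _ _ (quadD e) (quadZ e)).
by apply: eq_bigr => i _; rewrite bq.
Qed.

(** A complex subspace of the tangent direction contains i v with v, so real orthogonality to the b
    i becomes complex orthogonality and kills the V_0(w) part. The answer does not depend on t. *)
Lemma disc_tangent_complex (b : 'I_10 -> V) :
  (forall i, quad e (b i) = b i) ->
  (forall v, v \in peirce triple 0 w -> v = \sum_i tf v (cj (b i)) *: b i) ->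
  max_complex_subspace [set v | forall i, complex.Re (tf v (cj (b i))) = 0]
    (peirce triple 1 w + peirce triple 2 w).
Proof.
move=> bq bE; have bW i := E2_V2p_mem Ee se (bq i).
split=> [v /= /memv_addP [v1 h1 [v2 h2 ->]] i|W' hW].
  have [t ->] := proj1 (rank1_peirce2_line v2 Ew) h2.
  have -> : tf (v1 + t *: w) (cj (b i)) = 0; last by [].
  rewrite (tfDl v1) tfZl -tf_cjr (rank1_V0_orth Ew (bW i) h1).
  by rewrite -(tf_cjr (b i)) (rank1_V0_orth0 Ew (bW i)) !rmorph0 mulr0 addr0.
apply/subvP => v vW; have [a [v1 [aW v1W vE]]] := rank1_decomp v Ew.
have hv i : tf v (cj (b i)) = 0.
  have h1 : complex.Re (tf v (cj (b i))) = 0 by apply: (hW v).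
  have h2 : complex.Re (tf ('i *: v) (cj (b i))) = 0.
    by apply: (hW ('i *: v)); apply: memvZ.
  move: h2; rewrite tfZl ReM_i => /eqP; rewrite oppr_eq0 => /eqP h2.
  by rewrite (complexE (tf v _)) h1 h2 mulr0 addr0.
have a0 : a = 0.
  rewrite (bE a aW) big1 // => i _; have := hv i.
  rewrite vE (tfDl (a + v1)) (tfDl a) tfZl -(tf_cjr (b i) v1) (rank1_V0_orth Ew (bW i) v1W).
  rewrite -(tf_cjr (b i) w) (rank1_V0_orth0 Ew (bW i)) !rmorph0 mulr0 !addr0 => ->.
  by rewrite scale0r.
rewrite vE a0 add0r; apply: memv_add; first exact: v1W.
by apply/(rank1_peirce2_line _ Ew); exists (tf v (cj w)).
Qed.

Lemma disc_tangent_dim : \dim (peirce triple 1 w + peirce triple 2 w) = 17%N.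
Proof.
have h : (peirce triple 1 w :&: peirce triple 2 w = 0)%VS.
  apply/eqP; rewrite -subv0; apply/subvP => v /memv_capP [h1 h2].
  have [t vt] := proj1 (rank1_peirce2_line v Ew) h2.
  have := proj1 (proj1 (rank1_peirce1 Ew v) h1).
  by rewrite vt tfZl w1 mulr1 => ->; rewrite scale0r; exact: mem0v.
exact: (etrans (dimv_disjoint_sum h)
  (congr2 addn (dim_rank1_peirce1 Ew) (dim_rank1_peirce2 Ew))).
Qed.

End Peirce.

Lemma CR_boundary2 : CR_submanifold 17 10 (boundary 2 : set V).
Proof.
split; first exact: submanifold_boundary2.
move=> p bp; have [e [Ee pE]] := boundary2_decomp bp.
have se : sharp e = cj (cj (sharp e)) by rewrite cjK.
have [b [bW bq bo bE]] := E2_V2p_basis Ee se.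
have r1 : hdet p * (hdet p)^* < 1 by have /boundary2_s [_ _] := bp.
have [OO [F [h dF]]] := boundary2_defining_functions Ee se r1 bq bo bE.
exists [set v | forall i, complex.Re (tf v (cj (b i))) = 0].
eexists; split; [|exact: (disc_tangent_complex Ee se bq bE)|exact: (disc_tangent_dim Ee se)].
exists 10%N, OO, F; rewrite pE; split; first exact: h.
by apply/seteqP; split=> v /=; rewrite dF.
Qed.

Lemma nonneg_excess0 (a c : C) : 0 <= a -> 0 <= c -> 4 + 2 * a + c <= 4 -> a = 0 /\ c = 0.
Proof.
move=> ha hc; rewrite -addrA gerDl => hs; have s0 : 2 * a + c = 0.
  by apply/eqP; rewrite eq_le hs addr_ge0 // mulr_ge0 // ler0n.
move/eqP: s0; rewrite paddr_eq0 // ?mulr_ge0 ?ler0n // mulf_eq0 pnatr_eq0 /=.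
by move=> /andP [/eqP -> /eqP ->].
Qed.

Section Intersections.
Variables e : V.
Hypothesis Ee : E2 e.
Let w := cj (sharp e).
Let se : sharp e = cj w. Proof. by rewrite cjK. Qed.
Let Ew : E1 w. Proof. by have [] := E2_facts Ee. Qed.
Let w1 : tf w (cj w) = 1. Proof. by case/E1P: Ew. Qed.
Let ee : tf e (cj e) = 2. Proof. by case/E2P: Ee. Qed.
Let qe : quad e e = e.
Proof.
rewrite /quad ee; have [_ _ h1 h2 _] := E2_facts Ee.
by rewrite se -h1 h2; vring.
Qed.

Lemma boundary2_tangent_V0 : boundary 2 `&`
    translate e (sum3 (imaginary (peirce2_plus triple e)) [set` peirce triple 1 e] [set` peirce triple 0 e])
  `<=` translate e [set` peirce triple 0 e].
Proof.
move=> x [bx [_ [_ [v1 [d [[u /E2_V2p uq <-] hv hd ->]]]] xE]] /=.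
have [e' [Ee' x']] := boundary2_decomp bx.
have r1 : hdet x * (hdet x)^* < 1 by have /boundary2_s [_ _] := bx.
have se' : sharp e' = cj (cj (sharp e')) by rewrite cjK.
have [Ew' _ _ _ _] := E2_facts Ee'.
have le4 : tf (triple x x e) (cj e) <= 4.
  rewrite {1 2}x' (disc_triple Ee' se') (tfDl (2 *: e)) tfNl !tfZl ee.
  rewrite -natrM lerBlDr lerDl mulr_ge0 //; first by rewrite subr_ge0 ltW.
  exact: rank1_triple_ge0.
have sym : tf (triple x x e) (cj e) = tf (triple e e x) (cj x).
  by rewrite tripleC !triple_adj (tripleC x).
move: le4; rewrite sym => le4.
have eu : (tf e (cj u))^* = tf e (cj u) := E2_V2p_real Ee se qe uq.
have ue : tf u (cj e) = tf e (cj u) by rewrite -tf_cjr eu.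
have uW := E2_V2p_mem Ee se uq; have eW := E2_V2p_mem Ee se qe.
have P1 : peirce triple 1 e = peirce triple 1 w := E2_peirce Ee se (j := 1) isT.
have P0 : peirce triple 0 e = peirce triple 2 w := E2_peirce Ee se (j := 0) isT.
have vW : v1 \in peirce triple 1 w by rewrite -P1; exact: hv.
have dW : d \in peirce triple 2 w by rewrite -P0; exact: hd.
have [t dE] := proj1 (rank1_peirce2_line d Ew) dW.
pose y := e + 'i *: u.
have yW : y \in peirce triple 0 w by apply: rpredD; [exact: eW | apply: rpredZ; exact: uW].
have xE' : x = y + v1 + t *: w by rewrite -xE dE /y; vring.
have yw := rank1_V0_orth0 Ew yW; have vw := proj1 (proj1 (rank1_peirce1 Ew v1) vW).
have yv := rank1_V0_orth Ew yW vW.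
have vy : tf v1 (cj y) = 0 by rewrite -tf_cjr yv rmorph0.
have tw : triple w w w = 2 *: w := E1_tripotent Ew.
have tx : triple e e x = 2 *: y + v1.
  rewrite (E2_triple x Ee) -/w xE' (tripleDr w w (y + v1)) (tripleDr w w y) (tripleZr t w w w) tw.
  move/peirceP: vW; move/peirceP: yW; rewrite scale1r scale0r => -> ->; vring.
have yy : tf y (cj y) = 2 + tf u (cj u).
  rewrite /y cjD cjZ conj_i !tfDl !tfDr !tfZl !tfZr ue ee.
  by rewrite !mulNr !mulrN !mulrA mulCii; ring.
have h : tf (triple e e x) (cj x) = 4 + 2 * tf u (cj u) + tf v1 (cj v1).
  rewrite tx xE'; clearbody y.
  by rewrite !cjD cjZ !tfDl !tfZl !tfDr !tfZr yv vy yw vw yy; ring.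
have [u0 v0] : tf u (cj u) = 0 /\ tf v1 (cj v1) = 0.
  by move: le4; rewrite h; apply: nonneg_excess0; apply: herm_ge0.
exists d; first exact: hd.
by rewrite -xE (herm_eq0 u0) (herm_eq0 v0) scaler0 !add0r.
Qed.

Lemma boundary2_tangent : boundary 2 `&`
    translate e (sum3 (imaginary (peirce2_plus triple e)) [set` peirce triple 1 e] [set` peirce triple 0 e])
  = boundary 2 `&` translate e [set` peirce triple 0 e].
Proof.
apply/seteqP; split=> x.
  by move=> hx; split; [case: hx | exact: boundary2_tangent_V0].
move=> [bx [d hd xE]]; split; first exact: bx.
exists d; last exact: xE.
exists 0, 0, d; split; [|exact: mem0v|exact: hd|by rewrite !add0r].
exists 0; last by rewrite scaler0.
by apply/E2_V2p; have := quadZ e 0 e; rewrite !scale0r rmorph0 scale0r.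
Qed.

Lemma boundary2_V0 : boundary 2 `&` translate e [set` peirce triple 0 e] =
  translate e [set x | x \in peirce triple 0 e /\ h3_herm x x < 1].
Proof.
have hw t : h3_herm (t *: w) (t *: w) = t * t^*.
  by rewrite hermE cjZ tfZl tfZr w1 mulr1.
have P0 : peirce triple 0 e = peirce triple 2 w := E2_peirce Ee se (j := 0) isT.
apply/seteqP; split=> x.
  move=> [bx [d hd xE]]; exists d; last exact: xE.
  split; first exact: hd.
  move: hd; rewrite /= P0 => /(rank1_peirce2_line _ Ew) [t dE].
  move: bx; rewrite -xE dE hw => /boundary2_s [_ _].
  by rewrite /s3 (disc_hdet Ee se).
move=> [d [hd d1] xE]; split; last by exists d.
move: (hd); rewrite P0 => /(rank1_peirce2_line _ Ew) [t dE].
by rewrite -xE dE; apply: (disc_boundary2 Ee se); rewrite -hw -dE.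
Qed.

End Intersections.

End RankTwoBoundary.

(** * Generic minimal polynomials and symmetric domains *)

Section Sesquipolynomials.
Context {R : realType} {U : vectType R[i]}.
Local Notation C := R[i].

Lemma is_rank_uniq (tr : U -> U -> U -> U) (W : {vspace U}) r r' :
  is_rank tr W r -> is_rank tr W r' -> r = r'.
Proof.
move=> [[x [y [N [xW yW rE]]]] h] [[x' [y' [N' [xW' yW' rE']]]] h'].
by apply/eqP; rewrite eqn_leq -[X in (X <= _)%N]rE -[X in _ && (X <= _)%N]rE' h // h'.
Qed.

Lemma sesqui_eq (p q : U -> U -> C) : sesqui_polynomial p -> (forall x y, p x y = q x y) ->
  sesqui_polynomial q.
Proof. by move=> hp h; have -> : q = p by apply/funext => x; apply/funext => y. Qed.

Lemma sesqui_sum n (p : 'I_n -> U -> U -> C) : (forall i, sesqui_polynomial (p i)) ->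
  sesqui_polynomial (fun x y => \sum_i p i x y).
Proof.
elim: n p => [|n IH] p h.
  by apply: (sesqui_eq (SPconst 0)) => x y; rewrite big_ord0.
apply: (sesqui_eq (SPadd (h ord0) (IH _ (fun i => h (lift ord0 i))))) => x y.
by rewrite big_ord_recl.
Qed.

Lemma sesqui_lin (f : U -> C) : (forall a u v, f (a *: u + v) = a * f u + f v) ->
  sesqui_polynomial (fun x _ => f x).
Proof.
move=> fl; pose D := GRing.isLinear.Build C U C^o *:%R f fl.
pose T : {linear U -> C^o} := HB.pack f D.
by apply: (sesqui_eq (SPlin (linfun T))) => x y; rewrite lfunE.
Qed.

Lemma sesqui_conj (f : U -> C) : (forall a u v, f (a *: u + v) = a * f u + f v) ->
  sesqui_polynomial (fun _ y => (f y)^* ).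
Proof.
move=> fl; pose D := GRing.isLinear.Build C U C^o *:%R f fl.
pose T : {linear U -> C^o} := HB.pack f D.
by apply: (sesqui_eq (SPconj (linfun T))) => x y; rewrite lfunE.
Qed.

(** Sesquipolynomials are studied on lines x + k z with k natural: k is real, so conjugated
    variables are polynomial in k too, and restrictions live in the integral domain [{poly C}]. *)
Definition nat_poly (f : nat -> C) := exists p : {poly C}, forall k, f k = p.[k%:R].

Lemma nat_poly_lin (a b : C) : nat_poly (fun k => a + b * k%:R).
Proof. by exists (a%:P + b *: 'X) => k; rewrite !hornerE. Qed.

Lemma nat_poly_add f g : nat_poly f -> nat_poly g -> nat_poly (fun k => f k + g k).
Proof. by move=> [p hp] [q hq]; exists (p + q) => k; rewrite hornerD hp hq. Qed.

Lemma nat_poly_mul f g : nat_poly f -> nat_poly g -> nat_poly (fun k => f k * g k).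
Proof. by move=> [p hp] [q hq]; exists (p * q) => k; rewrite hornerM hp hq. Qed.

Lemma nat_poly_conj f : nat_poly f -> nat_poly (fun k => (f k)^* ).
Proof.
move=> [p hp]; exists (map_poly Num.conj p) => k; rewrite hp.
by rewrite -horner_map /= rmorph_nat.
Qed.

Lemma nat_poly_sesqui (p : U -> U -> C) (x z : U) : sesqui_polynomial p ->
  nat_poly (fun k => p (x + k%:R *: z) (x + k%:R *: z)).
Proof.
have lin (phi : 'Hom(U, C^o)) : nat_poly (fun k => phi (x + k%:R *: z)).
  have [q hq] := nat_poly_lin (phi x) (phi z).
  by exists q => k; rewrite -hq linearD linearZ /= mulrC.
elim=> [c|phi|phi|q r _ hq _ hr|q r _ hq _ hr].
- by exists c%:P => k; rewrite hornerC.
- exact: lin.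
- exact: nat_poly_conj.
- exact: nat_poly_add.
- exact: nat_poly_mul.
Qed.

Lemma nat_poly_eq0 (p : {poly C}) : (forall k : nat, p.[k%:R] = 0) -> p = 0.
Proof.
move=> h; apply/eqP; apply/contraT => p0.
have us : uniq [seq (k%:R : C) | k <- iota 0 (size p)].
  by rewrite map_inj_uniq ?iota_uniq // => i j /eqP; rewrite eqr_nat => /eqP.
have := max_poly_roots p0 _ us; rewrite size_map size_iota ltnn; apply.
by apply/allP => y /mapP [k _ ->]; rewrite rootE h.
Qed.

(** A factor that is nonzero at one point of the line cancels at all points, including those where
    it vanishes. *)
Lemma nat_poly_cancel f g k0 : nat_poly f -> nat_poly g -> g k0 != 0 ->
  (forall k, f k * g k = 0) -> forall k, f k = 0.
Proof.
move=> [p hp] [q hq] g0 h; have : p * q = 0.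
  by apply: nat_poly_eq0 => k; rewrite hornerM -hp -hq.
move/eqP; rewrite mulf_eq0 => /orP [/eqP p0 k|/eqP q0]; first by rewrite hp p0 horner0.
by move: g0; rewrite hq q0 horner0 eqxx.
Qed.

Lemma monic_deriv2 (p : {poly C}) : p \is monic -> size p = 3%N ->
  p^`N(0).[1] = 1 + p`_1 + p`_0 /\ p^`N(1).[1] = 2 + p`_1.
Proof.
move=> /monicP; rewrite lead_coefE => + sp; rewrite sp /= => p2.
have pE : p = 'X^2 + p`_1 *: 'X + (p`_0)%:P.
  apply/polyP => k; rewrite !(coefD, coefZ, coefXn, coefX, coefC).
  case: k => [|[|[|k]]] /=; rewrite ?mulr0 ?mulr1 ?add0r ?addr0 //.
  by apply: nth_default; rewrite sp.
move: pE; move: (p`_1) (p`_0) => a b ->.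
rewrite nderivn0 nderivn1 !derivD derivXn derivZ derivX derivC !hornerE.
by split; ring.
Qed.

End Sesquipolynomials.

(** * The unit disc of V_0(e) for e of rank 2 *)

Section RankTwoDisc.
Context {R : realType}.
Local Notation C := R[i].
Local Notation V := (H3O R).
Implicit Types (x y z : V).

Lemma sesqui_form x0 : sesqui_polynomial (fun x _ : V => tf x (cj x0)).
Proof. by apply: sesqui_lin => a u v; rewrite tfDl tfZl. Qed.

Lemma sesqui_form_conj x0 : sesqui_polynomial (fun _ y : V => (tf y (cj x0))^* ).
Proof. by apply: sesqui_conj => a u v; rewrite tfDl tfZl. Qed.

Variables e : V.
Hypothesis Ee : E2 e.
Let w := cj (sharp e).
Let se : sharp e = cj w. Proof. by rewrite cjK. Qed.
Let Ew : E1 w. Proof. by have [] := E2_facts Ee. Qed.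
Let w1 : tf w (cj w) = 1. Proof. by case/E1P: Ew. Qed.
Let P0 : peirce triple 0 e = peirce triple 2 w.
Proof. exact: (E2_peirce Ee se (j := 0) isT). Qed.

Lemma disc_jpow (s t : C) k : jpow triple (s *: w) (t *: w) k.+1 = ((s * t^* ) ^+ k * s) *: w.
Proof.
elim: k => [|k IH]; first by rewrite expr0 mul1r.
rewrite /jpow /= in IH *; rewrite IH tripleZl tripleZm tripleZr (E1_tripotent Ew) !scalerA.
by congr (_ *: _); rewrite exprS; field.
Qed.

Lemma disc_closed : triple_closed triple (peirce triple 0 e).
Proof.
rewrite P0 => x y z /(rank1_peirce2_line _ Ew) [a ->] /(rank1_peirce2_line _ Ew) [b ->].
move=> /(rank1_peirce2_line _ Ew) [c ->]; apply/(rank1_peirce2_line _ Ew).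
by rewrite tripleZl tripleZm tripleZr (E1_tripotent Ew) !scalerA; eexists; reflexivity.
Qed.

Lemma disc_rank : is_rank triple (peirce triple 0 e) 1.
Proof.
have wW : w \in peirce triple 2 w.
  by apply/(rank1_peirce2_line _ Ew); exists 1; rewrite scale1r.
split.
  exists w, w, 1%N; split; [by rewrite P0 | by rewrite P0 |].
  by rewrite /= span_seq1 dim_vline (E1_neq0 Ew).
move=> x y N; rewrite P0 => /(rank1_peirce2_line _ Ew) [s ->] /(rank1_peirce2_line _ Ew) [t ->].
rewrite -[X in (_ <= X)%N](dim_rank1_peirce2 Ew); apply: dimvS; apply/span_subvP => v /mapP [k].
rewrite mem_iota => /andP [k1 _] ->; rewrite -(prednK k1) disc_jpow.
by apply/(rank1_peirce2_line _ Ew); eexists; reflexivity.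
Qed.

Lemma disc_generic : generic_minimal_polynomial triple (peirce triple 0 e) 1
  (fun x y => 'X - (tf x (cj w) * (tf y (cj w))^* )%:P).
Proof.
split=> [[|[|k]]|x y|x y].
- apply: (sesqui_eq (SPmul (SPmul (SPconst (-1)) (sesqui_form w)) (sesqui_form_conj w))) => x y.
  rewrite coefB coefX coefC /= mulN1r mulNr sub0r; reflexivity.
- by apply: (sesqui_eq (SPconst 1)) => x y; rewrite coefB coefX coefC /= subr0.
- by apply: (sesqui_eq (SPconst 0)) => x y; rewrite coefB coefX coefC /= subr0.
- by split; [exact: monicXsubC | exact: size_XsubC].
rewrite P0 => /(rank1_peirce2_line _ Ew) [s ->] /(rank1_peirce2_line _ Ew) [t ->].
rewrite !big_ord_recr big_ord0 /= !disc_jpow !coefB !coefX !coefC /= !tfZl w1.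
by vring.
Qed.

Lemma disc_symmetric_domain : symmetric_domain triple (peirce triple 0 e) =
  [set x | x \in peirce triple 0 e /\ h3_herm x x < 1].
Proof.
have value (p : {poly C}) : p \is monic -> size p = 2%N -> p^`N(0).[1] = 1 + p`_0.
  move=> /monicP; rewrite lead_coefE => + sp; rewrite sp /= => p1.
  by rewrite nderivn0 (horner_coef_wide _ (leqnn _)) sp !big_ord_recr big_ord0 /= p1; ring.
apply/seteqP; split=> x [xW].
  move=> [r [m [hr [_ hm hs] hp]]]; split; first exact: xW.
  have r1 := is_rank_uniq hr disc_rank; move: hm hs hp; rewrite r1 => hm hs hp.
  have [mm ms] := hm x x.
  have := hp 0 isT; rewrite (value _ mm ms) => pos.
  have := hs x x xW xW; move: (xW); rewrite P0 => /(rank1_peirce2_line _ Ew) [t xE].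
  rewrite !big_ord_recr big_ord0 /= xE !disc_jpow -xE.
  have m1 : (m x x)`_1 = 1 by move/monicP: mm; rewrite lead_coefE ms.
  rewrite m1 scale1r add0r scalerA -scalerDl hermE xE cjZ tfZl tfZr w1 mulr1 => h0.
  (* At x = 0 the minimal polynomial relation says nothing about m, but there the norm bound is
     immediate. *)
  have [t0|t0] := eqVneq t 0; first by rewrite t0 mul0r ltr01.
  have := congr1 (fun z => tf z (cj w)) h0; rewrite /= tfZl tf0l w1 mulr1.
  rewrite expr0 expr1 mul1r -mulrDl => /eqP; rewrite mulf_eq0 (negbTE t0) orbF.
  by rewrite addr_eq0 => /eqP m0; move: pos; rewrite -xE in m0 *; rewrite m0 subr_gt0.
move=> x1; split; first exact: xW.
exists 1%N; eexists; split; [exact: disc_rank|exact: disc_generic|].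
case=> [|//] _; rewrite (value _ (monicXsubC _) (size_XsubC _)) coefB coefX coefC /= sub0r subr_gt0.
move: (xW); rewrite P0 => /(rank1_peirce2_line _ Ew) [t xE]; move: x1.
by rewrite hermE {1 2}xE cjZ tfZl tfZr xE tfZl w1 !mulr1.
Qed.

End RankTwoDisc.

(** * The spin factor V_0(e) for a minimal tripotent and the Lie ball *)

Section LieBall.
Context {R : realType}.
Local Notation C := R[i].
Local Notation V := (H3O R).
Implicit Types (x y z : V).

Variable e : V.
Hypothesis Ee : E1 e.
Variable b : 'I_10 -> V.
Hypothesis bW : forall i, b i \in peirce triple 0 e.
Hypothesis bJ : forall i, peirce0_conj e (b i) = b i.
Hypothesis bo : forall i j, tf (b i) (cj (b j)) = (i == j)%:R.
Hypothesis bE : forall v, v \in peirce triple 0 e -> v = \sum_i tf v (cj (b i)) *: b i.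
Local Notation J := (peirce0_conj e).

Let c i x := tf x (cj (b i)).
Let h x y := \sum_i c i x * (c i y)^*.
Let s x := \sum_i c i x ^+ 2.

Lemma frame_coord (f : 'I_10 -> C) i : c i (\sum_j f j *: b j) = f i.
Proof.
rewrite /c tf_suml (eq_bigr (fun j => f j * (j == i)%:R)); last by move=> j _; rewrite tfZl bo.
by rewrite (bigD1 i) //= eqxx mulr1 big1 ?addr0 // => j /negbTE ->; rewrite mulr0.
Qed.

Lemma frame_mem (f : 'I_10 -> C) : \sum_j f j *: b j \in peirce triple 0 e.
Proof. by apply: memv_suml => i _; apply: memvZ; exact: bW. Qed.

Lemma frame_herm x y : y \in peirce triple 0 e -> tf x (cj y) = h x y.
Proof.
move=> yW; rewrite {1}(bE yW) -tf_cjr tf_suml rmorph_sum; apply: eq_bigr => i _.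
rewrite tfZl rmorphM /= (tf_cjr (b i) x) mulrC; reflexivity.
Qed.

Lemma frame_conj x i : x \in peirce triple 0 e -> c i (J x) = (c i x)^*.
Proof. by move=> xW; rewrite /c -{1}bJ (peirce0_conj_isom Ee xW (bW i)). Qed.

Lemma frame_square x : x \in peirce triple 0 e -> tf x (cj (J x)) = s x.
Proof.
move=> xW; rewrite (frame_herm _ (peirce0_conj_mem Ee xW)); apply: eq_bigr => i _.
by rewrite (frame_conj i xW) conjCK expr2.
Qed.

Lemma frame_square_conj y : y \in peirce triple 0 e -> tf (J y) (cj y) = (s y)^*.
Proof. by move=> yW; rewrite -tf_cjr (frame_square yW). Qed.

Lemma quad_step x y : x \in peirce triple 0 e -> y \in peirce triple 0 e ->
  2^-1 *: triple x y x = h x y *: x - (2^-1 * s x) *: J y.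
Proof.
move=> xW yW; rewrite (peirce0_triple Ee xW yW xW) (frame_square xW) (frame_herm x yW).
by move: (h x y) (s x) (J y) => p q v; vpush; field.
Qed.

Lemma quad_step_conj x y : x \in peirce triple 0 e -> y \in peirce triple 0 e ->
  2^-1 *: triple x y (J y) = (2^-1 * (s y)^* ) *: x.
Proof.
move=> xW yW; have JW := peirce0_conj_mem Ee yW.
rewrite (peirce0_triple Ee xW yW JW) (peirce0_conjK Ee yW) (frame_square_conj yW).
by move: (tf x (cj y)) (s y) (J y) => p q v; vpush; field.
Qed.

Lemma frame_step x y p q : x \in peirce triple 0 e -> y \in peirce triple 0 e ->
  2^-1 *: triple x y (p *: x + q *: J y) =
  (p * h x y + q * (2^-1 * (s y)^* )) *: x + (- p * (2^-1 * s x)) *: J y.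
Proof.
move=> xW yW; rewrite (tripleDr x y (p *: x)) (tripleZr p x y x) (tripleZr q x y (J y)).
have h1 := quad_step xW yW; have h2 := quad_step_conj xW yW.
move: (triple x y x) (triple x y (J y)) h1 h2 => A B h1 h2.
have -> : 2^-1 *: (p *: A + q *: B) = p *: (2^-1 *: A) + q *: (2^-1 *: B) by vring.
rewrite h1 h2; clear h1 h2.
by move: (h x y) (s x) (s y) (J y) => a1 a2 a3 v; vring.
Qed.

Lemma frame_jpow x y k : x \in peirce triple 0 e -> y \in peirce triple 0 e ->
  exists p q, jpow triple x y k.+1 = p *: x + q *: J y.
Proof.
move=> xW yW; elim: k => [|k [p [q IH]]].
  by exists 1, 0; rewrite /jpow /= scale1r scale0r addr0.
move: IH; rewrite /jpow /= => ->; rewrite (frame_step p q xW yW).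
by eexists; eexists; reflexivity.
Qed.

Lemma frame_jpow2 x y : x \in peirce triple 0 e -> y \in peirce triple 0 e ->
  jpow triple x y 2 = h x y *: x - (2^-1 * s x) *: J y.
Proof. by move=> xW yW; rewrite -quad_step. Qed.

(** The minimal polynomial relation in degree 2: applying D(x, y)/2 to Jy gives back a multiple of
    x, which closes the recursion. *)
Lemma frame_jpow3 x y : x \in peirce triple 0 e -> y \in peirce triple 0 e ->
  jpow triple x y 3 = h x y *: jpow triple x y 2 - (2^-1 * s x * (2^-1 * s y)^* ) *: x.
Proof.
move=> xW yW; have -> : jpow triple x y 3 = 2^-1 *: triple x y (jpow triple x y 2) by [].
rewrite (frame_jpow2 xW yW).
have -> : h x y *: x - (2^-1 * s x) *: J y = h x y *: x + (- (2^-1 * s x)) *: J y.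
  by rewrite scaleNr.
rewrite (frame_step _ _ xW yW) rmorphM /= fmorphV rmorph_nat.
by move: (h x y) (s x) (s y) (J y) => a1 a2 a3 v; vring.
Qed.

(** All powers lie in the span of x and Jy. The bound 2 is reached at two distinct basis vectors,
    where (x|y) = 0 and the second power of x is - y/2. *)
Lemma frame_rank : is_rank triple (peirce triple 0 e) 2.
Proof.
pose i0 : 'I_10 := 0; pose i1 : 'I_10 := 1.
split; last first.
  move=> x y N xW yW; have sz : size [:: x; J y] = 2%N by [].
  rewrite -[X in (_ <= X)%N]sz; apply: leq_trans (dim_span [:: x; J y]).
  apply: dimvS; apply/span_subvP => v /mapP [k]; rewrite mem_iota => /andP [k1 _] ->.
  rewrite -(prednK k1); have [p [q ->]] := frame_jpow k.-1 xW yW.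
  by apply: memvD; apply/memvZ/memv_span; rewrite !inE eqxx ?orbT.
exists (b i0), (b i1), 2%N; split; [exact: bW|exact: bW|].
have ci i j : c i (b j) = (j == i)%:R by rewrite /c bo.
have h0 : h (b i0) (b i1) = 0.
  rewrite /h (bigD1 i0) //= !ci eqxx rmorph0 mulr0 add0r big1 // => j ji.
  by rewrite !ci (eq_sym i0) (negbTE ji) mul0r.
have s1 : s (b i0) = 1.
  rewrite /s (bigD1 i0) //= !ci eqxx expr1n big1 ?addr0 // => j ji.
  by rewrite !ci (eq_sym i0) (negbTE ji) expr0n.
have j2 : jpow triple (b i0) (b i1) 2 = (- 2^-1) *: b i1.
  by rewrite (frame_jpow2 (bW i0) (bW i1)) h0 s1 bJ mulr1 scale0r sub0r scaleNr.
have -> : [seq jpow triple (b i0) (b i1) k | k <- iota 1 2] = [:: b i0; (- 2^-1) *: b i1].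
  by rewrite -j2.
suff : free [tuple of [:: b i0; (- 2^-1) *: b i1]] by move/eqP.
apply/freeP => k.
rewrite !big_ord_recr big_ord0 /= add0r scalerA => hk.
have e0 := congr1 (c i0) hk; have e1 := congr1 (c i1) hk.
move: e0 e1; rewrite /c !tfDl !tfZl !bo !eqxx /= !tf0l !(mulr0, mulr1, add0r, addr0) => e0.
move=> /eqP; rewrite mulf_eq0 oppr_eq0 invr_eq0 pnatr_eq0 orbF => /eqP e1.
by case=> [[|[|//]] i2]; [rewrite -[RHS]e0 | rewrite -[RHS]e1]; congr (k _); apply: val_inj.
Qed.

Let m x y : {poly C} := 'X^2 - h x y *: 'X + (2^-1 * s x * (2^-1 * s y)^* )%:P.

Let mcoef x y k : (m x y)`_k = (k == 2)%:R - h x y * (k == 1)%:R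
  + (if k == 0 then 2^-1 * s x * (2^-1 * s y)^* else 0).
Proof. by rewrite /m coefD coefB coefZ coefXn coefX coefC. Qed.

Lemma sesqui_h : sesqui_polynomial h.
Proof. by apply: sesqui_sum => i; apply: SPmul; [exact: sesqui_form | exact: sesqui_form_conj]. Qed.

Lemma sesqui_s : sesqui_polynomial (fun x _ : V => s x).
Proof. by apply: sesqui_sum => i; apply: SPmul; exact: sesqui_form. Qed.

Lemma sesqui_s_conj : sesqui_polynomial (fun _ y : V => (s y)^* ).
Proof.
apply: (sesqui_eq (p := fun _ y => \sum_i (c i y)^* * (c i y)^* )).
  by apply: sesqui_sum => i; apply: SPmul; exact: sesqui_form_conj.
by move=> x y; rewrite /s rmorph_sum; apply: eq_bigr => i _; rewrite expr2 rmorphM.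
Qed.

Let q0 x y := 2^-1 * s x * (2^-1 * s y)^*.
Lemma sesqui_q0 : sesqui_polynomial q0.
Proof.
apply: (sesqui_eq (SPmul (SPconst (2^-1 * 2^-1)) (SPmul sesqui_s sesqui_s_conj))) => x y.
rewrite /q0 rmorphM /= fmorphV rmorph_nat.
by move: (s x) ((s y)^* ) => p q; rewrite mulrACA.
Qed.

Lemma frame_generic : generic_minimal_polynomial triple (peirce triple 0 e) 2 m.
Proof.
have sm x y : size (m x y) = 3%N.
  rewrite /m -addrA size_polyDl size_polyXn // ltnS.
  by apply/leq_sizeP => [] [|[|j]] // _; rewrite coefD coefN coefZ coefX coefC /= mulr0 oppr0 addr0.
split=> [[|[|[|k]]]|x y|x y xW yW].
- by apply: (sesqui_eq sesqui_q0) => x y; rewrite mcoef /= mulr0 subr0 add0r.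
- apply: (sesqui_eq (SPmul (SPconst (-1)) sesqui_h)) => x y.
  by rewrite mcoef /= mulr1 addr0 sub0r mulN1r.
- by apply: (sesqui_eq (SPconst 1)) => x y; rewrite mcoef /= mulr0 subr0 addr0.
- by apply: (sesqui_eq (SPconst 0)) => x y; rewrite mcoef /= mulr0 subr0 addr0.
- split; last exact: sm.
  by apply/monicP; rewrite lead_coefE sm mcoef /= mulr0 subr0 addr0.
rewrite !big_ord_recr big_ord0 /= !mcoef /= (frame_jpow3 xW yW).
have -> : jpow triple x y 1 = x by [].
by move: (h x y) (s x) (s y) (jpow triple x y 2) => a1 a2 a3 v; vring.
Qed.

(** For a quadratic polynomial the second difference is twice the leading coefficient, so
    nonvanishing somewhere on a line can be read from the direction z alone. *)
Lemma second_difference_neq0 (f : nat -> C) : f 0 - 2 * f 1 + f 2 != 0 -> exists k, f k != 0.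
Proof.
move=> d; apply: contrapT => hn; have hf k : f k = 0.
  by apply: contrapT => /eqP hk; apply: hn; exists k.
by move: d; rewrite !hf mulr0 subr0 addr0 eqxx.
Qed.

(* Where x and x^(2) are dependent the minimal polynomial is not determined by x
   alone. It is on the line x + k z for all but finitely many k, and its
   coefficients are polynomials in k. *)
Lemma frame_generic_uniq m' x : generic_minimal_polynomial triple (peirce triple 0 e) 2 m' ->
  x \in peirce triple 0 e -> (m' x x)`_1 = - h x x /\ (m' x x)`_0 = q0 x x.
Proof.
move=> [hs hm hj] xW.
pose i0 : 'I_10 := 0; pose i1 : 'I_10 := 1.
(* The direction z = 2 b0 + i b1 is chosen so that three polynomials in k are nonzero for every x: D
   and s have second differences 8 i and 2 (4 - 1) = 6, and the coordinate c i0 has slope 2. *)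
pose f (j : 'I_10) : C := if j == i0 then 2 else if j == i1 then 'i else 0.
pose z := \sum_j f j *: b j.
have cz i : c i z = f i by exact: frame_coord.
pose y (k : nat) := x + k%:R *: z.
have yW k : y k \in peirce triple 0 e.
  by apply: memvD; [exact: xW | apply: memvZ; exact: frame_mem].
have cy i k : c i (y k) = c i x + f i * k%:R.
  by rewrite -cz /c /y tfDl tfZl mulrC.
have y0 : y 0 = x by rewrite /y scale0r addr0.
have u0P : nat_poly (fun k => c i0 (y k)) := nat_poly_sesqui x z (sesqui_form (b i0)).
have u1P : nat_poly (fun k => c i1 (y k)) := nat_poly_sesqui x z (sesqui_form (b i1)).
have sP : nat_poly (fun k => s (y k)) := nat_poly_sesqui x z sesqui_s.
(* A and B are the errors of the two coefficients of m' against the expected ones. *)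
pose A k := (m' (y k) (y k))`_1 + h (y k) (y k).
pose B k := (m' (y k) (y k))`_0 + -1 * q0 (y k) (y k).
have AP : nat_poly A := nat_poly_sesqui x z (SPadd (hs 1) sesqui_h).
have BP : nat_poly B := nat_poly_sesqui x z (SPadd (hs 0) (SPmul (SPconst (-1)) sesqui_q0)).
(* D is the minor of v and Jv in the coordinates i0, i1; where it is nonzero the two vectors are
   independent. *)
pose D k := (c i0 (y k))^* * c i1 (y k) + -1 * ((c i1 (y k))^* * c i0 (y k)).
have DP : nat_poly D.
  apply: nat_poly_add; first by apply: nat_poly_mul; [exact: nat_poly_conj | exact: u1P].
  apply: nat_poly_mul; first by have := nat_poly_lin (-1 : C) 0; under eq_fun do rewrite mul0r addr0.
  by apply: nat_poly_mul; [exact: nat_poly_conj | exact: u0P].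
(* Subtracting the known relation leaves B v + A v^(2) = 0; replacing v^(2) by h v - (s/2) Jv and
   reading coordinate i gives this equation. *)
have rel k i : (B k + A k * h (y k) (y k)) * c i (y k) = A k * (2^-1 * s (y k)) * (c i (y k))^*.
  rewrite /A /B; move: (y k) (yW k) => v vW.
  have := hj _ _ vW vW; rewrite !big_ord_recr big_ord0 /=.
  have -> : (m' v v)`_2 = 1 by have [/monicP + ms] := hm v v; rewrite lead_coefE ms.
  rewrite (frame_jpow3 vW vW) (frame_jpow2 vW vW).
  have -> : jpow triple v v 1 = v by [].
  move/(congr1 (c i)); rewrite -(frame_conj i vW) /q0 /c.
  move: (J v) => u; rewrite !(tfDl, tfNl, tfZl, tf0l).
  move: (tf u _) (tf v _) ((m' v v)`_0) ((m' v v)`_1) (h v v) => t1 t2 a1 a2 a3.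
  move: (s v) ((2^-1 * s v)^* ) => a4 a5 hk.
  by apply/eqP; rewrite -subr_eq0 -[X in _ == X]hk; apply/eqP; ring.
have ASD k : (A k * s (y k)) * D k = 0.
  have r0 := rel k i0; have r1 := rel k i1; rewrite /D.
  move: r0 r1; move: (B k + A k * h (y k) (y k)) (c i0 (y k)) (c i1 (y k)) (A k) (s (y k)).
  move=> p u v a t r0 r1.
  have -> : a * t * (u^* * v + -1 * (v^* * u)) =
    2 * (a * (2^-1 * t) * u^* * v - a * (2^-1 * t) * v^* * u) by field.
  by rewrite -r0 -r1; ring.
have cy0 k : c i0 (y k) = c i0 x + 2 * k%:R by rewrite cy /f eqxx.
have cy1 k : c i1 (y k) = c i1 x + 'i * k%:R by rewrite cy /f eqxx.
have dE k : D k = (c i0 x + 2 * k%:R)^* * (c i1 x + 'i * k%:R)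
    + -1 * ((c i1 x + 'i * k%:R)^* * (c i0 x + 2 * k%:R)).
  by rewrite /D cy0 cy1.
have [kD D0] : exists k, D k != 0.
  apply: second_difference_neq0; rewrite !dE; move: (c i0 x) (c i1 x) => u v.
  rewrite !(rmorphD, rmorphM) /= !rmorph_nat conj_i.
  move: (u^* ) (v^* ) => u' v'; rewrite (_ : _ - _ + _ = 8 * 'i); last by ring.
  by rewrite mulf_neq0 ?pnatr_eq0 ?neq0Ci.
have sdg (u a p q r : C) : p = u + a * 0%:R -> q = u + a * 1%:R -> r = u + a * 2%:R ->
    p ^+ 2 - 2 * q ^+ 2 + r ^+ 2 = 2 * a ^+ 2.
  by move=> -> -> ->; ring.
have sd i := sdg _ _ _ _ _ (cy i 0%N) (cy i 1%N) (cy i 2%N).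
have [ks s0] : exists k, s (y k) != 0.
  apply: second_difference_neq0; rewrite /s mulr_sumr -sumrB -big_split /=.
  rewrite (eq_bigr (fun i => 2 * f i ^+ 2)); last by move=> i _; exact: sd.
  rewrite (bigD1 i0) // (bigD1 i1) //= big1 => [|j /andP [/negbTE j0 /negbTE j1]].
    by rewrite /f !eqxx /= addr0 sqrCi (_ : _ + _ = 6) ?pnatr_eq0 //; ring.
  by rewrite /f j0 j1 expr0n mulr0.
have AS k : A k * s (y k) = 0 by apply: (nat_poly_cancel (nat_poly_mul AP sP) DP D0 ASD).
have A0 := nat_poly_cancel AP sP s0 AS.
have Bu k : B k * c i0 (y k) = 0 by have := rel k i0; rewrite !A0 !mul0r addr0.
have [ku u0] : exists k, c i0 (y k) != 0.
  have [u0|u0] := eqVneq (c i0 x) 0; last by exists 0%N; rewrite y0; exact: u0.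
  by exists 1%N; have := cy0 1%N; rewrite u0 mulr1 add0r => ->; rewrite pnatr_eq0.
have B0 := nat_poly_cancel BP u0P u0 Bu.
have := A0 0%N; have := B0 0%N; rewrite /A /B y0 mulN1r => /eqP.
rewrite subr_eq0 => /eqP -> /eqP; rewrite addr_eq0 => /eqP ->.
by [].
Qed.

Lemma frame_domain : symmetric_domain triple (peirce triple 0 e) =
  [set x | x \in peirce triple 0 e /\ (0 < 1 - h x x + q0 x x /\ h x x < 2)].
Proof.
apply/seteqP; split=> x [xW].
  move=> [r [m' [hr hg hp]]]; split; first exact: xW.
  have r2 := is_rank_uniq hr frame_rank; move: hg hp; rewrite r2 => hg hp.
  have [h1 h2] := frame_generic_uniq hg xW; have [_ hm _] := hg.
  have [mm ms] := hm x x; have [d0 d1] := monic_deriv2 mm ms.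
  have := hp 0%N isT; have := hp 1%N isT; rewrite d0 d1 h1 h2 subr_gt0 => p1 p0.
  by split; [exact: p0 | exact: p1].
move=> [p0 p1]; split; first exact: xW.
exists 2%N, m; split; [exact: frame_rank|exact: frame_generic|].
have [_ hm _] := frame_generic; have [mm ms] := hm x x; have [d0 d1] := monic_deriv2 mm ms.
have m0 : (m x x)`_0 = q0 x x by rewrite mcoef /= mulr0 subr0 add0r.
have m1 : (m x x)`_1 = - h x x by rewrite mcoef /= mulr1 addr0 sub0r.
case=> [|[|//]] _; first by rewrite d0 m0 m1.
by rewrite d1 m1 subr_gt0.
Qed.

(** The scale a is 1 for the isomorphism of triple systems, which must be isometric, and sqrt 2 for
    the domains. *)
Let F (a : C) (z : 'rV[C]_10) : V := \sum_i (a * z 0 i) *: b i.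

Lemma frame_map_linear a : linear (F a).
Proof.
move=> t u v; rewrite /F scaler_sumr -big_split /=; apply: eq_bigr => i _.
by rewrite !mxE; vring.
Qed.

Definition frame_map a : 'Hom('rV[C]_10, V) :=
  linfun (HB.pack (F a) (GRing.isLinear.Build C _ _ _ (F a) (frame_map_linear a))
    : {linear 'rV[C]_10 -> V}).

Lemma frame_mapE a (z : 'rV[C]_10) : frame_map a z = F a z.
Proof. by rewrite lfunE. Qed.

Lemma frame_map_coord a (z : 'rV[C]_10) i : c i (frame_map a z) = a * z 0 i.
Proof. by rewrite frame_mapE frame_coord. Qed.

Lemma frame_map_mem a (z : 'rV[C]_10) : frame_map a z \in peirce triple 0 e.
Proof. by rewrite frame_mapE; exact: frame_mem. Qed.

Lemma frame_map_inv a x : a != 0 -> x \in peirce triple 0 e ->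
  frame_map a (\row_i (a^-1 * c i x)) = x.
Proof.
move=> a0 xW; rewrite frame_mapE [RHS](bE xW); apply: eq_bigr => i _.
by rewrite mxE mulrA divff // mul1r.
Qed.

Lemma frame_map_img a : a != 0 -> (frame_map a @: fullv)%VS = peirce triple 0 e.
Proof.
move=> a0; apply/vspaceP => x; apply/memv_imgP/idP => [[z _ ->]|xW].
  exact: frame_map_mem.
by exists (\row_i (a^-1 * c i x)); [exact: memvf | rewrite frame_map_inv].
Qed.

Lemma frame_map_ker a : a != 0 -> (fullv :&: lker (frame_map a) = 0)%VS.
Proof.
move=> a0; rewrite capfv; apply/eqP; rewrite -subv0; apply/subvP => z; rewrite memv_ker => /eqP hz.
rewrite memv0; apply/eqP/rowP => i; apply: (mulfI a0).
by rewrite -frame_map_coord hz /c tf0l mxE mulr0.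
Qed.

Lemma frame_map_h a (u v : 'rV[C]_10) : h (frame_map a u) (frame_map a v) = a * a^* * hermIV u v.
Proof.
rewrite /h /hermIV mulr_sumr; apply: eq_bigr => i _.
by rewrite !frame_map_coord rmorphM /= mulrACA.
Qed.

Lemma frame_map_s a (u : 'rV[C]_10) : s (frame_map a u) = a ^+ 2 * dotIV u u.
Proof.
rewrite /s /dotIV mulr_sumr; apply: eq_bigr => i _.
by rewrite !frame_map_coord exprMn -expr2.
Qed.

Lemma V0_typeIV : triple_isomorphic (@tripleIV R 10) fullv triple (peirce triple 0 e).
Proof.
exists (frame_map 1); split; [exact: frame_map_img (oner_neq0 _)|exact: frame_map_ker (oner_neq0 _)|].
move=> u v z _ _ _; have uW := frame_map_mem 1 u; have vW := frame_map_mem 1 v.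
have zW := frame_map_mem 1 z.
rewrite (peirce0_triple Ee uW vW zW) (frame_herm _ vW) (frame_herm _ vW) !frame_map_h.
rewrite rmorph1 !mul1r (frame_herm _ (peirce0_conj_mem Ee zW)).
have -> : J (frame_map 1 v) = frame_map 1 (map_mx (@conjc R) v).
  rewrite [LHS](bE (peirce0_conj_mem Ee vW)) [RHS]frame_mapE; apply: eq_bigr => i _.
  have := frame_conj i vW; rewrite /c => ->; rewrite -/(c i _) frame_map_coord.
  by rewrite !mul1r mxE.
have -> : h (frame_map 1 u) (J (frame_map 1 z)) = dotIV u z.
  apply: eq_bigr => i _; rewrite (frame_conj i zW) conjCK !frame_map_coord.
  by rewrite !mul1r.
by rewrite /tripleIV !linearD linearN !linearZ.
Qed.

Lemma V0_lie_ball : linearly_equivalent fullv (@lie_ball R 10) (peirce triple 0 e)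
  (symmetric_domain triple (peirce triple 0 e)).
Proof.
(* With this scale h becomes 2 |z|^2 and s/2 becomes the sum of the z_i^2, so the inequalities 1 - h
   + |s/2|^2 > 0 and h < 2 turn into those of the Lie ball. *)
pose a : C := sqrtC 2.
have aa : a * a = 2 by rewrite -expr2 sqrtCK.
have a0 : a != 0 by rewrite sqrtC_eq0 pnatr_eq0.
have ac : a^* = a by rewrite conj_Creal // ger0_real // sqrtC_ge0 ler0n.
exists (frame_map a); split; [exact: frame_map_img a0|exact: frame_map_ker a0|].
rewrite frame_domain.
have l2 (t : C) : (2 * t < 2) = (t < 1) by rewrite -[X in _ < X]mulr1 ltr_pM2l ?ltr0n.
have key (z : 'rV[C]_10) : (0 < 1 - h (frame_map a z) (frame_map a z) + q0 (frame_map a z) (frame_map a z) /\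
    h (frame_map a z) (frame_map a z) < 2) <-> lie_ball z.
  rewrite /lie_ball /= frame_map_h /q0 frame_map_s ac expr2 aa mulKf ?pnatr_eq0 // -normCK.
  by rewrite l2.
apply/seteqP; split=> x.
  move=> [z hz <-]; split; first exact: frame_map_mem.
  exact/key.
move=> [xW hx]; exists (\row_i (a^-1 * c i x)); last exact: frame_map_inv.
by apply/key; rewrite (frame_map_inv a0 xW).
Qed.

End LieBall.

Theorem proposition3p5 (R : realType) :
  let V1 (e : H3O R) := peirce triple 1 e in
  let V0 (e : H3O R) := peirce triple 0 e in
  let V2p (e : H3O R) := peirce2_plus triple e in
  let Omega_ (e : H3O R) := symmetric_domain triple (V0 e) in
  let d1 : set (H3O R) := boundary 1 in
  let d2 : set (H3O R) := boundary 2 in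
  let d3 : set (H3O R) := boundary 3 in
  (* 1 *)
  [/\ [/\ locally_closed (realify @` d1),
          submanifold_codim 1 d1,
          exists d, submanifold d (E1 : set (H3O R)),
          E1 = [set e : H3O R | minimal_tripotent triple e]
        & E1 `<=` d1]
    & forall e : H3O R, E1 e ->
      [/\ [/\ tangent_direction d1 e
                (sum3 (imaginary (real_line e)) [set` V1 e] [set` V0 e]),
              direct3 (imaginary (real_line e)) [set` V1 e] [set` V0 e]
            & normal_directions
                (sum3 (imaginary (real_line e)) [set` V1 e] [set` V0 e])
              = real_line e],
          \dim (V1 e) = 16%N /\ \dim (V0 e) = 10%N,
          triple_closed triple (V0 e),
          triple_isomorphic (@tripleIV R 10) fullv triple (V0 e)
        & linearly_equivalent fullv (@lie_ball R 10) (V0 e) (Omega_ e)] ]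
  /\
  (* 2 *)
  [/\ [/\ locally_closed (realify @` d2),
          submanifold 44 d2,
          CR_submanifold 17 10 d2
        & [/\ exists d, submanifold d (E2 : set (H3O R)),
              E2 = [set e : H3O R | rank_tripotent triple 2 e]
            & E2 `<=` d2] ]
    & forall e : H3O R, E2 e ->
      let T := sum3 (imaginary (V2p e)) [set` V1 e] [set` V0 e] in
      [/\ [/\ tangent_direction d2 e T,
              direct3 (imaginary (V2p e)) [set` V1 e] [set` V0 e],
              normal_directions T = V2p e
            & is_real_dim (V2p e) 10],
          \dim (V1 e) = 16%N /\ \dim (V0 e) = 1%N,
          d2 `&` translate e T = d2 `&` translate e [set` V0 e],
          d2 `&` translate e [set` V0 e] = translate e (Omega_ e)
        & triple_closed triple (V0 e) /\
          Omega_ e = [set x | x \in V0 e /\ h3_herm x x < 1] ] ]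
  /\
  (* 3 *)
  [/\ d3 = E3,
      E3 = [set e : H3O R | maximal_tripotent triple e],
      compact (realify @` d3),
      totally_real d3
    & submanifold 27 d3].
Proof.
move=> V1 V0 V2p Omega_ d1 d2 d3; split; [split; [split|] | split; [split; [split|] | split]].
- exact: locally_closed_boundary1.
- exact: submanifold_boundary1.
- by exists 33%N; exact: submanifold_E1.
- by apply/seteqP; split=> e /minimalP.
- exact: E1_boundary1.
- move=> e Ee; have [b [bW bJ bo bE]] := peirce0_real_basis Ee.
  split; [split|split| | |].
  + exact: E1_tangent.
  + exact: E1_direct.
  + exact: E1_normal.
  + exact: dim_rank1_peirce1.
  + exact: dim_rank1_peirce0.
  + exact: peirce0_closed.
  + exact: (V0_typeIV Ee bW bJ bo bE).
  + exact: (V0_lie_ball Ee bW bJ bo bE).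
- exact: locally_closed_boundary2.
- exact: submanifold_boundary2.
- exact: CR_boundary2.
- split; [by exists 42%N; exact: submanifold_E2 | | exact: E2_boundary2].
  by apply/seteqP; split=> e /rank2P.
- move=> e Ee T; have se : sharp e = cj (cj (sharp e)) by rewrite cjK.
  have dom : Omega_ e = [set x | x \in V0 e /\ h3_herm x x < 1].
    exact: disc_symmetric_domain.
  split; [split|split| | |split].
  + exact: (E2_tangent Ee se).
  + exact: (E2_direct Ee se).
  + exact: (E2_normal Ee se).
  + exact: (E2_V2p_dim Ee se).
  + exact: (dim_E2_peirce1 Ee se).
  + exact: (dim_E2_peirce0 Ee se).
  + exact: boundary2_tangent.
  + by rewrite dom; exact: boundary2_V0.
  + exact: disc_closed.
  + exact: dom.
- by apply/seteqP; split=> e /boundary3_E3.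
- by apply/seteqP; split=> e /maximalP.
- exact: compact_boundary3.
- exact: totally_real_boundary3.
- exact: submanifold_boundary3.
Qed.
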